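(* Let $\{X_i, i\in J\}$ be a locally dependent family of nonnegative integer-valued random variables with neighbourhoods $A_i\subseteq B_i\subseteq C_i$, let $W=\sum_{i\in J}X_i$, and assume $\mathbf{E}W^3<\infty$. With the target variables $M_1,M_2$ (with the parameters matched to $W$) and the quantities $\Theta_1,\Theta_2,\Xi_{i,1},\Xi_{i,2},\delta$ defined in the context, the following hold. (i) If $\mathbf{E}W<\operatorname{Var}W$ and $\lambda\bar q<(r\bar q+\lambda\bar p)/2$, then $$d_{TV}(W,M_2)\le \Theta_2\sum_{i\in J}\Xi_{i,2}.$$ (ii) If $\mathbf{E}W>\operatorname{Var}W$ and $\lambda p/q< p\lfloor n+\lambda/p\rfloor/2$, then $$d_{TV}(W,M_1)\le \Theta_1\left[\sum_{i\in J}\Xi_{i,1}+\frac{\delta p^2}{q}\right].$$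
   Context: Local dependence. $J$ is a finite subset of $\mathbf{N}$ and $\{X_i,i\in J\}$ are nonnegative integer-valued random variables. For $A\subseteq J$, $X_A=\{X_i,i\in A\}$, $X_A^*=\sum_{i\in A}X_i$, and $A^c=J\setminus A$. The family is locally dependent if for each $i\in J$ there are sets $i\in A_i\subseteq B_i\subseteq C_i\subseteq J$ such that $X_i$ is independent of $X_{A_i^c}$, $X_{A_i}$ is independent of $X_{B_i^c}$, and $X_{B_i}$ is independent of $X_{C_i^c}$. Distance. $d_{TV}(W,M)=\sup_{A}|\mathbf{P}(W\in A)-\mathbf{P}(M\in A)|$, the supremum over sets $A$ of nonnegative integers. For a finite signed measure $\nu$ on $\mathbf{Z}$, $\|\nu\|_{TV}=\sum_k|\nu(\{k\})|$. Target distributions. $M_1\sim B(n,p)*\mathcal{P}(\lambda)$ (convolution of a binomial and a Poisson law), $q=1-p$; $M_2\sim NB(r,\bar p)*\mathcal{P}(\lambda)$, $\bar q=1-\bar p$, where $NB(r,\bar p)$ has mass $\binom{r+k-1}{k}\bar p^{\,r}\bar q^{\,k}$ at $k=0,1,2,\dots$ (here $r>0$ is real). The value of $\lambda$ is the one belonging to the case considered. Parameters. For a random variable $X$ with probability generating function $\phi_X$, $\Gamma_j(X)=\frac{d^j}{dz^j}\log\phi_X(z)|_{z=1}$ is the $j$-th factorial cumulant. With $m_j=\mathbf{E}W^j$: $\Gamma_1(W)=m_1$, $\Gamma_2(W)=m_2-m_1^2-m_1$, $\Gamma_3(W)=m_3-3m_1m_2+2m_1^3-3m_2+3m_1^2+2m_1$.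 The parameters are chosen by matching the first three factorial cumulants of $W$ and of the target (up to rounding of $n$): for $M_1$: $n=\left\lfloor -\frac{4\Gamma_2(W)^3}{\Gamma_3(W)^2}\right\rfloor$, $p=-\frac{\Gamma_3(W)}{2\Gamma_2(W)}$, $\lambda=\mathbf{E}W-np$, $\delta=-\frac{4\Gamma_2(W)^3}{\Gamma_3(W)^2}-n$; for $M_2$: $r=\frac{4\Gamma_2(W)^3}{\Gamma_3(W)^2}$, $\bar p=\frac{2\Gamma_2(W)}{2\Gamma_2(W)+\Gamma_3(W)}$, $\lambda=\mathbf{E}W-\frac{r\bar q}{\bar p}$. It is assumed that these give admissible parameters ($n\ge1$, $0<p<1$, $\lambda>0$, respectively $r>0$, $0<\bar p<1$, $\lambda>0$) in the case considered. Constants. $$\theta_1=\frac{\lambda}{\lfloor n+\lambda/p\rfloor q},\quad \theta_2=\frac{\lambda\bar q}{r\bar q+\lambda\bar p},\quad \Theta_1=\frac{\theta_1q}{(1-2\theta_1)\lambda p},\quad \Theta_2=\frac{\theta_2}{(1-2\theta_2)\lambda\bar q}.$$ Smoothness. $I_1,I_0$ are the point masses at $1$ and $0$, $\mathcal{L}(W|X_{C_i})$ is the conditional law of $W$ given $X_{C_i}$, and $D(W|X_{C_i})=\|\mathcal{L}(W|X_{C_i})*(I_1-I_0)^{*2}\|_{TV}$, a random variable depending on $X_{C_i}$; $\operatorname{ess}$ denotes essential supremum. Let $\beta_1=-p/q$, $\beta_2=\bar q$, and for $j=1,2$ $$\Xi_{i,j}=9\sum\nolimits_{(\mathbf{E})}\Big[(1-\beta_j)\mathbf{E}X_i(\mathbf{E})X_{A_i}^*(\mathbf{E})X_{B_i}^*(\mathbf{E})X_{C_i}^*+\beta_j\mathbf{E}X_i(\mathbf{E})X_{B_i}^*(\mathbf{E})X_{C_i}^*\Big]\operatorname{ess}D(W|X_{C_i}).$$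 Here $\sum_{(\mathbf{E})}$ is the sum over all choices of keeping or deleting each bracketed $(\mathbf{E})$, where in each resulting expression every $\mathbf{E}$ applies to the product of the variables following it up to the next $\mathbf{E}$; thus the first expression contributes 8 terms (for instance $\mathbf{E}[X_iX_{A_i}^*X_{B_i}^*X_{C_i}^*]$, $\mathbf{E}[X_i]\,\mathbf{E}[X_{A_i}^*X_{B_i}^*X_{C_i}^*]$, $\mathbf{E}[X_iX_{A_i}^*]\,\mathbf{E}[X_{B_i}^*X_{C_i}^*]$, ...) and the second contributes 4 terms. *)

(* Defs.v *)
From HB Require Import structures.
From mathcomp Require Import all_boot all_order all_algebra.
From mathcomp Require Import finmap.
From mathcomp Require Import all_classical all_reals all_analysis ess_sup_inf.

Set Implicit Arguments.
Unset Strict Implicit.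
Unset Printing Implicit Defensive.

Import Order.TTheory GRing.Theory Num.Theory.
Import numFieldNormedType.Exports.

Local Open Scope classical_set_scope.
Local Open Scope ring_scope.

Section LocalDependence.
Context {d : measure_display} {T : measurableType d} {R : realType}.
Variable P : probability T R.

(* Independence of random elements with values in countable types, all of
   whose subsets are measurable. *)
Definition independent_elements {U V : countType} (Y : T -> U) (Z : T -> V) :=
  forall (E : set U) (F : set V),
    P (Y @^-1` E `&` Z @^-1` F) = (P (Y @^-1` E) * P (Z @^-1` F))%E.

Context {I : finType}.
Variable X : I -> T -> nat.

(* The random vector X_A, with the coordinates outside of A set to 0. *)
Definition subfamily (A : {set I}) (t : T) : {ffun I -> nat} :=
  [ffun i => if i \in A then X i t else 0%N].

Definition subsum (A : {set I}) (t : T) : nat := (\sum_(i in A) X i t)%N.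

Definition rvsum (t : T) : nat := (\sum_i X i t)%N.

Definition locally_dependent (A B C : I -> {set I}) :=
  forall i : I,
    [/\ i \in A i, A i \subset B i & B i \subset C i] /\
    [/\ independent_elements (X i) (subfamily (~: A i)%SET),
        independent_elements (subfamily (A i)) (subfamily (~: B i)%SET) &
        independent_elements (subfamily (B i)) (subfamily (~: C i)%SET)].

End LocalDependence.

Section DiscreteLaws.
Context {R : realType}.
Local Open Scope ereal_scope.

Definition dTV (mu nu : set nat -> \bar R) : \bar R :=
  ereal_sup [set `|mu A - nu A| | A in [set: set nat]].

Definition law_conv (mu nu : set nat -> \bar R) : set nat -> \bar R :=
  fun U => \esum_(x in [set x : nat * nat | U (x.1 + x.2)%N])
    (mu [set x.1] * nu [set x.2]).

(* The generalized binomial coefficient (r + k - 1 choose k) is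
   r (r + 1) ... (r + k - 1) / k!. *)
Definition negbin_pmf (r p : R) (k : nat) : R :=
  ((\prod_(i < k) (r + i%:R)) / k`!%:R * p `^ r * (1 - p) ^+ k)%R.

Definition negbin_prob (r p : R) : set nat -> \bar R :=
  fun U => \esum_(k in U) (negbin_pmf r p k)%:E.

(* [poisson_prob] takes a second argument on which it does not depend. *)
Definition law_M1 (n : nat) (p lambda : R) : set nat -> \bar R :=
  law_conv (binomial_prob n p) (poisson_prob lambda 0%N).

Definition law_M2 (r pbar lambda : R) : set nat -> \bar R :=
  law_conv (negbin_prob r pbar) (poisson_prob lambda 0%N).

End DiscreteLaws.

(* A finite signed measure on the integers is represented by its masses. *)
Section SignedMeasures.
Context {R : realType}.

Definition point_mass (a : int) : int -> R := fun k => (k == a)%:R.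

(* The convolution nu * g for a measure g with finite support, so that the sum
   over all the integers has only finitely many nonzero terms. *)
Definition fsconv (nu g : int -> R) : int -> R :=
  fun k => \sum_(j \in [set: int]) nu (k - j) * g j.

Definition norm_TV (nu : int -> R) : \bar R :=
  (\esum_(k in [set: int]) `|nu k|%:E)%E.

Definition second_difference : int -> R :=
  let g := point_mass 1 \- point_mass 0 in fsconv g g.

End SignedMeasures.

Section Cumulants.
Context {d : measure_display} {T : measurableType d} {R : realType}.
Variable P : probability T R.
Local Open Scope ereal_scope.

Definition nmean (Y : T -> nat) : \bar R := 'E_P[fun t => (Y t)%:R].

Definition pgf (Y : T -> nat) (z : R) : R :=
  fine 'E_P[fun t => (z ^+ Y t)%R].

Definition left_derive (f : R -> R) (x : R) : R :=
  lim ((h^-1 * (f (x + h) - f x))%R @[h --> 0^'-]).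

(* The generating function may be infinite to the right of 1, even if the first
   three moments are finite, so the derivatives at 1 are taken from the left. *)
Definition fact_cumulant (j : nat) (Y : T -> nat) : R :=
  iter j left_derive (fun z => ln (pgf Y z)) 1%R.

End Cumulants.

Section Constants.
Context {R : realType}.
Implicit Types (n : nat) (r p pbar lambda : R).

Definition theta1 n p lambda : R :=
  lambda / ((Num.floor (n%:R + lambda / p))%:~R * (1 - p)).

Definition theta2 r pbar lambda : R :=
  lambda * (1 - pbar) / (r * (1 - pbar) + lambda * pbar).

Definition Theta1 n p lambda : R :=
  let th := theta1 n p lambda in
  th * (1 - p) / ((1 - 2 * th) * lambda * p).

Definition Theta2 r pbar lambda : R :=
  let th := theta2 r pbar lambda in
  th / ((1 - 2 * th) * lambda * (1 - pbar)).

End Constants.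

Section Smoothness.
Context {d : measure_display} {T : measurableType d} {R : realType}.
Variable P : probability T R.

(* The masses of the conditional law of W given Y, on the event that Y takes
   the value Y t; it is 0 on the null event that P (Y = Y t) = 0. *)
Definition cond_law {V : countType} (W : T -> nat) (Y : T -> V) (t : T) :
    int -> R :=
  fun k => fine (P [set s | (W s)%:Z = k /\ Y s = Y t]) /
           fine (P [set s | Y s = Y t]).

Definition smoothness {V : countType} (W : T -> nat) (Y : T -> V) (t : T) :
    \bar R :=
  norm_TV (fsconv (cond_law W Y t) second_difference).

Local Open Scope ereal_scope.

(* [bracketE Y [:: Z1; ...; Zk]] is the sum of the 2 ^ k expressions obtained
   from E Y (E)Z1 ... (E)Zk: if the first (E) is deleted then Z1 joins the
   current product, and if it is kept then the current product is closed. *)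
Fixpoint bracketE (Y : T -> nat) (s : seq (T -> nat)) : \bar R :=
  match s with
  | [::] => nmean P Y
  | Z :: s' => bracketE (fun t => Y t * Z t)%N s' + nmean P Y * bracketE Z s'
  end.

Context {I : finType}.
Variables (X : I -> T -> nat) (A B C : I -> {set I}).

Definition Xi (beta : R) (i : I) : \bar R :=
  9%:E *
  ((1 - beta)%:E *
     bracketE (X i) [:: subsum X (A i); subsum X (B i); subsum X (C i)] +
   beta%:E * bracketE (X i) [:: subsum X (B i); subsum X (C i)]) *
  ess_sup P (smoothness (rvsum X) (subfamily X (C i))).

End Smoothness.

(* Main.v *)
Require Import Defs.
From HB Require Import structures.
From mathcomp Require Import all_boot all_order all_algebra.
From mathcomp Require Import finmap ring lra zify.
From mathcomp Require Import all_classical all_reals all_analysis ess_sup_inf.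
From mathcomp Require Import measurable_realfun.

Set Implicit Arguments.
Unset Strict Implicit.
Unset Printing Implicit Defensive.

Import Order.TTheory GRing.Theory Num.Theory.
Import numFieldNormedType.Exports.

Local Open Scope classical_set_scope.
Local Open Scope ring_scope.

(** The proof is an instance of Stein's method, for a perturbed birth-death
    operator. Write [be] for [- p / q] in the binomial case and for
    [1 - pbar] in the negative binomial case, and [al = (1 - be) E W].

    The masses of a binomial or a negative binomial law satisfy
    [(k + 1) b (k + 1) = (x + be k) b k]. Convolution with a Poisson law of
    mean [lam] turns this into a second-order recursion
    ([conv_mass_recursion]), which says that under the target law the mean of
    [stein_op al be lam g k =
     (al + be k) g (k + 1) - k g k - lam be (g (k + 2) - g (k + 1))]
    vanishes ([sum_stein_op]). Without its last term this is the operator of a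
    birth-death chain with birth rates [al + be k] and death rates [k], and on
    an interval [0, K] the equation [(al + be k) g (k + 1) - k g k = f k - c]
    has an explicit solution whose increments are at most [1 / s]
    ([stein_solution]); here [s] is [al] in the negative binomial case and
    [(n + lam / p) p] in the binomial case. The last term is a perturbation:
    its means under [W] and under the target differ by at most
    [2 lam |be| / s] times the distance that is being estimated. As this factor
    is below 1, the distance is at most [1 / (1 - 2 lam |be| / s)] times what
    the unperturbed equation gives ([gap_contraction], [gap_bound]).

    It remains to bound the mean of [stein_op g] under [W]. Local dependence
    gives an expansion: one step ([Ex_cal_step]) passes from a neighbourhood to
    the next larger one, splits off an expectation by independence, and
    replaces the function by its difference. Along [i], [A i], [B i], [C i]
    this yields ([stein_op_expansion])
    [E (stein_op g W) = c1 E (g' (W + 1)) + c2 E (g'' (W + 1)) + remainder]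
    for differences [g'] and [g''], where the remainder contains only third
    differences of [g]. Since [c1] and [c2] do not depend on [g], they are
    found by inserting [g k = k] and [g k = k (k - 1) / 2], for which the
    remainder is zero; the matching of the cumulants makes [c2] vanish and
    [c1] equal to 0 or, because [n] is rounded, to [delta p^2 / q]
    ([stein_op_bound]). A third difference of [g] is a second difference of the
    bounded function [g'], so conditionally on the coordinates in [C i] its
    mean is at most [1 / s] times the smoothness [D (W | X_C)]
    ([cal_small_smooth], [smooth_given_ess]). The weights that accompany it
    add up to the eight-term sum minus the four-term sum ([rem3_bracket]) or,
    in the terms with slope [be], to less than that ([rem2_le_rem3]).

    The equation is not solved beyond [K], which costs a tail probability. In
    the negative binomial case [K] is arbitrary and the tails disappear. In the
    binomial case the birth rates change sign near [K = n + lam / p]; by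
    Chebyshev's inequality the tails are at most a multiple of
    [1 / max (Var W, 1)], while the smoothness is at least another multiple of
    it ([smooth_given_lower], with a cosine as test function). The tails are
    therefore absorbed in the sum of the [Xi], which explains the constant
    [9 = 2 + 7]: the expansion takes 2, the tails take 7.

    All this needs a finite fourth moment. If it is infinite, then so is one of
    the [Xi], again because the smoothness is positive, and there is nothing to
    prove ([fourth_moment_or_infinite_bracket], [Xi_infinite]). *)

(** * Expectations of functions of a countable-valued random element *)

Section Expectation.
Context {d : measure_display} {T : measurableType d} {R : realType}.
Variable P : probability T R.
Context {V : countType}.
Variable Y : T -> V.
Hypothesis mY : forall v, measurable (Y @^-1` [set v]).
Implicit Types F G : V -> R.

(** On a countable value space every function is measurable, so that
    integrability is the only condition to carry along. *)
Definition Ex F : R := \int[P]_t F (Y t).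

Definition integ F : Prop := P.-integrable setT (EFin \o (F \o Y)).

Lemma measurable_countable_preimage (U : set V) : measurable (Y @^-1` U).
Proof.
rewrite (_ : Y @^-1` U = \bigcup_(v in U) (Y @^-1` [set v])); last first.
  by apply/seteqP; split=> [t Ut|t [v Uv /= tv]]; [exists (Y t)|rewrite /= tv].
rewrite bigcup_mkcond; apply: countable_bigcupT_measurable => [|v].
  exact: countableP.
by case: ifP.
Qed.

Lemma measurable_fun_countable d' (T' : measurableType d') (F : V -> T') :
  measurable_fun setT (F \o Y).
Proof.
move=> _ B _; rewrite setTI.
exact: (measurable_countable_preimage (F @^-1` B)).
Qed.

Lemma integ_le F G : integ G -> (forall v, `|F v| <= G v) -> integ F.
Proof.
move=> iG FG; apply: (le_integrable _ _ _ iG) => //.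
  by apply/measurable_EFinP; exact: measurable_fun_countable.
by move=> t _ /=; rewrite lee_fin (le_trans (FG _)) ?ler_norm.
Qed.

Lemma integ_cst c : integ (fun=> c).
Proof. exact: finite_measure_integrable_cst. Qed.

Lemma integD F G : integ F -> integ G -> integ (fun v => F v + G v).
Proof. by move=> iF iG; have := integrableD measurableT iF iG. Qed.

Lemma integZ c F : integ F -> integ (fun v => c * F v).
Proof. by move=> iF; have := integrableZl measurableT c iF. Qed.

Lemma integN F : integ F -> integ (fun v => - F v).
Proof. by move=> iF; have := integrableN iF. Qed.

Lemma integB F G : integ F -> integ G -> integ (fun v => F v - G v).
Proof. by move=> iF iG; apply: integD => //; apply: integN. Qed.

Lemma integ_sum I (s : seq I) (Q : pred I) (F : I -> V -> R) :
  (forall i, integ (F i)) -> integ (fun v => \sum_(i <- s | Q i) F i v).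
Proof.
move=> iF; elim: s => [|i s IH].
  by under [X in integ X]eq_fun do rewrite big_nil; exact: integ_cst.
under [X in integ X]eq_fun do rewrite big_cons.
by case: (Q i) => //; apply: integD.
Qed.

Lemma Ex_ge0 F : (forall v, 0 <= F v) -> 0 <= Ex F.
Proof. by move=> F0; apply: Rintegral_ge0. Qed.

Lemma Ex_cst c : Ex (fun=> c) = c.
Proof. rewrite /Ex (Rintegral_cst P measurableT) -[RHS]mulr1.
by congr (c * _); exact: (congr1 fine (probability_setT P)).
Qed.

Lemma ExD F G : integ F -> integ G -> Ex (fun v => F v + G v) = Ex F + Ex G.
Proof. by move=> iF iG; rewrite /Ex RintegralD. Qed.

Lemma ExB F G : integ F -> integ G -> Ex (fun v => F v - G v) = Ex F - Ex G.
Proof. by move=> iF iG; rewrite /Ex RintegralB. Qed.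

Lemma ExZ c F : integ F -> Ex (fun v => c * F v) = c * Ex F.
Proof. by move=> iF; rewrite /Ex RintegralZl. Qed.

Lemma Ex_sum I (s : seq I) (Q : pred I) (F : I -> V -> R) :
  (forall i, integ (F i)) ->
  Ex (fun v => \sum_(i <- s | Q i) F i v) = \sum_(i <- s | Q i) Ex (F i).
Proof.
move=> iF; elim: s => [|i s IH].
  by rewrite big_nil; under eq_fun do rewrite big_nil; exact: Ex_cst.
rewrite big_cons; under eq_fun do rewrite big_cons.
by case: (Q i) => //; rewrite ExD ?IH//; exact: integ_sum.
Qed.

Lemma le_Ex F G : integ F -> integ G -> (forall v, F v <= G v) -> Ex F <= Ex G.
Proof. by move=> iF iG FG; apply: le_Rintegral. Qed.

Lemma le_abs_Ex F G : integ F -> integ G -> (forall v, `|F v| <= G v) ->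
  `|Ex F| <= Ex G.
Proof.
move=> iF iG FG; rewrite ler_norml -mulN1r -ExZ//; apply/andP; split.
  by apply: le_Ex => // [|v]; [exact: integZ|];
    rewrite mulN1r; have := FG v; rewrite ler_norml => /andP[].
by apply: le_Ex => // v; have := FG v; rewrite ler_norml => /andP[].
Qed.

(** The level sets of [y] cut the sample space into countably many pieces.
    Multiplying by their indicators instead of conditioning on them avoids
    any division by the probability of a null level set. *)
Lemma ge0_Ex_partition (U : countType) (y : V -> U) F : integ F ->
  (forall u, 0 <= Ex (fun v => F v * (y v == u)%:R)) -> 0 <= Ex F.
Proof.
move=> iF F0; apply: fine_ge0.
pose C n := [set t | choice.pickle (y (Y t)) = n].
have CT : \bigcup_n C n = setT.
  by apply/seteqP; split=> // t _; exists (choice.pickle (y (Y t))).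
have mC n : measurable (C n) by exact: (measurable_countable_preimage
  [set v | choice.pickle (y v) = n]).
rewrite -CT integral_bigcup//; last 2 first.
- apply/trivIsetP => i j _ _ /eqP ij; rewrite -subset0 => t [Ci Cj].
  by exfalso; apply: ij; rewrite -Ci -Cj.
- by rewrite CT.
apply: nneseries_ge0 => n _ _.
rewrite integral_mkcond.
have [[u un]|nu] := pselect (exists u : U, choice.pickle u = n).
  have := F0 u; rewrite /Ex /Rintegral.
  rewrite (_ : (fun t => (F (Y t) * (y (Y t) == u)%:R)%:E) =
     (fun t => (F (Y t))%:E) \_ (C n)).
    move=> h; rewrite -(@fineK _ (integral _ _ _)) ?lee_fin//.
    apply: integrable_fin_num => //.
    by rewrite -integrable_mkcond//; exact: integrableS iF.
  apply/funext => t; rewrite patchE; case: ifPn.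
    rewrite inE /C/= -un => /(pcan_inj choice.pickleK) ->; by rewrite eqxx mulr1.
  rewrite notin_setE /C/= -un => h; case: eqP => [E|]; last by rewrite mulr0.
  by exfalso; apply: h; rewrite E.
rewrite integral0_eq// => t _; rewrite patchE; case: ifPn => //.
by rewrite inE => h; exfalso; apply: nu; exists (y (Y t)).
Qed.

Lemma integ_indic (Q : pred V) F : integ F -> integ (fun v => F v * (Q v)%:R).
Proof.
move=> iF; apply: (@integ_le _ (fun v => `|F v|)).
  by have := integrable_norm iF.
by move=> v; rewrite normrM; case: (Q v); rewrite ?normr1 ?mulr1// normr0 mulr0.
Qed.

Lemma integ_ind (Q : pred V) : integ (fun v => (Q v)%:R).
Proof.
rewrite (_ : (fun v => _) = (fun v => 1 * (Q v)%:R)).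
  by apply: integ_indic; exact: integ_cst.
by apply/funext => v; rewrite mul1r.
Qed.

Lemma integ_bounded F M : (forall v, `|F v| <= M) -> integ F.
Proof. by apply: integ_le; exact: integ_cst. Qed.

(** A bound that holds given the value of [y] holds unconditionally; this
    takes the place of the tower property of conditional expectations. *)
Lemma le_abs_Ex_partition (U : countType) (y : V -> U) F G :
  integ F -> integ G ->
  (forall u, `|Ex (fun v => F v * (y v == u)%:R)| <=
     Ex (fun v => G v * (y v == u)%:R)) -> `|Ex F| <= Ex G.
Proof.
move=> iF iG FG; rewrite ler_norml; apply/andP; split.
  rewrite -subr_ge0 opprK -ExD//; apply: (ge0_Ex_partition (y := y)).
    exact: integD.
  move=> u; under eq_fun do rewrite mulrDl.
  rewrite ExD; [|exact: integ_indic|exact: integ_indic].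
  by have := FG u; rewrite ler_norml -subr_ge0 opprK => /andP[].
rewrite -subr_ge0 -ExB//; apply: (ge0_Ex_partition (y := y)).
  exact: integB.
move=> u; under eq_fun do rewrite mulrBl.
rewrite ExB; [|exact: integ_indic|exact: integ_indic].
by have := FG u; rewrite ler_norml subr_ge0 => /andP[].
Qed.

Lemma eq_Ex_partition (U : countType) (y : V -> U) F G :
  integ F -> integ G ->
  (forall u, Ex (fun v => F v * (y v == u)%:R) =
     Ex (fun v => G v * (y v == u)%:R)) -> Ex F = Ex G.
Proof.
move=> iF iG FG; apply/eqP; rewrite -subr_eq0 -ExB// -normr_le0 -(Ex_cst 0).
apply: (le_abs_Ex_partition (y := y)); [exact: integB|exact: integ_cst|].
move=> u; under eq_fun do rewrite mulrBl.
rewrite ExB ?FG ?subrr ?normr0; [|exact: integ_indic..].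
by apply: Ex_ge0 => v; rewrite mul0r.
Qed.

Lemma Ex_indic (Q : pred V) : Ex (fun v => (Q v)%:R) = fine (P [set t | Q (Y t)]).
Proof.
have mQ : measurable [set t | Q (Y t)].
  exact: (measurable_countable_preimage [set v | Q v]).
rewrite /Ex /Rintegral -[in RHS](setIT [set t | Q (Y t)]) -integral_indic//.
congr fine; apply: eq_integral => t _; rewrite indicE /=.
have [h|h] := boolP (Q (Y t)); first by rewrite mem_set.
by rewrite memNset//; exact/negP.
Qed.

Lemma Ex_indicE (Q : pred V) : (Ex (fun v => (Q v)%:R))%:E = P [set t | Q (Y t)].
Proof. by rewrite Ex_indic fineK// fin_num_measure//;
  exact: (measurable_countable_preimage [set v | Q v]). Qed.

(** Singletons suffice because the value spaces are countable. *)
Definition indep (U1 U2 : countType) (y : V -> U1) (z : V -> U2) :=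
  forall u w, Ex (fun v => (y v == u)%:R * (z v == w)%:R) =
    Ex (fun v => (y v == u)%:R) * Ex (fun v => (z v == w)%:R).

(** Partitioning by [y] and then by [z] makes each factor constant in turn,
    and only the joint masses are left. *)
Lemma indep_Ex (U1 U2 : countType) (y : V -> U1) (z : V -> U2) (f g : _ -> R) :
  indep y z -> integ (f \o y) -> integ (g \o z) ->
  integ (fun v => f (y v) * g (z v)) ->
  Ex (fun v => f (y v) * g (z v)) = Ex (f \o y) * Ex (g \o z).
Proof.
move=> yz iF iG iFG.
transitivity (Ex (fun v => Ex (g \o z) * f (y v))); last by rewrite ExZ// mulrC.
apply: (eq_Ex_partition (y := y)) => //; first exact: integZ.
move=> u.
pose i1 v : R := (y v == u)%:R.
have ii1 : integ i1 by exact: integ_ind.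
transitivity (f u * Ex (fun v => g (z v) * i1 v)).
  rewrite -ExZ; last exact: integ_indic.
  congr Ex; apply/funext => v; rewrite /i1; case: eqP => [->|]; by
    rewrite ?mulr1 ?mulr0.
transitivity (f u * (Ex (g \o z) * Ex i1)); last first.
  rewrite -ExZ// -ExZ; last exact: integZ.
  congr Ex; apply/funext => v; rewrite /i1; case: eqP => [->|];
    rewrite ?mulr1 ?mulr0//; first exact: mulrC.
congr (_ * _).
transitivity (Ex (fun v => Ex i1 * g (z v))); last by rewrite ExZ// mulrC.
apply: (eq_Ex_partition (y := z)); [exact: integ_indic|exact: integZ|].
move=> w.
have -> : (fun v => g (z v) * i1 v * (z v == w)%:R) =
  (fun v => g w * (i1 v * (z v == w)%:R)).
  by apply/funext => v; case: eqP => [->|]; rewrite ?mulr1 ?mulr0.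
have -> : (fun v => Ex i1 * g (z v) * (z v == w)%:R) =
  (fun v => g w * Ex i1 * (z v == w)%:R).
  by apply/funext => v; case: eqP => [->|];
    rewrite ?mulr1 ?mulr0 1?mulrC.
rewrite ExZ ?ExZ ?yz ?mulrA//; last exact: integ_indic.
exact: integ_ind.
Qed.

End Expectation.

(** * Stein equations of birth-death chains *)

Section BirthDeath.
Context {R : realFieldType}.
Variables (al : nat -> R) (K : nat).
Hypothesis K_gt0 : (0 < K)%N.
Hypothesis al_gt0 : forall k, (k < K)%N -> 0 < al k.
Hypothesis al_step : forall k, (k.+1 < K)%N -> al k.+1 - al k <= 1.

(** The reversible measure of the chain with birth rates [al] and death rates
    [k], normalized to 1 at 0; [bd_balance] is detailed balance. *)
Definition bd_mass (k : nat) : R := \prod_(i < k) (al i / i.+1%:R).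
Local Notation m := bd_mass.
Definition bd_below (k : nat) : R := \sum_(0 <= i < k) m i.
Local Notation F := bd_below.
Definition bd_above (k : nat) : R := \sum_(k <= i < K.+1) m i.
Local Notation G := bd_above.

Lemma bd_mass_gt0 k : (k <= K)%N -> 0 < m k.
Proof.
move=> kK; apply: prodr_gt0 => i _; apply: divr_gt0; last by rewrite ltr0n.
by apply: al_gt0; exact: leq_trans (ltn_ord i) kK.
Qed.

Lemma bd_balance k : k.+1%:R * m k.+1 = al k * m k.
Proof.
have -> : m k.+1 = m k * (al k / k.+1%:R) by rewrite /m big_ord_recr.
by rewrite mulrC -mulrA divfK ?pnatr_eq0// mulrC.
Qed.

Lemma bd_belowS k : F k.+1 = F k + m k.
Proof. by rewrite /F big_nat_recr. Qed.

Lemma bd_aboveS k : (k <= K)%N -> G k = m k + G k.+1.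
Proof. by move=> kK; rewrite /G big_ltn. Qed.

Lemma bd_below_above k : (k <= K.+1)%N -> F k + G k = F K.+1.
Proof. by move=> kK; rewrite /F /G -big_cat_nat. Qed.

Lemma bd_below_ge0 k : (k <= K.+1)%N -> 0 <= F k.
Proof.
move=> kK; rewrite /F big_nat_cond; apply: sumr_ge0 => i /andP[/andP[_ ik] _].
by apply/ltW/bd_mass_gt0; rewrite -ltnS (leq_trans ik).
Qed.

Lemma bd_above_ge0 k : 0 <= G k.
Proof.
rewrite /G big_nat_cond; apply: sumr_ge0 => i /andP[/andP[_ ik] _].
exact/ltW/bd_mass_gt0.
Qed.

Lemma bd_total_gt0 : 0 < F K.+1.
Proof.
rewrite bd_belowS; apply: ltr_wpDl; first exact: bd_below_ge0.
exact: bd_mass_gt0.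
Qed.

(** By [al_step] the difference [al k - k] is nonincreasing, so the inequality
    passes from [k] to [k + 1]. Together with its mirror image
    [bd_above_mono] it fixes the signs in the proof of [bd_sol_diff]. *)
Lemma bd_below_mono k : (k < K)%N -> al k * F k <= k%:R * F k.+1.
Proof.
move=> kK.
suff: (al k - k%:R) * F k <= k%:R * m k.
  by rewrite bd_belowS mulrBl mulrDr lerBlDl.
elim: k kK => [|k IH] kK.
  by rewrite /F big_geq// mulr0 mul0r.
have kK' : (k < K)%N by exact: ltnW.
have mk := bd_mass_gt0 (ltnW kK').
have Fk := bd_below_ge0 (leqW (ltnW kK')).
have Fk1 := bd_below_ge0 (leqW (ltnW kK)).
have x1 : al k.+1 - k.+1%:R <= al k - k%:R.
  by have := al_step kK; rewrite -natr1; lra.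
have [x0|x0] := leP (al k.+1 - k.+1%:R) 0.
  apply: (@le_trans _ _ 0); first by rewrite mulr_le0_ge0.
  by rewrite mulr_ge0// ltW// bd_mass_gt0// ltnW.
rewrite bd_balance; apply: (@le_trans _ _ ((al k - k%:R) * F k.+1)).
  by rewrite ler_wpM2r.
by rewrite bd_belowS mulrDr; have := IH kK'; lra.
Qed.

Lemma bd_above_mono k : (k < K)%N -> k%:R * G k.+1 <= al k * G k.
Proof.
move=> kK.
suff: (k%:R - al k) * G k.+1 <= al k * m k.
  by rewrite (bd_aboveS (ltnW kK)) mulrBl mulrDr lerBlDr.
have [n nE] : exists n, n = (K - k.+1)%N by exists (K - k.+1)%N.
elim: n k kK nE => [|n IH] k kK nE.
  have kE : k.+1 = K by apply/eqP; rewrite eqn_leq kK -subn_eq0 -nE.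
  rewrite -bd_balance (@bd_aboveS k.+1)// {2}kE /G big_geq// addr0.
  have := al_gt0 kK; have := bd_mass_gt0 kK; rewrite -natr1.
  by move=> ? ?; rewrite ler_pM2r//; lra.
have k1K : (k.+1 < K)%N by rewrite -subn_gt0 -nE.
have mk := bd_mass_gt0 kK; have ak := al_gt0 kK; have ak1 := al_gt0 k1K.
have G2 := bd_above_ge0 k.+2.
have {}IH := IH k.+1 k1K ltac:(by rewrite subnS -nE).
rewrite -bd_balance (@bd_aboveS k.+1)//.
have x1 : k%:R - al k <= k.+1%:R - al k.+1.
  by have := al_step k1K; rewrite -natr1; lra.
apply: (@le_trans _ _ ((k.+1%:R - al k.+1) * (m k.+1 + G k.+2))).
  by apply: ler_wpM2r => //; apply: addr_ge0 => //; exact: ltW.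
by rewrite mulrDr; lra.
Qed.

Variable s : R.
Hypothesis s_gt0 : 0 < s.
Hypothesis s_le : s <= K%:R.
Hypothesis s_bound : forall k, (0 < k < K)%N ->
  s * (G k.+1 / al k + F k / k%:R) <= F K.+1.

Variable f : nat -> R.
Hypothesis f01 : forall k, 0 <= f k <= 1.

Definition bd_mean : R := (\sum_(0 <= i < K.+1) m i * f i) / F K.+1.
Local Notation c := bd_mean.

Definition bd_sum (k : nat) : R := \sum_(0 <= i < k) m i * (f i - c).
Local Notation S := bd_sum.

(** Multiplied by [bd_mass], the left side of the Stein equation telescopes,
    which forces this value for [1 <= k <= K]. The equation leaves [g 0]
    free; copying [g 1] makes the first increment vanish. *)
Definition bd_sol (k : nat) : R :=
  let j := maxn k 1 in if (j <= K)%N then S j / (j%:R * m j) else 0.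
Local Notation g := bd_sol.

Lemma bd_mean01 : 0 <= c <= 1.
Proof.
have Z0 := bd_total_gt0.
rewrite /c ler_pdivlMr// ler_pdivrMr// mul0r mul1r; apply/andP; split.
  rewrite big_nat_cond; apply: sumr_ge0 => i /andP[/andP[_ ik] _].
  by rewrite mulr_ge0//; [exact/ltW/bd_mass_gt0|case/andP: (f01 i)].
rewrite /F big_nat_cond [leRHS]big_nat_cond.
apply: ler_sum => i /andP[/andP[_ ik] _].
by rewrite ler_piMr//; [exact/ltW/bd_mass_gt0|case/andP: (f01 i)].
Qed.

Lemma bd_sumE k : S k = \sum_(0 <= i < k) m i * f i - c * F k.
Proof.
rewrite /S /F mulr_sumr -sumrB; apply: eq_bigr => i _.
by rewrite mulrBr [c * _]mulrC.
Qed.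

Lemma bd_sum_total : S K.+1 = 0.
Proof.
by rewrite bd_sumE /c divfK ?subrr// gt_eqF// bd_total_gt0.
Qed.

Lemma bd_sumS k : S k.+1 = S k + m k * (f k - c).
Proof. by rewrite /S big_nat_recr. Qed.

Lemma bd_sol0 : g 0%N = g 1%N. Proof. by []. Qed.

Lemma bd_sol_out k : (K < k)%N -> g k = 0.
Proof.
move=> Kk; rewrite /g (maxn_idPl _) ?(leq_trans _ Kk)//.
by rewrite leqNgt Kk.
Qed.

Lemma bd_solE k : (0 < k <= K)%N -> g k = S k / (k%:R * m k).
Proof. by move=> /andP[k0 kK]; rewrite /g (maxn_idPl _)// kK. Qed.

Lemma bd_sol_eq k : (k <= K)%N -> al k * g k.+1 - k%:R * g k = f k - c.
Proof.
move=> kK; have mk := bd_mass_gt0 kK.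
have gk : k%:R * g k = S k / m k.
  case: k kK mk => [|k] kK mk; first by rewrite /S big_geq// !mul0r.
  have x0 : k.+1%:R != 0 :> R by rewrite pnatr_eq0.
  rewrite bd_solE//; move: (k.+1%:R) (S k.+1) (m k.+1) x0 mk => x y z x0 z0.
  by field; rewrite x0 gt_eqF.
rewrite gk.
have [kltK|] := ltnP k K; last first.
  move=> Kk; have {kK Kk}kE : k = K by apply/eqP; rewrite eqn_leq kK.
  rewrite bd_sol_out ?kE// mulr0 sub0r.
  have := bd_sum_total; rewrite bd_sumS => /eqP; rewrite addr_eq0 => /eqP ->.
  by rewrite mulNr opprK mulrAC mulfV ?mul1r// -kE gt_eqF.
rewrite bd_solE//= bd_balance bd_sumS.
by field; rewrite !gt_eqF//; exact: al_gt0.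
Qed.

(** The increment is linear in [f]. The coefficient of [f k] is nonnegative,
    all the others are nonpositive by the two monotonicity lemmas, and they
    add up to zero; hence the indicator of [k] and its complement are the
    extreme cases, and these are covered by [s_bound]. The last increment,
    from [g K] to 0, is at most [1 / K]. *)
Lemma bd_sol_diff k : `|g k.+1 - g k| <= s^-1.
Proof.
have s0 : 0 <= s^-1 by rewrite invr_ge0 ltW.
have Z0 := bd_total_gt0.
case: k => [|k]; first by rewrite bd_sol0 subrr normr0.
have [kK|Kk] := ltnP k.+1 K; last first.
  rewrite (@bd_sol_out k.+2)// sub0r normrN.
  have [kE|kE] := ltnP K k.+1; first by rewrite bd_sol_out ?normr0.
  have {Kk kE}kE : k.+1 = K by apply/eqP; rewrite eqn_leq kE.
  have := bd_sol_eq (leqnn K); rewrite bd_sol_out// mulr0 sub0r kE => e.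
  have K0 : 0 < K%:R :> R by rewrite ltr0n.
  have -> : g K = - (f K - c) / K%:R.
    by rewrite -e opprK mulrAC mulfV ?mul1r// gt_eqF.
  rewrite normrM normrN normfV (gtr0_norm K0).
  apply: (@le_trans _ _ (1 * K%:R^-1)); last by rewrite mul1r lef_pV2.
  rewrite ler_pM2r ?invr_gt0// ler_norml.
  have := f01 K; have := bd_mean01; lra.
set n := k.+1 in kK *.
have n0 : 0 < n%:R :> R by rewrite ltr0n.
have mn := bd_mass_gt0 (ltnW kK); have an := al_gt0 kK.
rewrite !bd_solE//; [|by rewrite /= ltnW..].
rewrite bd_balance.
pose A := \sum_(0 <= i < n) m i * f i.
pose D := \sum_(n.+1 <= i < K.+1) m i * f i.
have A0 : 0 <= A.
  rewrite /A big_nat_cond; apply: sumr_ge0 => i /andP[/andP[_ ik] _].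
  apply: mulr_ge0; last by case/andP: (f01 i).
  by apply/ltW/bd_mass_gt0/ltnW/(leq_trans ik)/ltnW.
have AF : A <= F n.
  rewrite /A /F big_nat_cond [leRHS]big_nat_cond.
  apply: ler_sum => i /andP[/andP[_ ik] _].
  apply: ler_piMr; last by case/andP: (f01 i).
  by apply/ltW/bd_mass_gt0/ltnW/(leq_trans ik)/ltnW.
have D0 : 0 <= D.
  rewrite /D big_nat_cond; apply: sumr_ge0 => i /andP[/andP[_ ik] _].
  by apply: mulr_ge0; [exact/ltW/bd_mass_gt0|case/andP: (f01 i)].
have DG : D <= G n.+1.
  rewrite /D /G big_nat_cond [leRHS]big_nat_cond.
  apply: ler_sum => i /andP[/andP[_ ik] _].
  by apply: ler_piMr; [exact/ltW/bd_mass_gt0|case/andP: (f01 i)].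
have ZE : F K.+1 = F n + m n + G n.+1.
  by rewrite -(bd_below_above (leqW (ltnW kK))) (bd_aboveS (ltnW kK)) addrA.
have cE : c * F K.+1 = A + m n * f n + D.
  rewrite /c divfK ?gt_eqF// (@big_cat_nat _ _ _ n)//=; last exact/leqW/ltnW.
  by rewrite [X in _ + X]big_ltn ?addrA// ltnW.
have SnE : S n = A - c * F n by exact: bd_sumE.
have c01 := bd_mean01.
have e1 := bd_below_mono kK; have e2 := bd_above_mono kK.
have e3 : s * (G n.+1 / al n + F n / n%:R) <= F K.+1 by exact: s_bound.
move: e1 e2; rewrite bd_belowS (bd_aboveS (ltnW kK)) bd_sumS SnE => e1 e2.
have F0 := bd_below_ge0 (leqW (ltnW kK)); have G0 := bd_above_ge0 n.+1.
have fn := f01 n.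
clear SnE.
move: (F n) (G n.+1) (m n) (F K.+1) (al n) n%:R (f n) c A D
  n0 mn an A0 AF D0 DG ZE cE e1 e2 e3 F0 G0 fn Z0 => {}F {}G {}m Z a x y {}c {}A {}D
  x0 m0 a0 A0 AF D0 DG ZE cE e1 e2 e3 F0 G0 fn Z0.
(* [A], [m * y] and [D] are the contributions of [f] below, at and above [k]. *)
rewrite (_ : _ - _ = (A * (G / a - (m + G) / x) + (m * y) * (G / a + F / x)
    + D * (F / x - (F + m) / a)) / (Z * m)); last first.
  have -> : c = (A + m * y + D) / Z by rewrite -cE mulfK// gt_eqF.
  by rewrite ZE; field; rewrite !gt_eqF// -ZE.
have h1 : G / a <= (m + G) / x.
  by rewrite ler_pdivrMr// mulrAC ler_pdivlMr// mulrC [_ * a]mulrC.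
have h2 : F / x <= (F + m) / a.
  by rewrite ler_pdivrMr// mulrAC ler_pdivlMr// mulrC [_ * x]mulrC.
have Ga0 : 0 <= G / a by rewrite divr_ge0// ltW.
have Fx0 : 0 <= F / x by rewrite divr_ge0// ltW.
have e4 : (G / a + F / x) / Z <= s^-1.
  by rewrite ler_pdivrMr// -ler_pdivrMl ?invr_gt0// invrK.
apply: le_trans e4.
rewrite normrM normfV (gtr0_norm (mulr_gt0 Z0 m0)).
rewrite ler_pdivrMr ?mulr_gt0// mulrA divfK ?gt_eqF//.
have k1 : A * (G / a - (m + G) / x) <= 0.
  by rewrite mulr_ge0_le0// subr_le0.
have k2 : D * (F / x - (F + m) / a) <= 0.
  by rewrite mulr_ge0_le0// subr_le0.
have k3 : m * y * (G / a + F / x) <= m * (G / a + F / x).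
  rewrite ler_wpM2r ?addr_ge0// ler_piMr//; [exact: ltW|by case/andP: fn].
have k4 : 0 <= m * y * (G / a + F / x).
  rewrite !mulr_ge0 ?addr_ge0//; [exact: ltW|by case/andP: fn].
have k5 : F * (G / a - (m + G) / x) <= A * (G / a - (m + G) / x).
  by rewrite ler_wnM2r// subr_le0.
have k6 : G * (F / x - (F + m) / a) <= D * (F / x - (F + m) / a).
  by rewrite ler_wnM2r// subr_le0.
rewrite ler_norml; apply/andP; split; last first.
  by move: k1 k2 k3 k4 k5 k6; lra.
have k7 : F * (G / a - (m + G) / x) + G * (F / x - (F + m) / a) =
  - ((G / a + F / x) * m) by field; rewrite !gt_eqF.
by move: k1 k2 k3 k4 k5 k6 k7; lra.
Qed.

End BirthDeath.

(** The constant [s] is a parameter since the two families reach it by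
    different computations. Only the range [k <= K] is served because the
    birth rates of the binomial chain are negative further up. *)
Lemma stein_solution (R : realFieldType) (al : nat -> R) (K : nat) (s : R)
    (f : nat -> R) :
  (0 < K)%N -> (forall k, (k < K)%N -> 0 < al k) ->
  (forall k, (k.+1 < K)%N -> al k.+1 - al k <= 1) ->
  0 < s -> s <= K%:R ->
  (forall k, (0 < k < K)%N ->
    s * (bd_above al K k.+1 / al k + bd_below al k / k%:R) <=
    bd_below al K.+1) ->
  (forall k, 0 <= f k <= 1) ->
  exists g c, [/\ 0 <= c <= 1, g 0%N = g 1%N, forall k, (K < k)%N -> g k = 0,
    forall k, (k <= K)%N -> al k * g k.+1 - k%:R * g k = f k - c &
    forall k, `|g k.+1 - g k| <= s^-1].
Proof.
move=> K0 a0 a1 s0 sK sb f01.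
exists (bd_sol al K f), (bd_mean al K f); split.
- exact: bd_mean01.
- exact: bd_sol0.
- exact: bd_sol_out.
- exact: bd_sol_eq.
- by move=> k; exact: bd_sol_diff.
Qed.

(** Upwards, the birth rates are at least [a]. Downwards, summing the balance
    equation expresses [a] times the mass below [k] by a first moment, which
    is at most [k] times that mass, and the mass at [k]. *)
Lemma negbin_stein_factor (R : realFieldType) (a b : R) (al : nat -> R) (K k : nat) :
  (forall i, al i = a + b * i%:R) ->
  0 < a -> 0 <= b <= 1 -> (0 < k < K)%N ->
  a * (bd_above al K k.+1 / al k + bd_below al k / k%:R) <= bd_below al K.+1.
Proof.
move=> alE a0 /andP[b0 b1] /andP[k0 kK].
have al0 i : (i < K)%N -> 0 < al i by move=> _; rewrite alE ltr_wpDr// mulr_ge0.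
have mk : 0 < bd_mass al k := bd_mass_gt0 al0 (ltnW kK).
have G0 : 0 <= bd_above al K k.+1 := bd_above_ge0 al0 _.
have ZE : bd_below al K.+1 = bd_below al k + bd_mass al k + bd_above al K k.+1.
  by rewrite -(@bd_below_above _ al K k.+1) ?bd_belowS// ltnS ltnW.
have e1 : a * (bd_above al K k.+1 / al k) <= bd_above al K k.+1.
  rewrite mulrCA ler_piMr// ler_pdivrMr ?mul1r; first by rewrite alE lerDl mulr_ge0.
  exact: al0.
have id : a * bd_below al k = (1 - b) * (\sum_(0 <= i < k) i%:R * bd_mass al i)
    + k%:R * bd_mass al k.
  elim: (k) => [|n IH]; first by rewrite /bd_below !big_geq// !mulr0 mul0r addr0.
  rewrite bd_belowS big_nat_recr//= mulrDr IH bd_balance alE; ring.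
have le1 : \sum_(0 <= i < k) i%:R * bd_mass al i <= k%:R * bd_below al k.
  rewrite /bd_below mulr_sumr big_nat_cond [leRHS]big_nat_cond.
  apply: ler_sum => i /andP[/andP[_ ik] _]; rewrite ler_wpM2r ?ler_nat 1?ltnW//.
  exact/ltW/(bd_mass_gt0 al0)/ltnW/(ltn_trans ik).
have F0 : 0 <= bd_below al k.
  by apply: (bd_below_ge0 al0); exact/leqW/ltnW.
have e2 : a * (bd_below al k / k%:R) <= bd_below al k + bd_mass al k.
  rewrite mulrA id ler_pdivrMr ?ltr0n// [(bd_below al k + _) * _]mulrDl.
  rewrite [bd_mass al k * _]mulrC lerD2r.
  apply: (@le_trans _ _ ((1 - b) * (k%:R * bd_below al k))).
    by rewrite ler_wpM2l// subr_ge0.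
  rewrite [k%:R * _]mulrC; apply: ler_piMl; first by rewrite mulr_ge0.
  by rewrite gerBl.
rewrite mulrDr ZE; move: e1 e2; clear; lra.
Qed.

(** Here [K] is the ceiling of the real number [N]. Summing the balance
    equation below [k] and above [k] expresses [N p] times the lower mass and
    [N q] times the upper mass by first moments and boundary terms; the
    boundary term at [K] has the sign of [N - K], which is the favourable
    one. *)
Lemma binomial_stein_factor (R : realFieldType) (N p q : R) (al : nat -> R)
    (K k : nat) :
  (forall i, al i = (N - i%:R) * (p / q)) ->
  0 < p -> 0 < q -> p + q = 1 -> N <= K%:R -> (forall i, (i < K)%N -> i%:R < N) ->
  (0 < k < K)%N ->
  N * p * (bd_above al K k.+1 / al k + bd_below al k / k%:R) <= bd_below al K.+1.
Proof.
move=> alE p0 q0 pq NK KN /andP[k0 kK].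
have al0 i : (i < K)%N -> 0 < al i.
  by move=> iK; rewrite alE mulr_gt0 ?divr_gt0// subr_gt0 KN.
have mk : 0 < bd_mass al k := bd_mass_gt0 al0 (ltnW kK).
have G0 : 0 <= bd_above al K k.+1 := bd_above_ge0 al0 _.
have bal i : q * (i.+1%:R * bd_mass al i.+1) = p * (N - i%:R) * bd_mass al i.
  by rewrite bd_balance alE; field; rewrite gt_eqF.
have ZE : bd_below al K.+1 = bd_below al k + bd_mass al k + bd_above al K k.+1.
  by rewrite -(@bd_below_above _ al K k.+1) ?bd_belowS// ltnS ltnW.
have qE : q = 1 - p by rewrite -pq addrC addKr.
have id : N * p * bd_below al k = (\sum_(0 <= i < k) i%:R * bd_mass al i)
    + q * (k%:R * bd_mass al k).
  elim: (k) => [|n IH]; first by rewrite /bd_below !big_geq// !mulr0 mul0r mulr0 addr0.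
  by rewrite bd_belowS big_nat_recr//= mulrDr IH bal qE; ring.
have le1 : \sum_(0 <= i < k) i%:R * bd_mass al i <= k%:R * bd_below al k.
  rewrite /bd_below mulr_sumr big_nat_cond [leRHS]big_nat_cond.
  apply: ler_sum => i /andP[/andP[_ ik] _]; rewrite ler_wpM2r ?ler_nat 1?ltnW//.
  exact/ltW/(bd_mass_gt0 al0)/ltnW/(ltn_trans ik).
have e2 : N * p * (bd_below al k / k%:R) <= bd_below al k + q * bd_mass al k.
  rewrite mulrA id ler_pdivrMr ?ltr0n// mulrDl [_ * k%:R]mulrC.
  by rewrite -mulrA [bd_mass al k * _]mulrC lerD2r.
have Nk : 0 < N - k%:R by rewrite subr_gt0 KN.
have id2 j : (j <= K)%N -> N * q * bd_above al K j =
    \sum_(j <= i < K) (N - i%:R) * bd_mass al i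
    + q * (N - K%:R) * bd_mass al K + q * (j%:R * bd_mass al j).
  move=> jK; have [n nE] : exists n, n = (K - j)%N by exists (K - j)%N.
  elim: n j jK nE => [|n IH] j jK nE.
    have {nE} -> : j = K by apply/eqP; rewrite eqn_leq jK -subn_eq0 -nE.
    rewrite big_geq// /bd_above big_nat1; ring.
  have j1 : (j < K)%N by rewrite -subn_gt0 -nE.
  rewrite bd_aboveS// mulrDr IH//; last by rewrite subnS -nE.
  by rewrite bal [X in _ = X + _ + _]big_ltn// qE; ring.
have le2 : \sum_(k.+1 <= i < K) (N - i%:R) * bd_mass al i
    + q * (N - K%:R) * bd_mass al K <= (N - k%:R) * bd_above al K k.+1.
  rewrite /bd_above big_nat_recr//= [leRHS]mulrDr; apply: lerD.
    rewrite mulr_sumr big_nat_cond [leRHS]big_nat_cond.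
    apply: ler_sum => i /andP[/andP[ki ik] _]; rewrite ler_wpM2r//.
      by apply/ltW/(bd_mass_gt0 al0)/ltnW.
    by rewrite lerD2l lerN2 ler_nat ltnW.
  have mK := bd_mass_gt0 al0 (leqnn K).
  rewrite ler_wpM2r ?(ltW mK)//; apply: (@le_trans _ _ 0); last exact: ltW.
  by rewrite mulr_ge0_le0 ?subr_le0// ltW.
have e1 : N * p * (bd_above al K k.+1 / al k) <= bd_above al K k.+1 + p * bd_mass al k.
  have -> : N * p * (bd_above al K k.+1 / al k) = N * q * bd_above al K k.+1 / (N - k%:R).
    by rewrite alE; field; rewrite !gt_eqF.
  rewrite ler_pdivrMr// id2// bal.
  rewrite [leRHS](_ : _ = (N - k%:R) * bd_above al K k.+1 +
    p * (N - k%:R) * bd_mass al k); last by ring.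
  by rewrite lerD2r.
have F0 : 0 <= bd_below al k.
  by apply: (bd_below_ge0 al0); exact/leqW/ltnW.
rewrite mulrDr ZE.
have : q * bd_mass al k + p * bd_mass al k = bd_mass al k.
  by rewrite -mulrDl addrC pq mul1r.
by lra.
Qed.

(** * Local expansion of expectations *)

Section Coordinates.
Context {I : finType}.
Local Notation V := {ffun I -> nat}.
Implicit Types (S : {set I}) (x y : V).

Definition res S x : V := [ffun i => if i \in S then x i else 0%N].
Definition tot S x : nat := (\sum_(i in S) x i)%N.
Definition tots x : nat := (\sum_i x i)%N.

Lemma tot_res S S' x : S \subset S' -> tot S (res S' x) = tot S x.
Proof.
move=> SS'; apply: eq_bigr => i iS; rewrite ffunE.
by rewrite (fintype.subsetP SS').
Qed.

Lemma res_res S S' x : S \subset S' -> res S (res S' x) = res S x.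
Proof.
move=> SS'; apply/ffunP => i; rewrite !ffunE; case: ifP => // iS.
by rewrite (fintype.subsetP SS').
Qed.

Lemma tot_leq S S' x : S \subset S' -> (tot S x <= tot S' x)%N.
Proof.
move=> SS'; rewrite /tot [leqRHS](big_setID S)/= (finset.setIidPr SS').
exact: leq_addr.
Qed.

Lemma tot_leqs S x : (tot S x <= tots x)%N.
Proof.
by rewrite /tots (eq_bigl (mem [set: I]%SET)) ?tot_leq ?finset.subsetT// => i;
  rewrite !inE.
Qed.

Lemma totsB S x : (tots x - tot S x = tot (~: S)%SET x)%N.
Proof.
rewrite /tots (bigID (mem S))/= -/(tot S x) addKn /tot.
by apply: eq_bigl => i; rewrite inE.
Qed.

Lemma tot1 i x : tot [set i]%SET x = x i.
Proof. by rewrite /tot big_set1. Qed.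

End Coordinates.

Section Expansion.
Context {R : realType} {I : finType}.
Local Notation V := {ffun I -> nat}.
Implicit Types (S : {set I}) (x y : V) (w : nat -> V -> R) (phi : nat -> R).

Definition fdiff phi (k : nat) : R := phi k.+1 - phi k.

(** With [l] the position [W - X_S + l + 1] climbs from [W - X_S + 1] to [W].
    The weights [w l] will be functions of the coordinates in [S], where
    [X_S], the total over [S], is known too. *)
Definition cal S w phi x : R :=
  \sum_(0 <= l < tot S x) w l x * phi (tots x - tot S x + l.+1)%N.

Definition wt S w x : R := \sum_(0 <= l < tot S x) w l x.

(** The weights on the larger set [S'] that result when each
    [phi (W - X_S + l + 1)] is telescoped from [W - X_S' + 1]. *)
Definition nxt S S' w (k : nat) x : R :=
  \sum_(0 <= l < tot S x) w l x * (k < tot S' x - tot S x + l)%:R.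

Definition one_w : nat -> V -> R := fun _ _ => 1.

Definition dep S (F : V -> R) := forall x, F (res S x) = F x.

Lemma finite_support_sum phi n m : (forall k, (n <= k)%N -> phi k = 0) ->
  phi m = \sum_(0 <= k < n) phi k * (m == k)%:R.
Proof.
move=> pn; have [mn|nm] := ltnP m n; last first.
  rewrite pn// big_nat_cond big1// => k /andP[/andP[_ kn] _].
  by rewrite gtn_eqF ?mulr0// (leq_trans kn).
rewrite (bigD1_seq m) ?mem_index_iota ?iota_uniq//= eqxx mulr1 big1 ?addr0//.
by move=> k /negPf km; rewrite eq_sym km mulr0.
Qed.

Lemma sum_diff phi (m n : nat) :
  \sum_(0 <= k < n) fdiff phi (m + k.+1)%N = phi (m + n.+1)%N - phi m.+1.
Proof.
elim: n => [|n IH]; first by rewrite big_geq// addn1 subrr.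
by rewrite big_nat_recr//= IH /fdiff -!addnS addnS; ring.
Qed.

Lemma wt_one S x : wt S one_w x = (tot S x)%:R.
Proof. by rewrite /wt sumr_const_nat subn0. Qed.

Lemma cal_one S phi x :
  cal S one_w (fdiff phi) x = phi (tots x).+1 - phi (tots x - tot S x).+1.
Proof.
rewrite /cal; under eq_bigr do rewrite mul1r.
by rewrite sum_diff addnS subnK// tot_leqs.
Qed.

Lemma sum_indicator (n m : nat) (F : nat -> R) : (m <= n)%N ->
  \sum_(0 <= k < n) (k < m)%:R * F k = \sum_(0 <= k < m) F k.
Proof.
move=> mn; rewrite (big_cat_nat (n := m))//= [X in _ + X]big_nat_cond.
rewrite [X in _ + X]big1 ?addr0; last first.
  by move=> k /andP[/andP[mk _] _]; rewrite ltnNge mk mul0r.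
rewrite !big_nat; apply: eq_bigr => k /andP[_ ->].
by rewrite mul1r.
Qed.

(** The base point [W - X_S' + 1] of the telescoping does not involve the
    coordinates in [S'], and the increments have the form of [cal] again. *)
Lemma cal_step S S' w phi x : S \subset S' ->
  cal S w phi x = wt S w x * phi (tots x - tot S' x).+1
    + cal S' (nxt S S' w) (fdiff phi) x.
Proof.
move=> SS'; have ab := tot_leq x SS'; have bW := tot_leqs S' x.
rewrite /cal /nxt /wt.
under [X in _ = _ + X]eq_bigr do rewrite mulr_suml.
rewrite [X in _ = _ + X]exchange_big_nat/= mulr_suml -big_split/=.
rewrite !big_nat; apply: eq_bigr => l /andP[_ la].
under eq_bigr do rewrite -mulrA.
rewrite -mulr_sumr -mulrDr sum_indicator; last by lia.
rewrite sum_diff; congr (_ * _).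
rewrite addrC subrK; congr phi; lia.
Qed.

Lemma wt_nxt_le S S' w x : S \subset S' -> (forall l x, 0 <= w l x) ->
  wt S' (nxt S S' w) x <= wt S w x * (tot S' x)%:R.
Proof.
move=> SS' w0; rewrite /wt /nxt exchange_big_nat/= mulr_suml.
apply: ler_sum => l _; rewrite -mulr_sumr ler_wpM2l//.
apply: (@le_trans _ _ (\sum_(0 <= k < tot S' x) 1)).
  by apply: ler_sum => k _; rewrite lern1 leq_b1.
by rewrite sumr_const_nat subn0.
Qed.

Lemma nxt_ge0 S S' w : (forall l x, 0 <= w l x) -> forall k x, 0 <= nxt S S' w k x.
Proof. by move=> w0 k x; apply: sumr_ge0 => l _; rewrite mulr_ge0. Qed.

Lemma wt_ge0 S w : (forall l x, 0 <= w l x) -> forall x, 0 <= wt S w x.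
Proof. by move=> w0 x; apply: sumr_ge0. Qed.

Lemma dep_nxt S S' w : S \subset S' -> (forall l, dep S (w l)) ->
  forall k, dep S' (nxt S S' w k).
Proof.
move=> SS' wS k x; rewrite /nxt !tot_res//.
by apply: eq_bigr => l _; rewrite -wS res_res// wS.
Qed.

Lemma dep_wt S w : (forall l, dep S (w l)) -> dep S (wt S w).
Proof.
move=> wS x; rewrite /wt tot_res//; apply: eq_bigr => l _; exact: wS.
Qed.

Lemma dep_sub S S' F : S \subset S' -> dep S F -> dep S' F.
Proof. by move=> SS' FS x; rewrite -(FS x) -(FS (res S' x)) res_res. Qed.

Lemma normr_cal_le S w phi x (b : R) : (forall l x, 0 <= w l x) ->
  (forall k, (k <= tots x)%N -> `|phi k| <= b) ->
  `|cal S w phi x| <= wt S w x * b.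
Proof.
move=> w0 pb; rewrite /cal /wt mulr_suml.
apply: le_trans (ler_norm_sum _ _ _) _; rewrite !big_nat.
apply: ler_sum => l /andP[_ la].
rewrite normrM ger0_norm// ler_wpM2l// pb//.
have := tot_leqs S x; lia.
Qed.

End Expansion.

Section ExpansionExpectation.
Context {d : measure_display} {T : measurableType d} {R : realType}.
Variable P : probability T R.
Context {I : finType}.
Local Notation V := {ffun I -> nat}.
Variable Y : T -> V.
Hypothesis mY : forall v, measurable (Y @^-1` [set v]).
Implicit Types (S : {set I}) (x y : V) (w : nat -> V -> R) (phi : nat -> R).
Local Notation E := (Ex P Y).

(** The form in which integrability is propagated: a moment condition on the
    total takes care of everything of polynomial growth. *)
Definition bnd (k : nat) (F : V -> R) :=
  exists C, forall x, `|F x| <= C * (tots x).+1%:R ^+ k.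

Definition growth (k : nat) (phi : nat -> R) :=
  exists C, forall m, `|phi m| <= C * m.+1%:R ^+ k.

Lemma growth_ge0 k phi : growth k phi ->
  exists2 C, 0 <= C & forall m, `|phi m| <= C * m.+1%:R ^+ k.
Proof.
move=> [C HC]; exists `|C| => // m; apply: le_trans (HC m) _.
by rewrite ler_wpM2r ?exprn_ge0// ler_norm.
Qed.

Lemma bnd_ge0 k F : bnd k F ->
  exists2 C, 0 <= C & forall x, `|F x| <= C * (tots x).+1%:R ^+ k.
Proof.
move=> [C HC]; exists `|C| => // m; apply: le_trans (HC m) _.
by rewrite ler_wpM2r ?exprn_ge0// ler_norm.
Qed.

Lemma expS_le (t D : nat) : (t.+1 ^ D <= 2 ^ D * (1 + t ^ D))%N.
Proof.
case: t => [|t]; first by rewrite exp1n muln_gt0 expn_gt0 addn_gt0.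
apply: (@leq_trans ((2 * t.+1) ^ D)); last by rewrite expnMn leq_mul// leq_addl.
by case: D => // D; rewrite leq_exp2r//; lia.
Qed.

Lemma bnd_integ_deg D k F : integ P Y (fun x => (tots x)%:R ^+ D) ->
  (k <= D)%N -> bnd k F -> integ P Y F.
Proof.
move=> WD kD /bnd_ge0[C C0 HC].
apply: (@integ_le _ _ _ _ _ _ mY _
  (fun x => C * ((2 ^ D)%:R * (1 + (tots x)%:R ^+ D)))).
  by apply/integZ/integZ/integD => //; exact: integ_cst.
move=> x; apply: le_trans (HC x) _; rewrite ler_wpM2l//.
apply: (@le_trans _ _ ((tots x).+1%:R ^+ D)).
  by apply: ler_weXn2l => //; rewrite ler1n.
have := expS_le (tots x) D.
by rewrite -(ler_nat R) natrX natrM natrD (natrX _ (tots x)).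
Qed.

Lemma bnd_mul k l F G : bnd k F -> bnd l G -> bnd (k + l) (fun x => F x * G x).
Proof.
move=> [C1 H1] [C2 H2]; exists (C1 * C2) => x.
by rewrite normrM exprD mulrACA ler_pM.
Qed.

Lemma bnd_le k F G : bnd k G -> (forall x, `|F x| <= `|G x|) -> bnd k F.
Proof. by move=> [C HC] FG; exists C => x; exact: le_trans (FG x) _. Qed.

Lemma bnd_tot S : bnd 1 (fun x => (tot S x)%:R).
Proof.
exists 1 => x; rewrite mul1r expr1 ger0_norm// ler_nat.
by apply: leqW; exact: tot_leqs.
Qed.

Lemma bnd_growth k phi (u : V -> nat) : growth k phi ->
  (forall x, (u x <= (tots x).+1)%N) -> bnd k (fun x => phi (u x)).
Proof.
move=> /growth_ge0[C C0 HC] ux; exists (C * 2 ^+ k) => x.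
apply: le_trans (HC _) _; rewrite -mulrA ler_wpM2l// -exprMn.
rewrite lerXn2r ?nnegrE ?mulr_ge0//.
by rewrite -natrM ler_nat; have := ux x; lia.
Qed.

Lemma bnd_cal S w phi k l : (forall l x, 0 <= w l x) -> bnd k (wt S w) ->
  growth l phi -> bnd (k + l) (cal S w phi).
Proof.
move=> w0 bw /growth_ge0[C C0 HC].
have [C1 H1] : bnd (k + l) (fun x => wt S w x * (C * (tots x).+1%:R ^+ l)).
  apply: bnd_mul => //; exists C => x.
  by rewrite ger0_norm// mulr_ge0// exprn_ge0.
exists C1 => x; apply: le_trans (H1 x); apply: le_trans _ (ler_norm _).
apply: normr_cal_le => // j jx; apply: le_trans (HC _) _.
by rewrite ler_wpM2l// lerXn2r ?nnegrE// ler_nat.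
Qed.

Lemma bnd_nxt S S' w k : S \subset S' -> (forall l x, 0 <= w l x) ->
  bnd k (wt S w) -> bnd (k + 1) (wt S' (nxt S S' w)).
Proof.
move=> SS' w0 bw; apply: (@bnd_le _ _ (fun x => wt S w x * (tot S' x)%:R)).
  by apply: bnd_mul => //; exact: bnd_tot.
move=> x; rewrite !ger0_norm.
- exact: wt_nxt_le.
- by rewrite mulr_ge0//; exact: wt_ge0.
- by apply: wt_ge0 => //; exact: nxt_ge0.
Qed.

Lemma bnd_one S : bnd 1 (wt S one_w).
Proof.
by apply: bnd_le (bnd_tot S) _ => x; rewrite wt_one.
Qed.

Hypothesis W4 : integ P Y (fun x => (tots x)%:R ^+ 4).

Lemma bnd_integ k F : (k <= 4)%N -> bnd k F -> integ P Y F.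
Proof. exact: bnd_integ_deg. Qed.

Definition nested_indep S S' :=
  S \subset S' /\ indep P Y (res S) (res (~: S')%SET).

Lemma nested_indep_Ex S S' (F G : V -> R) k l : (k + l <= 4)%N ->
  nested_indep S S' -> dep S F -> dep (~: S')%SET G ->
  bnd k F -> bnd l G -> E (fun x => F x * G x) = E F * E G.
Proof.
move=> kl [SS' ind] dF dG bF bG.
have iFG : integ P Y (fun x => F x * G x).
  by apply: (bnd_integ kl); exact: bnd_mul.
have iF : integ P Y F by apply: bnd_integ bF; lia.
have iG : integ P Y G by apply: bnd_integ bG; lia.
have FE : F \o res S = F by apply/funext => x; exact: dF.
have GE : G \o res (~: S')%SET = G by apply/funext => x; exact: dG.
have EE : (fun x => F x * G x) =
    (fun x => F (res S x) * G (res (~: S')%SET x)).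
  by apply/funext => x; rewrite dF dG.
by rewrite EE indep_Ex ?FE ?GE// -EE.
Qed.

(** The base term of [cal_step] is independent of the weights, so its
    expectation factors. Moving its base point from [W - X_S' + 1] to [W + 1]
    costs a sum of the same kind with unit weights. *)
Lemma Ex_cal_step S S' w phi k l l' :
  (k + l <= 4)%N -> (k + 1 + l' <= 4)%N -> (1 + l' <= 4)%N ->
  nested_indep S S' ->
  (forall l x, 0 <= w l x) -> (forall l, dep S (w l)) -> bnd k (wt S w) ->
  growth l phi -> growth l' (fdiff phi) ->
  E (cal S w phi) =
  E (wt S w) * (E (fun x => phi (tots x).+1) - E (cal S' one_w (fdiff phi)))
    + E (cal S' (nxt S S' w) (fdiff phi)).
Proof.
move=> kl kl' ll' ind w0 wS bw gp gd.
have SS' := ind.1.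
have -> : cal S w phi = (fun x => wt S w x * phi (tots x - tot S' x).+1
    + cal S' (nxt S S' w) (fdiff phi) x).
  by apply/funext => x; exact: cal_step.
have bp : bnd l (fun x => phi (tots x - tot S' x).+1).
  by apply: bnd_growth gp _ => x; rewrite ltnS leq_subr.
have bp1 : bnd l (fun x => phi (tots x).+1) by apply: bnd_growth gp _.
rewrite ExD; first last.
- apply: (bnd_integ kl'); apply: bnd_cal gd => //.
    by apply: nxt_ge0.
  exact: bnd_nxt.
- by apply: (bnd_integ kl); exact: bnd_mul.
congr (_ + _).
rewrite (nested_indep_Ex kl ind)//; last 2 first.
- exact: dep_wt.
- by move=> x; rewrite !totsB; congr (phi _.+1); exact: tot_res.
congr (_ * _).
rewrite -ExB; last 2 first.
- by apply: bnd_integ bp1; lia.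
- apply: (bnd_integ ll'); apply: bnd_cal gd => //.
  exact: bnd_one.
congr Ex; apply/funext => x; rewrite cal_one; ring.
Qed.

(** What is asked of the differences in the last step of the expansion; the
    second differences of bounded functions satisfy it by
    [cal_small_smooth]. *)
Definition cal_small S phi (e : R) :=
  forall w k, (k <= 4)%N -> (forall l x, 0 <= w l x) ->
  (forall l, dep S (w l)) -> bnd k (wt S w) ->
  `|E (cal S w phi)| <= e * E (wt S w).

Lemma dep_one S : forall l, dep S (@one_w R I l).
Proof. by []. Qed.

Lemma one_w_ge0 : forall l x, 0 <= @one_w R I l x.
Proof. by []. Qed.

Section OneStep.
Variables S1 S2 : {set I}.
Hypothesis ind12 : nested_indep S1 S2.
Variables (w : nat -> V -> R) (k : nat).
Hypothesis w0 : forall l x, 0 <= w l x.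
Hypothesis wS : forall l, dep S1 (w l).
Hypothesis bw : bnd k (wt S1 w).
Local Notation b := (fun x => (tot S2 x)%:R : R).
Local Notation u := (wt S1 w).

Lemma Ex_cal_first_order phi e l : (k + l <= 4)%N -> (k + 1 <= 4)%N ->
  growth l phi -> growth 0 (fdiff phi) -> 0 <= e -> cal_small S2 (fdiff phi) e ->
  `|E (cal S1 w phi) - E u * E (fun x => phi (tots x).+1)| <=
  e * (E u * E b + E (fun x => u x * b x)).
Proof.
move=> kl k1 gp gd e0 sm.
rewrite (@Ex_cal_step S1 S2 w phi k l 0)//; last by rewrite addn0.
have h1 : `|E (cal S2 one_w (fdiff phi))| <= e * E b.
  have := sm one_w 1%N isT one_w_ge0 (dep_one S2) (bnd_one S2).
  by rewrite (funext (@wt_one R I S2)).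
have h2 : `|E (cal S2 (nxt S1 S2 w) (fdiff phi))| <= e * E (fun x => u x * b x).
  have b2 : bnd (k + 1) (wt S2 (nxt S1 S2 w)) by exact: (bnd_nxt ind12.1).
  apply: le_trans (sm _ _ k1 _ _ b2) _.
  - exact: nxt_ge0.
  - by apply: dep_nxt => //; exact: ind12.1.
  rewrite ler_wpM2l//; apply: le_Ex.
  - exact: (bnd_integ k1).
  - by apply: (bnd_integ k1); apply: bnd_mul => //; exact: bnd_tot.
  - by move=> x; apply: wt_nxt_le => //; exact: ind12.1.
have u0 : 0 <= E u by apply: Ex_ge0 => x; exact: wt_ge0.
rewrite mulrBr addrAC addrC mulrDr [E u * _ - _ - _]addrAC subrr sub0r addrC.
apply: le_trans (ler_normD _ _) _; rewrite normrN normrM (ger0_norm u0).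
apply: lerD => //; by rewrite mulrCA ler_wpM2l.
Qed.

End OneStep.

Section TwoSteps.
Variables S1 S2 S3 : {set I}.
Hypothesis ind12 : nested_indep S1 S2.
Hypothesis ind23 : nested_indep S2 S3.
Variables (w : nat -> V -> R) (k : nat).
Hypothesis w0 : forall l x, 0 <= w l x.
Hypothesis wS : forall l, dep S1 (w l).
Hypothesis bw : bnd k (wt S1 w).
Local Notation b := (fun x => (tot S2 x)%:R : R).
Local Notation c := (fun x => (tot S3 x)%:R : R).
Local Notation u := (wt S1 w).

(** It is essential that [kappa] does not depend on [phi]: the coefficients of
    the expansion can then be read off from polynomials. *)
Lemma Ex_cal_second_order : exists kappa, forall phi e l,
  (k + l <= 4)%N -> (k + 2 <= 4)%N -> (k + 1 + l <= 4)%N ->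
  growth l phi -> growth 0 (fdiff phi) -> growth 0 (fdiff (fdiff phi)) ->
  0 <= e -> cal_small S3 (fdiff (fdiff phi)) e ->
  `|E (cal S1 w phi) - E u * E (fun x => phi (tots x).+1)
    - kappa * E (fun x => fdiff phi (tots x).+1)| <=
  e * (E u * E b * E c + E u * E (fun x => b x * c x)
    + E (fun x => u x * b x) * E c + E (fun x => u x * b x * c x)).
Proof.
exists (E (wt S2 (nxt S1 S2 w)) - E u * E b) => phi e l kl k2 kl1 gp g1 g2 e0 sm.
have k1 : (k + 1 <= 4)%N by lia.
rewrite (@Ex_cal_step S1 S2 w phi k l 0)//; last by rewrite addn0.
set Ed := E (fun x => fdiff phi (tots x).+1).
have b2 : bnd (k + 1) (wt S2 (nxt S1 S2 w)) by exact: (bnd_nxt ind12.1).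
have n0 := nxt_ge0 S1 S2 w0.
have u0 : 0 <= E u by apply: Ex_ge0 => x; exact: wt_ge0.
have b0 : 0 <= E b by apply: Ex_ge0.
(* The step from [S2] to [S3] is used twice: for unit weights and for the
   weights left over by the step from [S1] to [S2]. *)
have gen w' k' : (k' + 1 <= 4)%N -> (forall l x, 0 <= w' l x) ->
    (forall l, dep S2 (w' l)) -> bnd k' (wt S2 w') ->
    `|E (cal S2 w' (fdiff phi)) - E (wt S2 w') * Ed| <=
    e * (E (wt S2 w') * E c + E (fun x => wt S2 w' x * c x)).
  move=> k'1 w'0 w'S b'.
  exact: (Ex_cal_first_order ind23 w'0 w'S b' (l := 0) ltac:(lia) k'1 g1 g2 e0 sm).
have := gen _ _ _ one_w_ge0 (dep_one S2) (bnd_one S2).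
have wtb : @wt R I S2 one_w = b by apply/funext => x; exact: wt_one.
rewrite wtb => /(_ isT) B1.
have B2 := gen (nxt S1 S2 w) (k + 1)%N.
have {B2} := B2 ltac:(lia) n0 ltac:(by apply: dep_nxt => //; exact: ind12.1) b2.
move=> B2.
have k3 : (k + 1 + 1 <= 4)%N by lia.
have le1 : E (wt S2 (nxt S1 S2 w)) <= E (fun x => u x * b x).
  apply: le_Ex.
  - exact: (bnd_integ k1).
  - by apply: (bnd_integ k1); apply: bnd_mul => //; exact: bnd_tot.
  - by move=> x; apply: wt_nxt_le => //; exact: ind12.1.
have le2 : E (fun x => wt S2 (nxt S1 S2 w) x * c x) <= E (fun x => u x * b x * c x).
  apply: le_Ex.
  - by apply: (bnd_integ k3); apply: bnd_mul => //; exact: bnd_tot.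
  - by apply: (bnd_integ k3); apply: bnd_mul; [apply: bnd_mul => //|]; exact: bnd_tot.
  - by move=> x; rewrite ler_wpM2r//; apply: wt_nxt_le => //; exact: ind12.1.
have c0 : 0 <= E c by apply: Ex_ge0.
set X1 := E (cal S2 one_w (fdiff phi)) in B1 *.
set X2 := E (cal S2 (nxt S1 S2 w) (fdiff phi)) in B2 *.
set p0 := E (fun x => phi (tots x).+1).
rewrite (_ : _ - _ = - (E u * (X1 - E b * Ed)) +
  (X2 - E (wt S2 (nxt S1 S2 w)) * Ed)); last by ring.
apply: le_trans (ler_normD _ _) _; rewrite normrN normrM (ger0_norm u0).
apply: le_trans (lerD (ler_wpM2l u0 B1) B2) _.
rewrite mulrCA -mulrDr ler_wpM2l// !mulrDr !mulrA -!addrA !lerD2l.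
by apply: lerD => //; rewrite ler_wpM2r.
Qed.

End TwoSteps.

Section SizeBias.
Variables (i : I) (A B C : {set I}).
Hypothesis indA : nested_indep [set i]%SET A.
Hypothesis indB : nested_indep A B.
Hypothesis indC : nested_indep B C.
Local Notation a := (fun x => (tot A x)%:R : R).
Local Notation b := (fun x => (tot B x)%:R : R).
Local Notation c := (fun x => (tot C x)%:R : R).
Local Notation xi := (fun x : V => (x i)%:R : R).

(** The weight left over by the step from [i] to [A]; the truncated
    predecessor is harmless, since [X_A = 0] forces [X_i = 0] for [i] in [A]. *)
Definition excess (x : V) : R := (x i * (tot A x).-1)%:R.

(** All the weight on the last position, where [W - X_i + l + 1] is [W]; thus
    [cal] becomes [X_i phi (W)], see [cal_point_w]. *)
Definition point_w (l : nat) (x : V) : R := (x i)%:R * (l.+1 == x i)%:R.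

Lemma point_w_ge0 l x : 0 <= point_w l x. Proof. by rewrite mulr_ge0. Qed.

Lemma sum_point_w x (F : nat -> R) :
  \sum_(0 <= l < x i) point_w l x * F l = (x i)%:R * F (x i).-1.
Proof.
rewrite /point_w; case: (x i) => [|n]; first by rewrite big_geq// mul0r.
rewrite big_nat_recr//= eqxx mulr1 big_nat_cond big1 ?add0r// => l.
by move=> /andP[/andP[_ ln] _]; rewrite eqSS ltn_eqF// mulr0 mul0r.
Qed.

Lemma wt_point_w x : wt [set i]%SET point_w x = (x i)%:R.
Proof.
rewrite /wt tot1; under eq_bigr do rewrite -[point_w _ _]mulr1.
by rewrite sum_point_w mulr1.
Qed.

Lemma cal_point_w phi x :
  cal [set i]%SET point_w phi x = (x i)%:R * phi (tots x).
Proof.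
rewrite /cal tot1 (sum_point_w x (fun l => phi (tots x - x i + l.+1)%N)).
have := tot_leqs [set i]%SET x; rewrite tot1.
case: (x i) => [|n] h; first by rewrite !mul0r.
by rewrite subnK.
Qed.

Lemma nxt_point_w k x :
  nxt [set i]%SET A point_w k x = (x i)%:R * (k < (tot A x).-1)%:R.
Proof.
rewrite /nxt tot1 (sum_point_w x (fun l => (k < tot A x - x i + l)%:R)).
have := tot_leq x indA.1; rewrite tot1.
case: (x i) => [|n] h; first by rewrite !mul0r.
by congr (_ * (_ < _)%:R); lia.
Qed.

Lemma wt_nxt_point_w x : wt A (nxt [set i]%SET A point_w) x = excess x.
Proof.
rewrite /wt; under eq_bigr do rewrite nxt_point_w.
rewrite -mulr_sumr /excess natrM; congr (_ * _).
under eq_bigr do rewrite -[_%:R]mulr1.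
by rewrite sum_indicator ?leq_pred// sumr_const_nat subn0.
Qed.

Lemma dep_point_w l : dep [set i]%SET (point_w l).
Proof. by move=> x; rewrite /point_w ffunE !inE eqxx. Qed.

Lemma bnd_xi : bnd 1 xi.
Proof. by apply: bnd_le (bnd_tot [set i]%SET) _ => x; rewrite tot1. Qed.

Lemma bnd_excess : bnd 2 excess.
Proof.
apply: (@bnd_le 2 _ (fun x => (x i)%:R * (tot A x)%:R)).
  exact: (bnd_mul bnd_xi (bnd_tot A)).
by move=> x; rewrite -natrM !ger0_norm// ler_nat leq_mul// leq_pred.
Qed.

(** The products of expectations that the steps to [B] and to [C] leave in
    front of the third differences, starting from the weight [u]. *)
Definition bracket3 (u : V -> R) : R :=
  E u * E b * E c + E u * E (fun x => b x * c x)
  + E (fun x => u x * b x) * E c + E (fun x => u x * b x * c x).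

Definition bracket2 (u : V -> R) : R := E u * E b + E (fun x => u x * b x).

Lemma size_bias_step phi l l' : (1 + l <= 4)%N -> (2 + l' <= 4)%N ->
  growth l phi -> growth l' (fdiff phi) ->
  E (fun x => (x i)%:R * phi (tots x)) =
  E xi * (E (fun x => phi (tots x).+1) - E (cal A one_w (fdiff phi)))
    + E (cal A (nxt [set i]%SET A point_w) (fdiff phi)).
Proof.
move=> l1 l2 gp gd; rewrite -(funext (cal_point_w phi)).
rewrite (@Ex_cal_step [set i]%SET A point_w phi 1 l l')//.
- by rewrite (funext wt_point_w).
- by lia.
- exact: point_w_ge0.
- exact: dep_point_w.
- by rewrite (funext wt_point_w); exact: bnd_xi.
Qed.

Lemma size_bias_second_order : exists c1 c2, forall g e,
  growth 2 g -> growth 1 (fdiff g) -> growth 0 (fdiff (fdiff g)) ->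
  growth 0 (fdiff (fdiff (fdiff g))) -> 0 <= e ->
  cal_small C (fdiff (fdiff (fdiff g))) e ->
  `|E xi * E (fun x => g (tots x).+1) - E (fun x => (x i)%:R * g (tots x))
    - c1 * E (fun x => fdiff g (tots x).+1)
    - c2 * E (fun x => fdiff (fdiff g) (tots x).+1)| <=
  e * (E xi * bracket3 a + bracket3 excess).
Proof.
have [k1 H1] := Ex_cal_second_order indB indC one_w_ge0 (dep_one A) (bnd_one A).
have b2 : bnd 2 (wt A (nxt [set i]%SET A point_w)).
  by rewrite (funext wt_nxt_point_w); exact: bnd_excess.
have n0 := nxt_ge0 [set i]%SET A point_w_ge0.
have nd := dep_nxt indA.1 dep_point_w.
have [k2 H2] := Ex_cal_second_order indB indC n0 nd b2.
exists (E xi * E a - E excess), (E xi * k1 - k2).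
move=> g e g0 g1 g2 g3 e0 sm.
rewrite (@size_bias_step g 2 1)//.
have {H1} := H1 _ e 1%N isT isT isT g1 g2 g3 e0 sm.
have {H2} := H2 _ e 1%N isT isT isT g1 g2 g3 e0 sm.
rewrite (funext wt_nxt_point_w) (funext (@wt_one R I A)).
have xi0 : 0 <= E xi by exact: Ex_ge0.
move=> H2 /(ler_wpM2l xi0) H1.
rewrite [e * _]mulrDr.
set D1 := E (cal _ one_w _) in H1 *; set D2 := E (cal _ (nxt _ _ _) _) in H2 *.
set p1 := E (fun x => fdiff g (tots x).+1) in H1 H2 *.
set p2 := E (fun x => fdiff (fdiff g) (tots x).+1) in H1 H2 *.
set p0 := E (fun x => g (tots x).+1).
rewrite (_ : _ - _ = E xi * (D1 - E a * p1 - k1 * p2) -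
  (D2 - E excess * p1 - k2 * p2)); last by ring.
apply: le_trans (ler_normB _ _) _; rewrite normrM (ger0_norm xi0).
apply: lerD => //.
by apply: le_trans H1 _; rewrite mulrCA.
Qed.

(** The term with slope [be] of the Stein operator already contains a
    difference of the solution, so one step less is needed. *)
Lemma size_bias_first_order g e :
  growth 1 g -> growth 0 (fdiff g) -> growth 0 (fdiff (fdiff g)) -> 0 <= e ->
  cal_small B (fdiff (fdiff g)) e ->
  `|E (fun x => (x i)%:R * g (tots x)) - E xi * E (fun x => g (tots x).+1)
    - (E excess - E xi * E a) * E (fun x => fdiff g (tots x).+1)| <=
  e * (E xi * bracket2 a + bracket2 excess).
Proof.
move=> g0 g1 g2 e0 sm.
have b2 : bnd 2 (wt A (nxt [set i]%SET A point_w)).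
  by rewrite (funext wt_nxt_point_w); exact: bnd_excess.
have n0 := nxt_ge0 [set i]%SET A point_w_ge0.
have nd := dep_nxt indA.1 dep_point_w.
have H1 := Ex_cal_first_order indB one_w_ge0 (dep_one A) (bnd_one A)
  (l := 0) isT isT g1 g2 e0 sm.
have := Ex_cal_first_order indB n0 nd b2 (l := 0) isT isT g1 g2 e0 sm.
rewrite (@size_bias_step g 1 0)//.
move: H1; rewrite (funext wt_nxt_point_w) (funext (@wt_one R I A)).
have xi0 : 0 <= E xi by exact: Ex_ge0.
move=> /(ler_wpM2l xi0) H1 H2.
set D1 := E (cal _ one_w _) in H1 *; set D2 := E (cal _ (nxt _ _ _) _) in H2 *.
set p1 := E (fun x => fdiff g (tots x).+1) in H1 H2 *.
set p0 := E (fun x => g (tots x).+1).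
rewrite (_ : _ - _ = - (E xi * (D1 - E a * p1)) + (D2 - E excess * p1)); last by ring.
apply: le_trans (ler_normD _ _) _; rewrite normrN normrM (ger0_norm xi0).
rewrite [e * _]mulrDr; apply: lerD => //.
by apply: le_trans H1 _; rewrite mulrCA.
Qed.

End SizeBias.

Lemma tots_natE x : (tots x)%:R = \sum_i (x i)%:R :> R.
Proof. by rewrite /tots natr_sum. Qed.

(** A birth-death operator with birth rates [al + be * k] and death rates
    [k]; the last term is what convolution with a Poisson law of mean [lam]
    adds, compare [sum_stein_op]. *)
Definition stein_op (al be lam : R) (g : nat -> R) (k : nat) : R :=
  (al + be * k%:R) * g k.+1 - k%:R * g k - lam * be * fdiff g k.+1.

Section GlobalExpansion.
Variables (A B C : I -> {set I}).
Hypothesis indA : forall i, nested_indep [set i]%SET (A i).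
Hypothesis indB : forall i, nested_indep (A i) (B i).
Hypothesis indC : forall i, nested_indep (B i) (C i).
Variables (be lam : R).
Hypothesis be1 : be <= 1.
Local Notation EW := (E (fun x => (tots x)%:R)).
Local Notation xi i := (fun x : V => (x i)%:R : R).

Definition rem3 i : R := E (xi i) * bracket3 (B i) (C i) (fun x => (tot (A i) x)%:R)
  + bracket3 (B i) (C i) (excess i (A i)).
Definition rem2 i : R := E (xi i) * bracket2 (B i) (fun x => (tot (A i) x)%:R)
  + bracket2 (B i) (excess i (A i)).

(** The choice [al = (1 - be) * EW] lets the terms with [g] itself combine to
    [(1 - be)] times the sum over [i] of
    [E X_i * E g (W + 1) - E (X_i * g W)], to which the expansion at [i]
    applies. As there, the coefficients must not depend on [g]. *)
Lemma stein_op_expansion : exists c1 c2, forall g (e : I -> R),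
  growth 2 g -> growth 1 (fdiff g) -> growth 0 (fdiff (fdiff g)) ->
  growth 0 (fdiff (fdiff (fdiff g))) -> (forall i, 0 <= e i) ->
  (forall i, cal_small (C i) (fdiff (fdiff (fdiff g))) (e i)) ->
  (forall i, cal_small (B i) (fdiff (fdiff (fdiff g))) (e i)) ->
  `|E (fun x => stein_op ((1 - be) * EW) be lam g (tots x))
    - c1 * E (fun x => fdiff g (tots x).+1)
    - c2 * E (fun x => fdiff (fdiff g) (tots x).+1)| <=
  \sum_i e i * ((1 - be) * rem3 i + `|be| * rem2 i).
Proof.
have H i := conj (size_bias_second_order (indA i) (indB i) (indC i))
  (size_bias_first_order (indA i) (indB i)).
have /choice[c1 Hc] : forall i, exists c1, exists c2, forall g e,
  growth 2 g -> growth 1 (fdiff g) -> growth 0 (fdiff (fdiff g)) ->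
  growth 0 (fdiff (fdiff (fdiff g))) -> 0 <= e ->
  cal_small (C i) (fdiff (fdiff (fdiff g))) e ->
  `|E (xi i) * E (fun x => g (tots x).+1) - E (fun x => (x i)%:R * g (tots x))
    - c1 * E (fun x => fdiff g (tots x).+1)
    - c2 * E (fun x => fdiff (fdiff g) (tots x).+1)| <= e * rem3 i.
  by move=> i; have [[c1 [c2 Hc]] _] := H i; exists c1, c2.
move: Hc => /choice[c2 Hc].
exists ((1 - be) * (\sum_i c1 i) + be * EW - lam * be).
exists ((1 - be) * (\sum_i c2 i)
  + be * \sum_i (E (excess i (A i)) - E (xi i) * E (fun x => (tot (A i) x)%:R))).
move=> g e g0 g1 g2 g3 e0 smC smB.
have ix i : integ P Y (xi i) by apply: bnd_integ (bnd_xi i).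
have EWE : EW = \sum_i E (xi i).
  by rewrite (funext tots_natE) Ex_sum.
have bg1 : bnd 2 (fun x => g (tots x).+1) by exact: (bnd_growth (k := 2)).
have bd1 : bnd 1 (fun x => fdiff g (tots x).+1) by exact: (bnd_growth (k := 1)).
have ixg i : integ P Y (fun x => (x i)%:R * g (tots x)).
  apply: (@bnd_integ (1 + 2)) => //; apply: bnd_mul; first exact: bnd_xi.
  by apply: bnd_growth.
have ixd i : integ P Y (fun x => (x i)%:R * fdiff g (tots x)).
  apply: (@bnd_integ (1 + 1)) => //; apply: bnd_mul; first exact: bnd_xi.
  by apply: bnd_growth.
have ig1 : integ P Y (fun x => g (tots x).+1) by exact: bnd_integ bg1.
have id1 : integ P Y (fun x => fdiff g (tots x).+1) by exact: bnd_integ bd1.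
set p0 := E (fun x => g (tots x).+1); set p1 := E (fun x => fdiff g (tots x).+1).
set p2 := E (fun x => fdiff (fdiff g) (tots x).+1).
have -> : E (fun x => stein_op ((1 - be) * EW) be lam g (tots x)) =
    (1 - be) * (\sum_i (E (xi i) * p0 - E (fun x => (x i)%:R * g (tots x))))
    + be * (\sum_i E (fun x => (x i)%:R * fdiff g (tots x))) - lam * be * p1.
  rewrite sumrB -mulr_suml -EWE -!Ex_sum//.
  have -> : (fun x => \sum_i (x i)%:R * g (tots x)) =
      (fun x => (tots x)%:R * g (tots x)).
    by apply/funext => x; rewrite tots_natE mulr_suml.
  have -> : (fun x => \sum_i (x i)%:R * fdiff g (tots x)) =
      (fun x => (tots x)%:R * fdiff g (tots x)).
    by apply/funext => x; rewrite tots_natE mulr_suml.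
  have iW : integ P Y (fun x => (tots x)%:R * g (tots x)).
    have -> : (fun x => (tots x)%:R * g (tots x)) =
      (fun x => \sum_i (x i)%:R * g (tots x)).
      by apply/funext => x; rewrite tots_natE mulr_suml.
    exact: integ_sum.
  have iWd : integ P Y (fun x => (tots x)%:R * fdiff g (tots x)).
    have -> : (fun x => (tots x)%:R * fdiff g (tots x)) =
      (fun x => \sum_i (x i)%:R * fdiff g (tots x)).
      by apply/funext => x; rewrite tots_natE mulr_suml.
    exact: integ_sum.
  have -> : (fun x => stein_op ((1 - be) * EW) be lam g (tots x)) = (fun x =>
      (1 - be) * (EW * g (tots x).+1 - (tots x)%:R * g (tots x))
      + be * ((tots x)%:R * fdiff g (tots x)) - lam * be * fdiff g (tots x).+1).
    by apply/funext => x; rewrite /stein_op /fdiff; ring.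
  rewrite ExB; last 2 first.
  - by apply: integD; apply: integZ => //; apply: integB => //; exact: integZ.
  - exact: integZ.
  rewrite ExD; last 2 first.
  - by apply: integZ; apply: integB => //; exact: integZ.
  - exact: integZ.
  have i1 : integ P Y (fun x => EW * g (tots x).+1) by exact: integZ.
  rewrite !ExZ//; last exact: integB.
  by rewrite (ExB i1 iW) ExZ.
have H3 i := Hc i g (e i) g0 g1 g2 g3 (e0 i) (smC i).
have H2 i := (H i).2 (fdiff g) (e i) g1 g2 g3 (e0 i) (smB i).
rewrite (_ : _ - _ - _ = (1 - be) *
    (\sum_i (E (xi i) * p0 - E (fun x => (x i)%:R * g (tots x))
       - c1 i * p1 - c2 i * p2)) +
  be * \sum_i (E (fun x => (x i)%:R * fdiff g (tots x)) - E (xi i) * p1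
    - (E (excess i (A i)) - E (xi i) * E (fun x => (tot (A i) x)%:R)) * p2)); last first.
  by rewrite !sumrB -!mulr_suml -?EWE !sumrB; ring.
apply: le_trans (ler_normD _ _) _; rewrite !normrM.
rewrite (@ger0_norm _ (1 - be)) ?subr_ge0//.
have -> : \sum_i e i * ((1 - be) * rem3 i + `|be| * rem2 i) =
    (1 - be) * (\sum_i e i * rem3 i) + `|be| * \sum_i e i * rem2 i.
  by rewrite !mulr_sumr -big_split/=; apply: eq_bigr => i _; ring.
apply: lerD.
  rewrite ler_wpM2l ?subr_ge0//; apply: le_trans (ler_norm_sum _ _ _) _.
  by apply: ler_sum => i _; exact: H3.
rewrite ler_wpM2l//; apply: le_trans (ler_norm_sum _ _ _) _.
by apply: ler_sum => i _; exact: H2.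
Qed.

End GlobalExpansion.

End ExpansionExpectation.

(** * Smoothness of the law of the total *)

Section VarianceBound.
Context {R : realType}.

Lemma normr_sin_le (y : R) : `|sin y| <= `|y|.
Proof.
wlog y0 : y / 0 <= y => [H|].
  have [/H//|y0] := leP 0 y.
  by rewrite -[y]opprK sinN !(normrN (- y)) normrN H// oppr_ge0 ltW.
have dsin (x : R) : is_derive x 1 (@sin R) (cos x) by exact: is_derive_sin.
have [c _] := @MVT_segment R (@sin R) (@cos R) 0 y y0 (fun x _ => dsin x)
  (continuous_subspaceT (@continuous_sin R)).
rewrite sin0 !subr0 => ->; rewrite normrM -[leRHS]mul1r ler_wpM2r//.
exact: cos_max.
Qed.

Lemma cos_sin_half (x : R) : cos x = 1 - 2 * sin (x / 2) ^+ 2.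
Proof.
have -> : cos x = cos ((x / 2) *+ 2).
  by congr cos; rewrite -mulr_natr; field.
by rewrite cos_mulr2n cos2sin2 -mulr_natr; ring.
Qed.

Lemma cos_ge_quadratic (x : R) : 1 - x ^+ 2 / 2 <= cos x.
Proof.
rewrite cos_sin_half lerD2l lerN2.
have : `|sin (x / 2)| ^+ 2 <= `|x / 2| ^+ 2.
  by rewrite lerXn2r ?nnegrE//; exact: normr_sin_le.
by rewrite !real_normK ?num_real// exprMn; lra.
Qed.

Lemma cos_le_quadratic (t : R) : 0 <= t <= 1 -> t ^+ 2 / 3 <= 1 - cos t.
Proof.
move=> /andP[t0 t1]; rewrite cos_sin_half opprB addrC subrK.
set y := t / 2.
have y0 : 0 <= y by rewrite /y divr_ge0.
have y1 : y <= 1 / 2 by rewrite /y; lra.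
have dsin (x : R) : is_derive x 1 (@sin R) (cos x) by exact: is_derive_sin.
have [c + ] := @MVT_segment R (@sin R) (@cos R) 0 y y0 (fun x _ => dsin x)
  (continuous_subspaceT (@continuous_sin R)).
rewrite in_itv/= sin0 !subr0 => /andP[c0 cy] ->.
have c2 : c ^+ 2 <= 1 / 4.
  by have : c ^+ 2 <= (1 / 2) ^+ 2; [rewrite lerXn2r ?nnegrE//; lra|lra].
have cc : 7 / 8 <= cos c by have := cos_ge_quadratic c; lra.
have c3 : (7 / 8) ^+ 2 <= cos c ^+ 2 by rewrite lerXn2r ?nnegrE//; lra.
rewrite (_ : t = 2 * y) ?exprMn; last by rewrite /y; field.
by have := sqr_ge0 y; nra.
Qed.

End VarianceBound.

Section SecondDifferences.
Context {d : measure_display} {T : measurableType d} {R : realType}.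
Variable P : probability T R.
Context {I : finType}.
Local Notation V := {ffun I -> nat}.
Variable Y : T -> V.
Hypothesis mY : forall v, measurable (Y @^-1` [set v]).
Local Notation E := (Ex P Y).
Implicit Types (S C : {set I}) (phi : nat -> R).

Definition finsupp_bounded phi (M : R) :=
  (forall k, `|phi k| <= M) /\ exists n, forall k, (n <= k)%N -> phi k = 0.

(** The dual form of a bound [D] on the total variation norm of the second
    differences of the law of the total given the coordinates in [C]. The
    masses of the atoms are kept as factors, so null atoms need no special
    treatment. *)
Definition smooth_given C (D : R) := forall phi M, finsupp_bounded phi M ->
  forall y : V, `|E (fun x => fdiff (fdiff phi) (tots x) * (res C x == y)%:R)| <=
    M * D * E (fun x => (res C x == y)%:R).

Lemma normr_diff2 phi M : (forall k, `|phi k| <= M) ->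
  forall k, `|fdiff (fdiff phi) k| <= 4 * M.
Proof.
move=> pM k; rewrite /fdiff.
rewrite (_ : _ - _ = phi k.+2 - phi k.+1 + (phi k - phi k.+1)); last by ring.
apply: le_trans (ler_normD _ _) _.
have := pM k; have := pM k.+1; have := pM k.+2.
have := ler_normB (phi k.+2) (phi k.+1); have := ler_normB (phi k) (phi k.+1).
lra.
Qed.

(** On an atom the shift by [a] is deterministic and can be moved into the
    test function. *)
Lemma smooth_given_shift C D phi M (l a : nat) (u : V) :
  smooth_given C D -> finsupp_bounded phi M -> (a <= tots u)%N ->
  (forall x, res C x = u -> (a <= tots x)%N) ->
  `|E (fun x => fdiff (fdiff phi) (tots x - a + l)%N * (res C x == u)%:R)| <=
  M * D * E (fun x => (res C x == u)%:R).
Proof.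
move=> sm [pM [n pn]] au ax.
have := sm (fun k => phi (k + l - a)%N) M _ u.
move=> /(_ _)/wrap[].
  split=> [k|]; first exact: pM.
  by exists (n + a)%N => k nk; apply: pn; lia.
congr (`|Ex _ _ _| <= _); apply/funext => x.
case: eqP => [xu|_]; last by rewrite !mulr0.
congr (_ * _); have := ax _ xu => {}ax.
by rewrite /fdiff; do ![congr (_ - _)]; congr phi; lia.
Qed.

(** On each atom of the coordinates in [C], the weights and the shifts of the
    total are constants, so that only the conditional law of the total is
    left. *)
Lemma cal_small_smooth C S D phi M :
  integ P Y (fun x => (tots x)%:R ^+ 4) ->
  S \subset C -> 0 <= D -> smooth_given C D -> finsupp_bounded phi M ->
  cal_small P Y S (fdiff (fdiff phi)) (M * D).
Proof.
move=> W4 SC D0 sm pM w k k4 w0 wS bw.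
have M0 : 0 <= M := le_trans (normr_ge0 _) (pM.1 0%N).
have iw : integ P Y (wt S w) by exact: (bnd_integ mY W4 k4).
have ic : integ P Y (cal S w (fdiff (fdiff phi))).
  apply: (bnd_integ mY W4 k4); rewrite -[k]addn0; apply: bnd_cal => //.
  by exists (4 * M) => m; rewrite expr0 mulr1; apply: normr_diff2 pM.1 _.
rewrite -(ExZ (M * D) iw).
apply: (@le_abs_Ex_partition _ _ _ P _ Y mY _ (res C)) => //; first exact: integZ.
move=> u.
have -> : (fun v => M * D * wt S w v * (res C v == u)%:R) =
    (fun v => M * D * wt S w u * (res C v == u)%:R).
  apply/funext => v; case: eqP => [vu|]; last by rewrite !mulr0.
  by rewrite -vu (dep_sub SC (dep_wt wS)).
rewrite (ExZ _ (integ_ind P mY _)).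
have -> : (fun v => cal S w (fdiff (fdiff phi)) v * (res C v == u)%:R) =
    (fun v => \sum_(0 <= l < tot S u) w l u *
       (fdiff (fdiff phi) (tots v - tot S u + l.+1)%N * (res C v == u)%:R)).
  apply/funext => v; case: eqP => [vu|]; last first.
    by rewrite mulr0 big1// => l _; rewrite !mulr0.
  rewrite mulr1 /cal -vu tot_res//; apply: eq_bigr => l _.
  by rewrite mulr1 (dep_sub SC (wS l)).
have ib l : integ P Y (fun v => fdiff (fdiff phi) (tots v - tot S u + l.+1)%N *
    (res C v == u)%:R).
  apply: (@integ_bounded _ _ _ P _ Y mY _ (4 * M)) => x; rewrite normrM.
  have := normr_diff2 pM.1 (tots x - tot S u + l.+1)%N.
  case: (_ == _); rewrite ?normr1 ?mulr1// normr0 mulr0.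
  by move=> _; rewrite mulr_ge0.
rewrite Ex_sum; last by move=> l; exact: integZ.
apply: le_trans (ler_norm_sum _ _ _) _.
rewrite /wt -[M * D * _ * _]mulrAC mulrC mulr_suml.
apply: ler_sum => l _; rewrite ExZ// normrM (ger0_norm (w0 _ _)) ler_wpM2l//.
apply: smooth_given_shift => //; first exact: tot_leqs.
by move=> x <-; rewrite tot_res//; exact: tot_leqs.
Qed.

Lemma smooth_given_total C D phi M : 0 <= D -> smooth_given C D ->
  finsupp_bounded phi M ->
  `|E (fun x => fdiff (fdiff phi) (tots x))| <= M * D.
Proof.
move=> D0 sm pM.
rewrite -[leRHS](Ex_cst P Y); apply: (@le_abs_Ex_partition _ _ _ P _ Y mY _ (res C)) => //.
- exact: (integ_bounded P mY (fun x => normr_diff2 pM.1 (tots x))).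
- exact: integ_cst.
- move=> u; apply: le_trans (sm _ _ pM u) _.
  by rewrite ExZ//; exact: (integ_ind P mY).
Qed.

(** Needed for the cosine, which has no finite support. Truncation at [n]
    costs at most a tail of the total, of order [1 / n] by Markov's
    inequality. *)
Lemma smooth_given_bounded C D phi M : 0 <= D -> smooth_given C D ->
  integ P Y (fun x => (tots x)%:R) -> (forall k, `|phi k| <= M) ->
  `|E (fun x => fdiff (fdiff phi) (tots x))| <= M * D.
Proof.
move=> D0 sm iW pM.
have M0 : 0 <= M := le_trans (normr_ge0 _) (pM 0%N).
pose B := 4 * M * (E (fun x => (tots x)%:R) + 2).
have B0 : 0 <= B by rewrite !mulr_ge0// addr_ge0// Ex_ge0.
have key n : `|E (fun x => fdiff (fdiff phi) (tots x))| <= M * D + B / n.+1%:R.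
  pose phin k := if (k < n.+1)%N then phi k else 0.
  have pnM : finsupp_bounded phin M.
    split=> [k|]; first by rewrite /phin; case: ifP; rewrite ?normr0.
    by exists n.+1 => k nk; rewrite /phin ltnNge nk.
  have := smooth_given_total D0 sm pnM.
  have i1 := integ_bounded P mY (fun x => normr_diff2 pM (tots x)).
  have i2 := integ_bounded P mY (fun x => normr_diff2 pnM.1 (tots x)).
  have i3 : integ P Y (fun x => 4 * M / n.+1%:R * ((tots x)%:R + 2)).
    by apply/integZ/integD => //; exact: integ_cst.
  have : `|E (fun x => fdiff (fdiff phi) (tots x) - fdiff (fdiff phin) (tots x))| <=
      E (fun x => 4 * M / n.+1%:R * ((tots x)%:R + 2)).
    apply: le_abs_Ex => //; first exact: integB.
    move=> x.
    have [xn|xn] := ltnP (tots x).+2 n.+1.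
      rewrite /fdiff /phin xn (ltnW xn) (ltnW (ltnW xn)) subrr normr0.
      by rewrite !mulr_ge0 ?addr_ge0.
    pose psi k := phi k - phin k.
    have -> : fdiff (fdiff phi) (tots x) - fdiff (fdiff phin) (tots x) =
        fdiff (fdiff psi) (tots x) by rewrite /psi /fdiff; ring.
    apply: le_trans (@normr_diff2 psi M _ _) _.
      by move=> k; rewrite /psi /phin; case: ifP => _; rewrite ?subrr ?normr0 ?subr0.
    rewrite mulrAC -mulrA ler_peMr ?mulr_ge0// ler_pdivlMr// mul1r.
    by rewrite -natrD ler_nat addn2.
  rewrite ExZ; last by apply: integD => //; exact: integ_cst.
  rewrite (ExD iW (integ_cst P Y 2)) Ex_cst.
  rewrite (ExB i1 i2) mulrAC -/B.
  set e1 := E _; set e2 := E _ => h1 h2.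
  have := ler_normD (e1 - e2) e2; rewrite subrK => h3.
  by apply: le_trans h3 _; rewrite addrC lerD.
apply/ler_addgt0Pr => e e0.
have [n nE] : exists n, B / n.+1%:R < e.
  have [n nB] : exists n, B / e < n.+1%:R.
    exists (Num.truncn (B / e)); have := truncnS_gt (B / e); lra.
  by exists n; rewrite ltr_pdivrMr// mulrC -ltr_pdivrMr.
by apply: le_trans (key n) _; rewrite lerD2l ltW.
Qed.

Definition total_mean : R := E (fun x => (tots x)%:R).
Definition total_var : R := E (fun x => ((tots x)%:R - total_mean) ^+ 2).
Local Notation m := total_mean.
Local Notation v := total_var.

(** The function [cos (t * (k - m))] is an eigenfunction of the centred second
    difference, with eigenvalue [2 * (1 - cos t)] up to sign, which is at
    least [2 * t ^ 2 / 3]. For [t ^ 2 = 1 / max (v, 1)] its mean is at least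
    [1 / 2], because [cos y >= 1 - y ^ 2 / 2]. *)
Lemma smooth_given_lower (C : {set I}) (D : R) : 0 <= D ->
  smooth_given C D -> integ P Y (fun x => (tots x)%:R ^+ 2) ->
  1 / 3 / Num.max v 1 <= D.
Proof.
move=> D0 sm i2; set w := Num.max v 1.
have w1 : 1 <= w by rewrite le_max lexx orbT.
have vw : v <= w by rewrite le_max lexx.
have w0 : 0 < w by exact: lt_le_trans w1.
pose t := (Num.sqrt w)^-1.
have s0 : 0 < Num.sqrt w by rewrite sqrtr_gt0.
have t0 : 0 <= t by rewrite invr_ge0 ltW.
have t2 : t ^+ 2 = w^-1 by rewrite exprVn sqr_sqrtr// ltW.
have t1 : t <= 1 by rewrite invf_le1// -{1}sqrtr1 ler_sqrt// ltW.
have iW : integ P Y (fun x => (tots x)%:R).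
  apply: (integ_le mY i2) => x.
  by rewrite ger0_norm// -natrX ler_nat -mulnn; nia.
pose phi (k : nat) : R := - cos (t * (k%:R - 1 - m)).
have pb k : `|phi k| <= 1 by rewrite normrN cos_max.
have := smooth_given_bounded D0 sm iW pb; rewrite mul1r => h.
apply: le_trans (le_trans (ler_norm _) h).
have dphi k : fdiff (fdiff phi) k = 2 * (1 - cos t) * cos (t * (k%:R - m)).
  rewrite /fdiff /phi.
  rewrite (_ : t * (k.+2%:R - 1 - m) = t * (k%:R - m) + t); last first.
    by rewrite -addn2 natrD; ring.
  rewrite (_ : t * (k.+1%:R - 1 - m) = t * (k%:R - m)); last first.
    by rewrite -addn1 natrD; ring.
  rewrite (_ : t * (k%:R - 1 - m) = t * (k%:R - m) - t); last by ring.
  by rewrite cosD cosB; ring.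
have ct : t ^+ 2 / 3 <= 1 - cos t by apply: cos_le_quadratic; rewrite t0.
have iv : integ P Y (fun x => ((tots x)%:R - m) ^+ 2).
  rewrite (_ : (fun x => _) = (fun x => (tots x)%:R ^+ 2 - 2 * m * (tots x)%:R
    + m ^+ 2)); last by apply/funext => x; ring.
  by apply: integD; [apply: integB => //; exact: integZ|exact: integ_cst].
have ct0 : 0 <= 1 - cos t by apply: le_trans ct; rewrite divr_ge0// sqr_ge0.
apply: (@le_trans _ _ (E (fun x => 2 * (1 - cos t) *
    (1 - t ^+ 2 / 2 * ((tots x)%:R - m) ^+ 2)))).
  rewrite ExZ ?ExB ?ExZ ?Ex_cst -/v//; first last.
  - by apply: integB; [exact: integ_cst|exact: integZ].
  - exact: integZ.
  - exact: integ_cst.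
  have e1 : t ^+ 2 * v <= 1 by rewrite t2 ler_pdivrMl ?mulr1.
  rewrite -t2 [leLHS](_ : _ = 2 * (t ^+ 2 / 3) * (1 / 2)); last by field.
  apply: ler_pM.
  - by rewrite mulr_ge0// divr_ge0// sqr_ge0.
  - by lra.
  - by rewrite ler_pM2l.
  - by rewrite mulrAC; lra.
apply: le_Ex => //.
- apply: integZ; apply: integB; first exact: integ_cst.
  exact: integZ.
- apply: (@integ_bounded _ _ _ P _ Y mY _ (4 * 1)) => x; exact: (normr_diff2 pb).
move=> x; rewrite dphi ler_wpM2l ?mulr_ge0//.
apply: le_trans (cos_ge_quadratic _); rewrite exprMn; lra.
Qed.

End SecondDifferences.

(** * Local dependence and smoothness through the vector of outcomes *)

Section Link.
Context {d : measure_display} {T : measurableType d} {R : realType}.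
Variable P : probability T R.
Context {I : finType}.
Local Notation V := {ffun I -> nat}.
Variable X : I -> T -> nat.
Hypothesis mX : forall i, measurable_fun setT (X i).
Implicit Types (S C : {set I}).

Definition outcome (t : T) : V := [ffun i => X i t].
Local Notation E := (Ex P outcome).

Lemma measurable_outcome v : measurable (outcome @^-1` [set v]).
Proof.
rewrite (_ : outcome @^-1` [set v] = \bigcap_(i in [set: I]) (X i @^-1` [set v i])).
  apply: fin_bigcap_measurable => // i _.
  by rewrite -[_ @^-1` _]setTI; exact: mX.
apply/seteqP; split => [t <- i _|t tv]; first by rewrite /= ffunE.
by apply/ffunP => i; rewrite ffunE; exact: tv.
Qed.
Local Notation mY := measurable_outcome.

Lemma subfamilyE S t : subfamily X S t = res S (outcome t).
Proof. by apply/ffunP => i; rewrite !ffunE. Qed.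

Lemma subsumE S t : subsum X S t = tot S (outcome t).
Proof. by apply: eq_bigr => i _; rewrite ffunE. Qed.

Lemma rvsumE t : rvsum X t = tots (outcome t).
Proof. by apply: eq_bigr => i _; rewrite ffunE. Qed.

Lemma independent_elements_indep (U1 U2 : countType) (y : V -> U1) (z : V -> U2) :
  independent_elements P (y \o outcome) (z \o outcome) -> indep P outcome y z.
Proof.
move=> ind u w; apply: EFin_inj; rewrite EFinM !(Ex_indicE P mY).
have := ind [set u] [set w].
have -> : (y \o outcome) @^-1` [set u] = [set t | y (outcome t) == u].
  by apply/seteqP; split => t /= /eqP.
have -> : (z \o outcome) @^-1` [set w] = [set t | z (outcome t) == w].
  by apply/seteqP; split => t /= /eqP.
move=> <-.
rewrite (_ : (fun v => _) = (fun v => ((y v == u) && (z v == w))%:R)).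
  by rewrite (Ex_indicE P mY); congr (P _); apply/seteqP; split => t /= /andP.
by apply/funext => v; rewrite -natrM mulnb.
Qed.

(** For the singleton, the value of [X i] and the restricted family determine
    each other. *)
Lemma locally_dependent_nested (A B C : I -> {set I}) :
  locally_dependent P X A B C -> forall i,
  [/\ nested_indep P outcome [set i]%SET (A i),
      nested_indep P outcome (A i) (B i) & nested_indep P outcome (B i) (C i)].
Proof.
move=> H i; have [[iA AB BC] [h1 h2 h3]] := H i.
have subE S : subfamily X S = res S \o outcome.
  by apply/funext => t; exact: subfamilyE.
split; split => //.
- by rewrite finset.sub1set.
- apply: independent_elements_indep => F G.
  have := h1 [set n | F [ffun j => if j == i then n else 0%N]] G; rewrite subE.
  rewrite (_ : X i @^-1` _ = (res [set i]%SET \o outcome) @^-1` F).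
    exact.
  apply/funext => t /=; congr F; apply/ffunP => j.
  by rewrite !ffunE inE; case: eqP => // ->.
- by apply: independent_elements_indep; rewrite -!subE.
- by apply: independent_elements_indep; rewrite -!subE.
Qed.

Lemma fsconv_second_difference (nu : int -> R) (k : int) :
  fsconv nu second_difference k = nu (k - 2) - 2 * nu (k - 1) + nu k.
Proof.
have fs (h g : int -> R) (s : seq int) : uniq s ->
    (forall j, j \notin s -> g j = 0) ->
    forall n, fsconv h g n = \sum_(j <- s) h (n - j) * g j.
  move=> us gs n; rewrite /fsconv -(fsbig_widen [set` s] setT)//; last first.
    move=> j [_ /= /negP js]; by rewrite gs ?mulr0.
  rewrite -fsbig_seq//.
have sd j : second_difference j = (j == 2)%:R - 2 * (j == 1)%:R + (j == 0)%:R :> R.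
  rewrite /second_difference (fs _ _ [:: 0; 1])//; last first.
    move=> i; rewrite !inE negb_or => /andP[/negPf i0 /negPf i1].
    by rewrite /= /point_mass i0 i1 subrr.
  rewrite !big_cons big_nil /= /point_mass /= subr0.
  rewrite (_ : (j - 1 == 1) = (j == 2)); last by rewrite subr_eq.
  by rewrite subr_eq0; ring.
rewrite (fs _ _ [:: 2; 1; 0])//; last first.
  move=> j; rewrite !inE !negb_or => /and3P[/negPf j2 /negPf j1 /negPf j0].
  by rewrite sd j2 j1 j0 mulr0 subrr addr0.
by rewrite !big_cons big_nil !sd /= subr0; ring.
Qed.

Variable C : {set I}.
Local Notation Z := (subfamily X C).
Local Notation W := (rvsum X).

Definition joint (y : V) (k : int) : R :=
  E (fun x => (((tots x)%:Z == k) && (res C x == y))%:R).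
Definition marg (y : V) : R := E (fun x => (res C x == y)%:R).

Lemma cond_lawE t k : cond_law P W Z t k =
  joint (res C (outcome t)) k / marg (res C (outcome t)).
Proof.
rewrite /cond_law /joint /marg !(Ex_indic P mY); congr (fine (P _) / fine (P _)).
  apply/seteqP; split => s /=; rewrite rvsumE !subfamilyE.
    by move=> [-> ->]; rewrite !eqxx.
  by move=> /andP[/eqP -> /eqP ->].
by apply/seteqP; split => s /=; rewrite !subfamilyE => /eqP.
Qed.

Lemma joint_ge0 y k : 0 <= joint y k. Proof. exact: Ex_ge0. Qed.

Lemma marg_ge0 y : 0 <= marg y. Proof. exact: Ex_ge0. Qed.

Lemma sum_joint_le (y : V) (F : seq int) (j : int) : uniq F ->
  \sum_(k <- F) joint y (k - j) <= marg y.
Proof.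
move=> uF; rewrite /joint -Ex_sum; last by move=> k; exact: (integ_ind P mY).
apply: le_Ex.
- by apply: integ_sum => k; exact: (integ_ind P mY).
- exact: (integ_ind P mY).
move=> x; case: (res C x == y); last first.
  by rewrite big1// => k _; rewrite andbF.
under eq_bigr do rewrite andbT.
have [xF|xF] := boolP ((tots x)%:Z + j \in F).
  rewrite (bigD1_seq _ xF uF)/= addrK eqxx big1 ?addr0// => k /negPf kx.
  by rewrite eq_sym subr_eq kx.
rewrite big_seq big1// => k kF; case: eqP => // xk; move: xF.
by rewrite xk subrK kF.
Qed.

Lemma smoothnessE t : smoothness P W Z t =
  \esum_(k in [set: int]) `|(joint (res C (outcome t)) (k - 2)
     - 2 * joint (res C (outcome t)) (k - 1) + joint (res C (outcome t)) k)
     / marg (res C (outcome t))|%:E.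
Proof.
apply: eq_esum => k _; rewrite fsconv_second_difference !cond_lawE.
by congr (`| _ |%:E); ring.
Qed.

(** The second difference has weights 1, -2, 1. *)
Lemma smoothness_le4 t : (smoothness P W Z t <= 4%:E)%E.
Proof.
rewrite smoothnessE; set y := res C (outcome t).
apply: ge_ereal_sup => _ [F [finF _] <-].
rewrite fsbig_finite//= sumEFin lee_fin.
have p0 := marg_ge0 y; have uF := fset_uniq (fset_set F).
apply: (@le_trans _ _ (\sum_(k <- fset_set F)
    (joint y (k - 2) + 2 * joint y (k - 1) + joint y (k - 0)) / marg y)).
  apply: ler_sum => k _; rewrite normrM normfV (ger0_norm p0).
  rewrite ler_wpM2r ?invr_ge0// subr0.
  apply: le_trans (ler_normD _ _) _.
  rewrite (ger0_norm (joint_ge0 y k)) lerD2r.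
  apply: le_trans (ler_normB _ _) _.
  by rewrite normrM !ger0_norm// joint_ge0.
rewrite -mulr_suml !big_split/= -mulr_sumr.
have := sum_joint_le y 2 uF; have := sum_joint_le y 1 uF.
have := sum_joint_le y 0 uF.
have [->|p1] := eqVneq (marg y) 0; first by rewrite invr0 mulr0.
rewrite ler_pdivrMr ?lt_neqAle 1?eq_sym ?p1//; lra.
Qed.

Lemma smoothness_ge0 t : (0 <= smoothness P W Z t)%E.
Proof. by apply: esum_ge0. Qed.

Lemma ess_sup_smoothness_fin :
  (0 <= ess_sup P (smoothness P W Z) <= 4%:E)%E.
Proof.
apply/andP; split; last first.
  by apply/ess_supP; apply: aeW => t; exact: smoothness_le4.
apply: ess_sup_gee; last by apply: aeW => t; exact: smoothness_ge0.
by rewrite (_ : _ setT = 1%E) ?lte01//; exact: probability_setT.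
Qed.

Definition ess_smooth : R := fine (ess_sup P (smoothness P W Z)).

Lemma ess_smoothE : ess_sup P (smoothness P W Z) = ess_smooth%:E.
Proof.
have /andP[h1 h2] := ess_sup_smoothness_fin.
by rewrite fineK// ge0_fin_numE//; apply: le_lt_trans h2 _; rewrite ltry.
Qed.

Lemma ess_smooth_ge0 : 0 <= ess_smooth.
Proof. by apply: fine_ge0; case/andP: ess_sup_smoothness_fin. Qed.

(** The smoothness is constant on each atom of the coordinates in [C], and an
    atom of positive mass meets every set of full measure. *)
Lemma smoothness_le_ess t : 0 < marg (res C (outcome t)) ->
  (smoothness P W Z t <= ess_smooth%:E)%E.
Proof.
move=> p0; rewrite -ess_smoothE.
have [N [mN N0 sN]] := ess_sup_ge P (smoothness P W Z).
have [s [sZ sle]] : exists s, res C (outcome s) = res C (outcome t) /\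
    (smoothness P W Z s <= ess_sup P (smoothness P W Z))%E.
  apply: contrapT => H.
  have sub : [set s | res C (outcome s) == res C (outcome t)] `<=` N.
    move=> s /= /eqP sE; apply: sN => /= h; apply: H; by exists s.
  have mS := measurable_countable_preimage mY
    [set v | res C v == res C (outcome t)].
  have : P [set s | res C (outcome s) == res C (outcome t)] = 0%E.
    by apply: (subset_measure0 _ mN) => //; exact: mS.
  move=> h; move: p0; rewrite /marg (Ex_indic P mY) /= h.
  by rewrite ltxx.
by rewrite smoothnessE -sZ -smoothnessE.
Qed.

(** Summation by parts moves the second difference from the test function to
    the law. *)
Lemma Ex_fdiff2_joint (phi : nat -> R) (n : nat) (y : V) :
  (forall k, (n <= k)%N -> phi k = 0) ->
  E (fun x => fdiff (fdiff phi) (tots x) * (res C x == y)%:R) =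
  \sum_(0 <= k < n) phi k *
    (joint y (k%:Z - 2) - 2 * joint y (k%:Z - 1) + joint y k%:Z).
Proof.
move=> pn; have phiE m := finite_support_sum m pn.
have jE (j : nat) k : joint y (k%:Z - j%:Z) =
    E (fun x => ((tots x + j == k)%N && (res C x == y))%:R).
  congr Ex; apply/funext => x; congr (_ && _)%:R.
  by rewrite eq_sym subr_eq eq_sym -PoszD eqz_nat.
transitivity (E (fun x => \sum_(0 <= k < n) phi k *
   (((tots x + 2 == k)%N && (res C x == y))%:R
    - 2 * ((tots x + 1 == k)%N && (res C x == y))%:R
    + ((tots x + 0 == k)%N && (res C x == y))%:R))).
  congr Ex; apply/funext => x; rewrite /fdiff.
  case: (res C x == y); last first.
    by rewrite mulr0 big1// => k _; rewrite !andbF; ring.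
  under eq_bigr do rewrite !andbT.
  rewrite mulr1 addn2 addn1 addn0 !phiE -!sumrB.
  by apply: eq_bigr => k _; ring.
have ii (Q : pred V) : integ P outcome (fun x => (Q x)%:R) by exact: (integ_ind P mY Q).
rewrite Ex_sum; last first.
  by move=> k; apply/integZ/integD => //; apply: integB => //; exact: integZ.
apply: eq_bigr => k _.
have i2 := @integZ _ _ _ P _ outcome 2 _
  (ii (fun x => (tots x + 1 == k)%N && (res C x == y))).
rewrite ExZ; last by apply: integD => //; exact: integB.
rewrite ExD//; last exact: integB.
rewrite ExB// ExZ//.
by rewrite (jE 2%N) (jE 1%N) -(jE 0%N k) subr0.
Qed.

(** The smoothness bounds every finite sum of absolute second differences of
    the conditional masses, and [phi] is bounded by [M]. *)
Lemma smooth_given_ess : smooth_given P outcome C ess_smooth.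
Proof.
move=> phi M [pM [n pn]] y.
have M0 : 0 <= M := le_trans (normr_ge0 _) (pM 0%N).
rewrite (Ex_fdiff2_joint y pn) -/(marg y).
have := marg_ge0 y; rewrite le_eqVlt => /predU1P[p0|p0].
  have j0 k : joint y k = 0.
    apply/eqP; rewrite eq_le joint_ge0 andbT p0.
    have := @sum_joint_le y [:: k] 0 isT; by rewrite big_seq1 subr0 -p0.
  by rewrite big1 ?normr0 -?p0 ?mulr0// => k _; rewrite !j0; ring.
have [t ty] : exists t, res C (outcome t) = y.
  apply: contrapT => H; move: p0; rewrite /marg.
  have -> : E (fun x => (res C x == y)%:R) = 0.
    rewrite (Ex_indic P mY) (_ : [set t | _] = set0) ?measure0//.
    by apply/seteqP; split => // t /= /eqP h; apply: H; exists t.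
  by rewrite ltxx.
have := @smoothness_le_ess t; rewrite ty => /(_ p0); rewrite smoothnessE ty => h.
have fin : ((\sum_(0 <= k < n) `|(joint y (k%:Z - 2) - 2 * joint y (k%:Z - 1)
    + joint y k%:Z) / marg y|)%R%:E <= ess_smooth%:E)%E.
  apply: le_trans h; apply: ereal_sup_ubound.
  exists [set` [seq k%:Z | k <- iota 0 n]]; first by split => //; exact: finite_seq.
  rewrite -fsbig_seq ?map_inj_uniq ?iota_uniq//; last by move=> ? ? [].
  by rewrite big_map sumEFin /index_iota subn0.
move: fin; rewrite lee_fin => fin.
apply: le_trans (ler_norm_sum _ _ _) _.
rewrite -mulrA [ess_smooth * _]mulrC mulrA [M * _]mulrC -mulrA.
apply: le_trans (ler_wpM2l (ltW p0) (ler_wpM2l M0 fin)).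
rewrite !mulr_sumr; apply: ler_sum => k _.
rewrite normrM (normrM _ (marg y)^-1) normfV (gtr0_norm p0).
rewrite [leRHS](_ : _ = M * `|joint y (k%:Z - 2) - 2 * joint y (k%:Z - 1)
    + joint y k%:Z|); last by field; rewrite gt_eqF.
by rewrite ler_wpM2r.
Qed.

End Link.

(** * Factorial cumulants as polynomials in the moments *)

Section LeftDerivatives.
Context {R : realType}.
Implicit Types (f g : R -> R) (x l : R).

Definition is_left_derive f x l :=
  (h^-1 * (f (x + h) - f x)) @[h --> 0^'-] --> l.

Lemma left_deriveE f x l : is_left_derive f x l -> left_derive f x = l.
Proof. by move=> fl; apply: cvg_lim. Qed.

Lemma is_left_derive_congr f g x l : f x = g x ->
  (\forall h \near 0^'-, f (x + h) = g (x + h)) ->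
  is_left_derive f x l -> is_left_derive g x l.
Proof.
move=> fgx fg fl; apply: cvg_trans fl; apply: near_eq_cvg.
near=> h; rewrite fgx; congr (_ * (_ - _)). near: h; exact: fg.
Unshelve. all: by end_near. Qed.

Lemma cvg_id_left0 : h @[h --> 0^'-] --> (0 : R).
Proof. exact: (@cvg_at_left_filter R R id 0 0 cvg_id). Qed.

Lemma is_left_derive_cvg f x l : is_left_derive f x l ->
  f (x + h) @[h --> 0^'-] --> f x.
Proof.
move=> fl.
have : (h * (h^-1 * (f (x + h) - f x)) + f x) @[h --> 0^'-] --> 0 * l + f x.
  apply: cvgD; last exact: cvg_cst.
  by apply: cvgM => //; exact: cvg_id_left0.
rewrite mul0r add0r => fh; apply: cvg_trans fh; apply: near_eq_cvg.
near=> h.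
have h0 : h != 0 by rewrite lt_eqF//; near: h; exact: nbhs_left_lt.
by rewrite mulrA mulfV// mul1r subrK.
Unshelve. all: by end_near. Qed.

Lemma is_left_deriveM f g x l l' : is_left_derive f x l ->
  is_left_derive g x l' -> is_left_derive (fun z => f z * g z) x (l * g x + f x * l').
Proof.
move=> fl gl; rewrite /is_left_derive.
rewrite (_ : (fun h => _) = (fun h => h^-1 * (f (x + h) - f x) * g (x + h) +
   f x * (h^-1 * (g (x + h) - g x)))); last by apply/funext => h; ring.
apply: cvgD; first by apply: cvgM => //; exact: is_left_derive_cvg gl.
by apply: cvgM => //; exact: cvg_cst.
Qed.

Lemma is_left_deriveB f g x l l' : is_left_derive f x l ->
  is_left_derive g x l' -> is_left_derive (fun z => f z - g z) x (l - l').
Proof.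
move=> fl gl; rewrite /is_left_derive.
rewrite (_ : (fun h => _) = (fun h => h^-1 * (f (x + h) - f x) -
   (h^-1 * (g (x + h) - g x)))); last by apply/funext => h; ring.
exact: cvgB.
Qed.

Lemma near_left_gt0 f x l : is_left_derive f x l -> 0 < f x ->
  \forall h \near 0^'-, 0 < f (x + h).
Proof.
move=> /is_left_derive_cvg fc f0.
exact: (cvgr_gt _ fc).
Qed.

Lemma is_left_deriveV f x l : is_left_derive f x l -> 0 < f x ->
  is_left_derive (fun z => (f z)^-1) x (- l / f x ^+ 2).
Proof.
move=> fl f0; rewrite /is_left_derive.
have fp := near_left_gt0 fl f0.
have : (- (h^-1 * (f (x + h) - f x)) * ((f (x + h))^-1 * (f x)^-1))
    @[h --> 0^'-] --> - l * ((f x)^-1 * (f x)^-1).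
  apply: cvgM; first exact: cvgN.
  apply: cvgM; last exact: cvg_cst.
  by apply: cvgV; [rewrite gt_eqF|exact: is_left_derive_cvg fl].
rewrite (_ : - l * _ = - l / f x ^+ 2); last by rewrite expr2 invfM.
move=> fh; apply: cvg_trans fh; apply: near_eq_cvg; near=> h.
have fxh : 0 < f (x + h) by near: h.
have h0 : h != 0 by rewrite lt_eqF//; near: h; exact: nbhs_left_lt.
by field; rewrite h0 !gt_eqF.
Unshelve. all: by end_near. Qed.

(** The difference quotient is squeezed by the tangent inequality
    [ln y - ln z <= (y - z) / z], used in both directions. *)
Lemma is_left_derive_ln f x l : is_left_derive f x l -> 0 < f x ->
  is_left_derive (fun z => ln (f z)) x (l / f x).
Proof.
move=> fl f0.
have fp := near_left_gt0 fl f0.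
have ln_le (y y0 : R) : 0 < y -> 0 < y0 -> ln y - ln y0 <= (y - y0) / y0.
  move=> y1 y2; rewrite -ln_div ?posrE//.
  have -> : y / y0 = 1 + (y - y0) / y0 by field; rewrite gt_eqF.
  apply: le_ln1Dx; rewrite mulrBl mulfV ?gt_eqF//.
  have : 0 < y / y0 by rewrite divr_gt0.
  lra.
have lower : (h^-1 * (f (x + h) - f x) / f x) @[h --> 0^'-] --> l / f x.
  by apply: cvgM => //; exact: cvg_cst.
have upper : (h^-1 * (f (x + h) - f x) / f (x + h)) @[h --> 0^'-] --> l / f x.
  apply: cvgM => //; apply: cvgV; first by rewrite gt_eqF.
  exact: is_left_derive_cvg fl.
apply: squeeze_cvgr lower upper; near=> h.
have fxh : 0 < f (x + h) by near: h.
have h0 : h < 0 by near: h; exact: nbhs_left_lt.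
have h1 := ln_le _ _ fxh f0; have h2 := ln_le _ _ f0 fxh.
have hV : h^-1 <= 0 by rewrite invr_le0 ltW.
rewrite -!mulrA; apply/andP; split; rewrite ler_wnM2l//.
by move: h2; rewrite -[f x - _]opprB mulNr; lra.
Unshelve. all: by end_near. Qed.

Lemma is_left_derive_quad f x l (C e : R) : 0 < e ->
  (forall h, - e < h < 0 -> `|f (x + h) - f x - h * l| <= C * h ^+ 2) ->
  is_left_derive f x l.
Proof.
move=> e0 H.
have lower : (l + C * h) @[h --> 0^'-] --> l + C * 0.
  apply: cvgD; first exact: cvg_cst.
  by apply: cvgM; [exact: cvg_cst|exact: cvg_id_left0].
have upper : (l - C * h) @[h --> 0^'-] --> l - C * 0.
  apply: cvgB; first exact: cvg_cst.
  by apply: cvgM; [exact: cvg_cst|exact: cvg_id_left0].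
rewrite mulr0 addr0 in lower; rewrite mulr0 subr0 in upper.
apply: squeeze_cvgr lower upper; near=> h.
have h0 : h < 0 by near: h; exact: nbhs_left_lt.
have he : - e < h by near: h; apply: nbhs_left_gt; rewrite oppr_lt0.
have hh := H h ltac:(by rewrite he h0).
have -> : h^-1 * (f (x + h) - f x) = l + h^-1 * (f (x + h) - f x - h * l).
  by field; rewrite lt_eqF.
set D := f (x + h) - f x - h * l in hh *.
have hD : `|h^-1 * D| <= C * - h.
  rewrite normrM normfV (ltr0_norm h0) ler_pdivrMl ?oppr_gt0//.
  by apply: le_trans hh _; rewrite le_eqVlt; apply/orP; left; apply/eqP; ring.
move: hD; rewrite ler_norml => /andP[]; rewrite mulrN; move=> ? ?.
by apply/andP; split; lra.
Unshelve. all: by end_near. Qed.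

End LeftDerivatives.

Section FactorialCumulants.
Context {d : measure_display} {T : measurableType d} {R : realType}.
Variable P : probability T R.
Variable W : T -> nat.
Hypothesis mW : forall v, measurable (W @^-1` [set v]).
Local Notation E := (Ex P W).
Hypothesis W4 : integ P W (fun w => w%:R ^+ 4).

Lemma pow_taylor (m : nat) (z z' : R) : 0 <= z <= 1 -> 0 <= z' <= 1 ->
  `|z' ^+ m - z ^+ m - (z' - z) * (m%:R * z ^+ m.-1)| <=
  m%:R ^+ 2 * (z' - z) ^+ 2.
Proof.
move=> /andP[z0 z1] /andP[z'0 z'1]; elim: m => [|m IH].
  by rewrite !expr0 subrr mul0r mulr0 subr0 normr0 mulr_ge0// ?sqr_ge0.
have -> : z' ^+ m.+1 - z ^+ m.+1 - (z' - z) * (m.+1%:R * z ^+ m.+1.-1) =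
    z' * (z' ^+ m - z ^+ m - (z' - z) * (m%:R * z ^+ m.-1)) +
    m%:R * z ^+ m.-1 * (z' - z) ^+ 2.
  case: m {IH} => [|m] /=; first by rewrite !expr0 !expr1; ring.
  by rewrite !exprS -!natr1; ring.
apply: le_trans (ler_normD _ _) _.
rewrite normrM (ger0_norm z'0).
have h1 : z' * `|z' ^+ m - z ^+ m - (z' - z) * (m%:R * z ^+ m.-1)| <=
    m%:R ^+ 2 * (z' - z) ^+ 2.
  by apply: le_trans IH; rewrite ler_piMl.
have h2 : `|m%:R * z ^+ m.-1 * (z' - z) ^+ 2| <= m%:R * (z' - z) ^+ 2.
  have q0 : 0 <= m%:R * z ^+ m.-1 by rewrite mulr_ge0// exprn_ge0.
  rewrite normrM (ger0_norm q0) ger0_norm ?sqr_ge0//.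
  by rewrite ler_wpM2r ?sqr_ge0// ler_piMr// exprn_ile1.
apply: le_trans (lerD h1 h2) _; rewrite -mulrDl ler_wpM2r ?sqr_ge0//.
by rewrite -natr1; have : 0 <= m%:R :> R by []; nra.
Qed.

(** The [j]-th derivative of the generating function on [0 < z <= 1], taken
    from the left at 1, for [j <= 3]; at [z = 1] it is the [j]-th factorial moment. *)
Definition fact_gen (j : nat) (z : R) : R :=
  E (fun w => (w ^_ j)%:R * z ^+ (w - j)).
Local Notation G := fact_gen.

Lemma ffact_le_exp (w j : nat) : (w ^_ j <= w ^ j)%N.
Proof.
elim: j => [|j IH]; first by rewrite ffactn0 expn0.
by rewrite ffactnSr expnSr leq_mul// leq_subr.
Qed.

Lemma integ_poly (k : nat) : (k <= 4)%N -> integ P W (fun w => w.+1%:R ^+ k).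
Proof.
move=> k4; apply: (@integ_le _ _ _ _ _ _ mW _ (fun w => 16 * (1 + w%:R ^+ 4))).
  by apply/integZ/integD => //; exact: integ_cst.
move=> w; rewrite ger0_norm ?exprn_ge0//.
apply: (@le_trans _ _ (w.+1%:R ^+ 4)).
  by apply: ler_weXn2l => //; rewrite ler1n.
by have := expS_le w 4; rewrite -(ler_nat R) natrX natrM natrD (natrX _ w).
Qed.

Lemma integ_fact_gen j z : (j <= 4)%N -> 0 <= z <= 1 ->
  integ P W (fun w => (w ^_ j)%:R * z ^+ (w - j)).
Proof.
move=> j4 /andP[z0 z1].
apply: (@integ_le _ _ _ _ _ _ mW _ _ (integ_poly j4)) => w.
rewrite ger0_norm ?mulr_ge0 ?exprn_ge0//.
apply: (@le_trans _ _ ((w ^_ j)%:R * 1)).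
  by rewrite ler_wpM2l// exprn_ile1.
rewrite mulr1 -natrX ler_nat; apply: leq_trans (ffact_le_exp _ _) _.
by case: j j4 => // j _; rewrite leq_exp2r.
Qed.

(** The Taylor remainder of each power is quadratic in the increment, with a
    coefficient of order [w ^ (j + 2)]: hence the fourth moment for
    [j = 2]. *)
Lemma fact_gen_derive j z : (j <= 2)%N -> 0 < z <= 1 ->
  is_left_derive (G j) z (G j.+1 z).
Proof.
move=> j2 /andP[z0 z1].
apply: (@is_left_derive_quad _ _ _ _ (E (fun w => w.+1%:R ^+ 4)) z z0).
move=> h /andP[hz h0].
have z01 : 0 <= z <= 1 by rewrite ltW.
have zh : 0 <= z + h <= 1 by apply/andP; split; lra.
have i1 := integ_fact_gen (leq_trans j2 (isT : 2 <= 4)%N) zh.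
have i2 := integ_fact_gen (leq_trans j2 (isT : 2 <= 4)%N) z01.
have i3 := integ_fact_gen (leq_trans (j2 : (j.+1 <= 3)%N) (isT : 3 <= 4)%N) z01.
rewrite /fact_gen -ExZ// -ExB// -ExB; [|exact: integB|exact: integZ].
rewrite [leRHS]mulrC -ExZ; last exact: integ_poly.
apply: le_abs_Ex.
- by apply: integB; [exact: integB|exact: integZ].
- by apply: integZ; exact: integ_poly.
move=> w; rewrite ffactnSr natrM.
have [wj|jw] := ltnP w j.
  by rewrite ffact_small// !mul0r mulr0 !subr0 normr0 mulr_ge0 ?sqr_ge0 ?exprn_ge0.
have -> : (w ^_ j)%:R * (z + h) ^+ (w - j) - (w ^_ j)%:R * z ^+ (w - j) -
    h * ((w ^_ j)%:R * (w - j)%:R * z ^+ (w - j.+1)) = (w ^_ j)%:R *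
   ((z + h) ^+ (w - j) - z ^+ (w - j) -
    (z + h - z) * ((w - j)%:R * z ^+ (w - j).-1)) :> R.
  by rewrite subnS; ring.
rewrite normrM ger0_norm//.
apply: le_trans (ler_wpM2l _ (pow_taylor (w - j) z01 zh)) _ => //.
rewrite [leLHS](_ : _ = h ^+ 2 * ((w ^_ j)%:R * (w - j)%:R ^+ 2)); last by ring.
rewrite ler_wpM2l ?sqr_ge0// -!natrX -natrM ler_nat.
rewrite (expnD w.+1 2 2) leq_mul//; last first.
  by rewrite leq_exp2r//; lia.
apply: leq_trans (ffact_le_exp _ _) _.
apply: (@leq_trans (w.+1 ^ j)); first by case: j {j2 i1 i2 i3 jw} => // j; rewrite leq_exp2r.
by rewrite leq_pexp2l.
Qed.

(** A vanishing value would make all the masses of [W] vanish. *)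
Lemma fact_gen0_gt0 z : 0 < z <= 1 -> 0 < G 0 z.
Proof.
move=> /andP[z0 z1]; rewrite lt_neqAle eq_sym; apply/andP; split; last first.
  by apply: Ex_ge0 => w; rewrite mulr_ge0 ?exprn_ge0// ltW.
apply/eqP => G0.
have z01 : 0 <= z <= 1 by rewrite ltW.
have : Ex P W (fun=> 1) = 0 :> R.
  rewrite -[RHS](Ex_cst P W 0).
  apply: (@eq_Ex_partition _ _ _ P _ W mW _ id).
  - exact: integ_cst.
  - exact: integ_cst.
  move=> u; under [in RHS]eq_fun do rewrite mul0r.
  rewrite Ex_cst; under eq_fun do rewrite mul1r.
  have iu : integ P W (fun v => (v == u)%:R) by exact: (integ_ind P mW).
  apply/eqP; rewrite eq_le Ex_ge0// andbT.
  have zu : 0 < z ^+ u by rewrite exprn_gt0.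
  rewrite -(ler_pM2l zu) mulr0 -ExZ// -G0; apply: le_Ex.
  - exact: integZ.
  - exact: integ_fact_gen.
  - move=> v; rewrite ffactn0 subn0 mul1r; case: eqP => [->|_].
      by rewrite mulr1.
    by rewrite mulr0 exprn_ge0// ltW.
by rewrite Ex_cst => /eqP; rewrite oner_eq0.
Qed.

Lemma pgfE z : 0 <= z <= 1 -> pgf P W z = G 0 z.
Proof.
move=> z01; rewrite /pgf unlock; congr fine; apply: eq_integral => t _ /=.
by rewrite ffactn0 subn0 mul1r.
Qed.

Let near_left_itv (z : R) : 0 < z <= 1 ->
  \forall h \near (0 : R)^'-, 0 < z + h <= 1.
Proof.
move=> /andP[z0 z1]; near=> h.
have h0 : h < 0 by near: h; exact: nbhs_left_lt.
have he : - z < h by near: h; apply: nbhs_left_gt; rewrite oppr_lt0.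
by apply/andP; split; lra.
Unshelve. all: by end_near. Qed.

Let L0 z := ln (pgf P W z).
Let L1 z := G 1 z * (G 0 z)^-1.
Let L2 z := G 2 z * (G 0 z)^-1 - L1 z * L1 z.

Lemma left_derive_log_pgf z : 0 < z <= 1 -> left_derive L0 z = L1 z.
Proof.
move=> z01; apply: left_deriveE.
apply: (is_left_derive_congr (f := fun z => ln (G 0 z))).
- by rewrite /L0 pgfE//; case/andP: z01 => /ltW -> ->.
- near=> h; rewrite /L0 pgfE//.
  have /andP[/ltW -> ->//] : 0 < z + h <= 1 by near: h; exact: near_left_itv.
apply: is_left_derive_ln; first exact: fact_gen_derive.
exact: fact_gen0_gt0.
Unshelve. all: by end_near. Qed.

Let L1_derive z : 0 < z <= 1 -> is_left_derive L1 z (L2 z).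
Proof.
move=> z01; have G0 := fact_gen0_gt0 z01.
have := is_left_deriveM (fact_gen_derive (isT : 1 <= 2)%N z01)
  (is_left_deriveV (fact_gen_derive (isT : 0 <= 2)%N z01) G0).
by congr is_left_derive; rewrite /L2 /L1; field; rewrite gt_eqF.
Qed.

Lemma left_derive2_log_pgf z : 0 < z <= 1 -> left_derive (left_derive L0) z = L2 z.
Proof.
move=> z01; apply: left_deriveE.
apply: (is_left_derive_congr (f := L1)); last exact: L1_derive.
- by rewrite left_derive_log_pgf.
- near=> h; rewrite left_derive_log_pgf//.
  by near: h; exact: near_left_itv.
Unshelve. all: by end_near. Qed.

Let m (k : nat) : R := E (fun w => w%:R ^+ k).

Let one01 : 0 < (1 : R) <= 1. Proof. by rewrite ltr01 lexx. Qed.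

Let im k : (k <= 4)%N -> integ P W (fun w => w%:R ^+ k).
Proof.
move=> k4; apply: (@integ_le _ _ _ _ _ _ mW _ _ (integ_poly k4)) => w.
by rewrite ger0_norm ?exprn_ge0// lerXn2r ?nnegrE// ler_nat.
Qed.

Lemma fact_gen_1 : [/\ G 0 1 = 1, G 1 1 = m 1, G 2 1 = m 2 - m 1 &
  G 3 1 = m 3 - 3 * m 2 + 2 * m 1].
Proof.
have f2 (w : nat) : (w ^_ 2)%:R = w%:R ^+ 2 - w%:R ^+ 1 :> R.
  rewrite ffactnS ffactn1 natrM; case: w => [|w]; first by rewrite mul0r !expr0n subrr.
  by rewrite -[w.+1.-1]/w -natr1; ring.
have f3 (w : nat) : (w ^_ 3)%:R = w%:R ^+ 3 - 3 * w%:R ^+ 2 + 2 * w%:R ^+ 1 :> R.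
  rewrite ffactnS natrM; case: w => [|w]; first by rewrite mul0r !expr0n /=; ring.
  by rewrite -[w.+1.-1]/w f2 -natr1; ring.
have g j : G j 1 = E (fun w => (w ^_ j)%:R).
  by congr Ex; apply/funext => w; rewrite expr1n mulr1.
rewrite !g; split.
- by under eq_fun do rewrite ffactn0; exact: Ex_cst.
- by congr Ex; apply/funext => w; rewrite ffactn1 expr1.
- by rewrite (funext f2) ExB//; exact: im.
- have i3 := @im 3 isT; have i2 := @im 2 isT; have i1 := @im 1 isT.
  rewrite (funext f3) ExD ?ExB ?ExZ//; try exact: integZ.
  by apply: integB => //; exact: integZ.
Qed.

Lemma fact_cumulant2 : fact_cumulant P 2 W = m 2 - m 1 ^+ 2 - m 1.
Proof.
rewrite /fact_cumulant /= left_derive2_log_pgf// /L2 /L1.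
by have [-> -> -> _] := fact_gen_1; rewrite invr1; ring.
Qed.

(** The second logarithmic derivative is known on a left neighbourhood of 1,
    which is all that its left derivative at 1 depends on. *)
Lemma fact_cumulant3 : fact_cumulant P 3 W =
  m 3 - 3 * m 1 * m 2 + 2 * m 1 ^+ 3 - 3 * m 2 + 3 * m 1 ^+ 2 + 2 * m 1.
Proof.
rewrite /fact_cumulant /=; apply: left_deriveE.
apply: (is_left_derive_congr (f := L2)).
- by rewrite left_derive2_log_pgf.
- near=> h; rewrite left_derive2_log_pgf//.
  by near: h; exact: near_left_itv.
have [e0 e1 e2 e3] := fact_gen_1.
have G0 := fact_gen0_gt0 one01.
have d0 := is_left_deriveV (fact_gen_derive (isT : 0 <= 2)%N one01) G0.
have d2 := is_left_deriveM (fact_gen_derive (isT : 2 <= 2)%N one01) d0.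
have d1 := is_left_deriveM (L1_derive one01) (L1_derive one01).
have := is_left_deriveB d2 d1.
congr is_left_derive; rewrite /L2 /L1 e0 e1 e2 e3 expr1n !invr1; ring.
Unshelve. all: by end_near. Qed.

End FactorialCumulants.

(** * The target laws *)

Section NegativeBinomialTotal.
Context {R : realType}.
Variables (r p : R).
Hypothesis r0 : 0 < r.
Hypothesis p01 : 0 < p < 1.
Let q : R := 1 - p.

Let q0 : 0 < q. Proof. by case/andP: p01 => ? ?; rewrite subr_gt0. Qed.
Let q1 : q < 1. Proof. by case/andP: p01 => ? ?; rewrite gtrBl. Qed.
Let p0 : 0 < p. Proof. by case/andP: p01. Qed.

Definition nb_coef (k : nat) : R := (\prod_(i < k) (r + i%:R)) / k`!%:R.
Local Notation c := nb_coef.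

Lemma nb_coefS k : k.+1%:R * c k.+1 = (r + k%:R) * c k.
Proof.
rewrite /nb_coef big_ord_recr/= factS natrM.
have k1 : k.+1%:R != 0 :> R by rewrite pnatr_eq0.
have kf : k`!%:R != 0 :> R by rewrite pnatr_eq0 -lt0n fact_gt0.
move: (k.+1%:R) (k`!%:R) k1 kf => x y x0 y0.
by field; rewrite x0 y0.
Qed.

Lemma nb_coef_gt0 k : 0 < c k.
Proof.
rewrite divr_gt0 ?ltr0n ?fact_gt0//; apply: prodr_gt0 => i _.
by rewrite ltr_pwDl.
Qed.

(** Truncating the binomial series of [(1 - x) ^ (- r)] after degree [n]
    leaves a single monomial in its differential equation
    [(1 - x) y' = r y]. Hence [(1 - x) ^ r] times the truncation is 1 at
    [x = 0] and has a small derivative, and the mean value theorem bounds its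
    distance to 1 at [x = q]. *)
Let pol n : {poly R} := \poly_(k < n.+1) c k.

Let pol_ode n : (1 - 'X) * (pol n)^`() - r *: pol n = - ((r + n%:R) * c n) *: 'X^n.
Proof.
apply/polyP => k; rewrite mulrBl mul1r !coefB coefZ coefXM coefZ coefXn !coef_deriv.
rewrite !coef_poly; case: k => [|k] /=.
  have := nb_coefS 0; rewrite mul1r => ->.
  by case: n => [|n] /=; rewrite !mulr0n ?mulr1n; ring.
rewrite !ltnS -[_ *+ k.+2]mulr_natl -[_ *+ k.+1]mulr_natl.
have h := nb_coefS k.+1.
have [kn|nk|->] := ltngtP k.+1 n.
- by rewrite h /=; ring.
- by rewrite /=; ring.
- by rewrite /=; ring.
Qed.

Let powR_pred (y : R) : 0 < y -> y `^ r = y `^ (r - 1) * y.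
Proof.
move=> y0; rewrite -[X in _ = _ * X]powRr1 ?ltW// -powRD ?subrK//.
by rewrite (gt_eqF y0) implybT.
Qed.

Let H n (x : R) := (1 - x) `^ r * (pol n).[x].

Let H_derive (n : nat) (x : R) : x < 1 ->
  is_derive x (1 : R) (H n) (- ((1 - x) `^ (r - 1) * ((r + n%:R) * c n * x ^+ n))).
Proof.
move=> x1; have x10 : 0 < 1 - x by rewrite subr_gt0.
have d1 : is_derive x 1 (fun y : R => 1 - y) (0 - 1).
  by apply: is_deriveB.
have d2 : is_derive x 1 (fun y : R => (1 - y) `^ r)
    (r * (1 - x) `^ (r - 1) * (0 - 1)).
  exact: (@is_derive1_comp _ (fun z => z `^ r) (fun y => 1 - y) x
    _ _ (is_derive1_powR r x10) d1).
have d3 := is_deriveM d2 (is_derive_poly (pol n) x).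
apply: is_derive_eq d3 _.
have e := powR_pred x10.
have ode : (r + n%:R) * c n * x ^+ n = r * (pol n).[x] - (1 - x) * (pol n)^`().[x].
  have := congr1 (fun P => P.[x]) (pol_ode n).
  rewrite !hornerE/= ?hornerXn => ode.
  by rewrite -[RHS]opprK opprB ode /nb_coef; ring.
by rewrite ode /GRing.scale/= e; ring.
Qed.

Let H_bound n : `|H n q - 1| <= q / p * ((r + n%:R) * c n * q ^+ n).
Proof.
have dH (x : R) : x \in `]0, q[%R -> is_derive x 1 (H n)
    (- ((1 - x) `^ (r - 1) * ((r + n%:R) * c n * x ^+ n))).
  by rewrite in_itv/= => /andP[_ xq]; apply: H_derive; exact: lt_trans q1.
have cH : {within `[0, q], continuous (H n)}.
  apply: derivable_within_continuous => x; rewrite in_itv/= => /andP[_ xq].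
  by apply: ex_derive; apply: H_derive; exact: le_lt_trans q1.
have [x] := MVT_segment (ltW q0) dH cH.
rewrite in_itv/= => /andP[x0 xq].
have -> : H n 0 = 1.
  rewrite /H subr0 powR1 mul1r horner_coef0 coef_poly/= /nb_coef big_ord0 fact0.
  by rewrite divr1.
rewrite subr0 => ->.
have px : p <= 1 - x by move: xq; rewrite /q; lra.
have x10 : 0 < 1 - x by exact: lt_le_trans px.
have cn := nb_coef_gt0 n.
have rn : 0 <= (r + n%:R) * c n by rewrite mulr_ge0 ?addr_ge0// ltW.
have e : (1 - x) `^ (r - 1) <= p^-1.
  have -> : (1 - x) `^ (r - 1) = (1 - x) `^ r / (1 - x).
    by rewrite (powR_pred x10) mulfK// gt_eqF.
  rewrite ler_pdivrMr// mulrC; apply: (@le_trans _ _ 1).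
    have x11 : 0 < 1 - x <= 1 by rewrite x10 gerBl.
    by have := ger_powR x11 (ltW r0); rewrite powRr0.
  by rewrite ler_pdivlMr// mul1r.
rewrite normrM (gtr0_norm q0) normrN ger0_norm; last first.
  by rewrite mulr_ge0 ?powR_ge0// mulr_ge0// exprn_ge0.
rewrite [leLHS]mulrC -[leRHS]mulrA ler_wpM2l ?(ltW q0)//; apply: ler_pM => //.
- exact: powR_ge0.
- by rewrite mulr_ge0// exprn_ge0.
- by rewrite ler_wpM2l// lerXn2r ?nnegrE// ltW.
Qed.

Let tail n := (r + n%:R) * c n * q ^+ n.

Let tail_ge0 n : 0 <= tail n.
Proof.
have cn := nb_coef_gt0 n.
by rewrite mulr_ge0 ?exprn_ge0 ?(ltW q0)// mulr_ge0 ?addr_ge0// ltW.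
Qed.

Let tailS n : tail n.+1 = tail n * (q * (r + n.+1%:R) / n.+1%:R).
Proof.
rewrite /tail exprS; apply: (@mulfI _ n.+1%:R); first by rewrite pnatr_eq0.
rewrite [LHS](_ : _ = (r + n.+1%:R) * (n.+1%:R * c n.+1) * q * q ^+ n); last by ring.
rewrite nb_coefS; field; by rewrite addrC natr1 pnatr_eq0.
Qed.

(** Ratio test: the ratios tend to [q]. *)
Let cvg_tail : tail @ \oo --> 0.
Proof.
pose rho := (1 + q) / 2.
have rho0 : 0 <= rho by rewrite /rho; have := q0; lra.
have rho1 : rho < 1 by rewrite /rho; have := q1; lra.
have [N HN] : exists N, forall n, (N <= n)%N -> q * (r + n.+1%:R) / n.+1%:R <= rho.
  exists (Num.truncn (2 * q * r / (1 - q))) => n Nn.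
  have n1 : 2 * q * r / (1 - q) <= n.+1%:R.
    apply/ltW/(lt_le_trans (truncnS_gt _)); rewrite ler_nat ltnS; exact: Nn.
  have q2 : 0 < 1 - q by rewrite subr_gt0.
  rewrite ler_pdivrMr ?ltr0n//; move: n1; rewrite ler_pdivrMr// /rho => n1.
  by move: n1; lra.
have key k : tail (k + N)%N <= rho ^+ k * tail N.
  elim: k => [|k IH]; first by rewrite expr0 mul1r.
  rewrite addSn tailS exprS.
  have h := HN _ (leq_addl k N).
  apply: (@le_trans _ _ (tail (k + N)%N * rho)); first by rewrite ler_wpM2l.
  by rewrite mulrC -mulrA ler_wpM2l.
rewrite -(cvg_shiftn N) /=.
have lim0 : (rho ^+ k * tail N) @[k --> \oo] --> 0.
  rewrite -[X in _ --> X](mul0r (tail N)); apply: cvgM; last exact: cvg_cst.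
  by apply: cvg_expr; rewrite ger0_norm.
apply: squeeze_cvgr lim0; last exact: cvg_cst.
by apply: nearW => k; rewrite tail_ge0 key.
Qed.

Lemma negbin_pmf_ge0 k : 0 <= negbin_pmf r p k.
Proof.
have c0 : 0 <= c k by exact/ltW/nb_coef_gt0.
apply: mulr_ge0; last by apply: exprn_ge0; exact: ltW q0.
by apply: mulr_ge0; [exact: c0|exact: powR_ge0].
Qed.

Lemma negbin_pmf_cvg : (\sum_(0 <= k < n) negbin_pmf r p k) @[n --> \oo] --> (1 : R).
Proof.
have E n : \sum_(0 <= k < n.+1) negbin_pmf r p k = H n q.
  rewrite /H /q subKr horner_poly mulr_sumr big_mkord.
  by apply: eq_bigr => k _; rewrite /negbin_pmf -/(nb_coef k); ring.
rewrite -(cvg_shiftS (fun n => \sum_(0 <= k < n) negbin_pmf r p k)).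
rewrite (funext E); apply/cvgrPdist_le => e e0.
have t0 : (q / p * tail n) @[n --> \oo] --> 0.
  rewrite -[X in _ --> X](mulr0 (q / p)).
  by apply: cvgM; [exact: cvg_cst|exact: cvg_tail].
near=> n.
have h : `|q / p * tail n| <= e by near: n; exact: (cvgr0_norm_le _ t0 _ e0).
rewrite distrC; apply: le_trans (H_bound n) _.
by apply: le_trans h; exact: ler_norm.
Unshelve. all: by end_near. Qed.

Lemma negbin_pmfS k : k.+1%:R * negbin_pmf r p k.+1 =
  (r * q + q * k%:R) * negbin_pmf r p k.
Proof.
rewrite /negbin_pmf -!/(nb_coef _) exprS.
rewrite [LHS](_ : _ = (k.+1%:R * nb_coef k.+1) * p `^ r * (q * q ^+ k)); last by rewrite /q; ring.
by rewrite nb_coefS -/q; ring.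
Qed.

End NegativeBinomialTotal.

Section DiscreteProbability.
Context {R : realType}.

Lemma esum_cvg (m : nat -> R) (l : R) : (forall k, 0 <= m k) ->
  (\sum_(0 <= k < n) m k) @[n --> \oo] --> l ->
  \esum_(k in [set: nat]) (m k)%:E = l%:E.
Proof.
move=> m0 ml; rewrite -nneseries_esumT; last by move=> k; rewrite lee_fin.
apply/cvg_lim => //.
rewrite (_ : (fun n => _) = EFin \o (fun n => \sum_(0 <= k < n) m k)).
  by apply: cvg_EFin; [exact: nearW|exact: ml].
by apply/funext => n /=; rewrite sumEFin.
Qed.

(** A bundle, so that the law below can carry a structure of probability
    measure. *)
Record pmf := Pmf {
  pmf_fun :> nat -> R ;
  pmf_fun_ge0 : forall k, 0 <= pmf_fun k ;
  pmf_fun_total : \esum_(k in [set: nat]) (pmf_fun k)%:E = 1%E }.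

Definition pmf_law (m : pmf) : set nat -> \bar R :=
  fun U => \esum_(k in U) (m k)%:E.

Section PmfLaw.
Variable m : pmf.

Let pmf_law0 : pmf_law m set0 = 0%E.
Proof. exact: esum_set0. Qed.

Let pmf_law_ge0 U : (0 <= pmf_law m U)%E.
Proof. by apply: esum_ge0 => k _; rewrite lee_fin pmf_fun_ge0. Qed.

Let pmf_law_sigma_additive : semi_sigma_additive (pmf_law m).
Proof.
move=> F mF tF mUF; rewrite /pmf_law; apply: cvg_toP.
  apply: ereal_nondecreasing_is_cvgn => a b ab.
  apply: lee_sum_nneg_natr => // n _ _.
  by apply: esum_ge0 => k _; rewrite lee_fin pmf_fun_ge0.
by rewrite nneseries_sum_bigcup// => i; rewrite lee_fin pmf_fun_ge0.
Qed.

HB.instance Definition _ := isMeasure.Build _ _ _ (pmf_law m)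
  pmf_law0 pmf_law_ge0 pmf_law_sigma_additive.

HB.instance Definition _ :=
  @Measure_isProbability.Build _ _ R (pmf_law m) (pmf_fun_total m).

End PmfLaw.

Definition conv_mass (b c : nat -> R) (k : nat) : R :=
  \sum_(0 <= i < k.+1) b i * c (k - i)%N.

Lemma conv_mass_ge0 b c k : (forall i, 0 <= b i) -> (forall i, 0 <= c i) ->
  0 <= conv_mass b c k.
Proof. by move=> b0 c0; apply: sumr_ge0 => i _; rewrite mulr_ge0. Qed.

Lemma law_convE (mu nu : set nat -> \bar R) (b c : nat -> R) :
  (forall i, 0 <= b i) -> (forall i, 0 <= c i) ->
  (forall i, mu [set i] = (b i)%:E) -> (forall i, nu [set i] = (c i)%:E) ->
  forall U, law_conv mu nu U = \esum_(k in U) (conv_mass b c k)%:E.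
Proof.
move=> b0 c0 mub nuc U; rewrite /law_conv.
pose e (z : nat * nat) := (z.2, (z.1 - z.2)%N).
rewrite (@reindex_esum _ _ _ (U `*`` (fun k => `I_k.+1)) _ e); last first.
  split.
  - move=> [k i] /= [Uk ik]; rewrite /e/= subnKC//.
  - move=> [k i] [k' i'] /set_mem[/= _ ik] /set_mem[/= _ ik'] [ii' kk'].
    by move: ik ik' kk'; rewrite -ii' !ltnS => h1 h2 h3; congr (_, _); lia.
  - move=> [i j] /= Uij; exists ((i + j)%N, i) => /=.
      by split => //=; rewrite ltnS leq_addr.
    by rewrite /e/= addKn.
under eq_esum do rewrite mub nuc -EFinM.
rewrite -(@esum_esum _ _ _ U (fun k => `I_k.+1) (fun k i => (b i * c (k - i)%N)%:E)).
  apply: eq_esum => k _; rewrite esum_fset//; last first.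
    by move=> i _; rewrite lee_fin mulr_ge0.
  by rewrite -fsbig_ord sumEFin /conv_mass big_mkord.
by move=> k i; rewrite lee_fin mulr_ge0.
Qed.

(** The convolution of two laws is given as a mere set function; expectations
    under it require a probability measure that agrees with it. *)
Lemma law_conv_probability (mu nu : set nat -> \bar R) (b c : nat -> R) :
  (forall i, 0 <= b i) -> (forall i, 0 <= c i) ->
  (forall i, mu [set i] = (b i)%:E) -> (forall i, nu [set i] = (c i)%:E) ->
  \esum_(k in [set: nat]) (b k)%:E = 1%E -> \esum_(k in [set: nat]) (c k)%:E = 1%E ->
  exists2 Q : probability nat R, (forall U, law_conv mu nu U = Q U) &
    forall k, Q [set k] = (conv_mass b c k)%:E.
Proof.
move=> b0 c0 mub nuc b1 c1.
have m0 k : 0 <= conv_mass b c k by exact: conv_mass_ge0.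
have m1 : \esum_(k in [set: nat]) (conv_mass b c k)%:E = 1%E.
  rewrite -(law_convE b0 c0 mub nuc) /law_conv.
  under eq_esum do rewrite mub nuc.
  have -> : [set x : nat * nat | [set: nat] (x.1 + x.2)%N] =
      [set: nat] `*`` (fun=> [set: nat]) by apply/seteqP; split.
  rewrite -(@esum_esum _ _ _ _ _ (fun i j => ((b i)%:E * (c j)%:E)%E)); last first.
    by move=> i j; rewrite mule_ge0// lee_fin.
  rewrite -b1; apply: eq_esum => i _.
  rewrite -nneseries_esumT; last by move=> j; rewrite mule_ge0// lee_fin.
  rewrite nneseriesZl; last by move=> j _; rewrite lee_fin.
  rewrite nneseries_esumT; last by move=> j; rewrite lee_fin.
  by rewrite c1 mule1.
exists (pmf_law (Pmf m0 m1)) => [U|k]; first exact: law_convE.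
apply: (@esum_set1 R nat k (fun j => (conv_mass b c j)%:E)).
by rewrite lee_fin.
Qed.

(** Counting the first summand in [k * m k] turns the recursion of [b] into
    [Q (k + 1) = x * m k + be * Q k] for the first moments [Q] of the
    convolution; counting the second one gives
    [(k + 1) * m (k + 1) = Q (k + 1) + lam * m k]. Eliminating [Q] leaves a
    recursion of second order. *)
Lemma conv_mass_recursion (x be lam : R) (b c : nat -> R) :
  (forall k, k.+1%:R * b k.+1 = (x + be * k%:R) * b k) ->
  (forall k, k.+1%:R * c k.+1 = lam * c k) ->
  let m := conv_mass b c in
  m 1%N = (x + lam) * m 0%N /\
  forall k, k.+2%:R * m k.+2 =
    (x + lam + be * k.+1%:R) * m k.+1 - lam * be * m k.
Proof.
move=> bS cS m.
pose Q k := \sum_(0 <= i < k.+1) i%:R * b i * c (k - i)%N.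
have QS k : Q k.+1 = x * m k + be * Q k.
  rewrite /Q big_nat_recl//= !mul0r add0r /m /conv_mass !mulr_sumr -big_split/=.
  by apply: eq_bigr => i _; rewrite bS subSS; ring.
have mS k : k.+1%:R * m k.+1 = Q k.+1 + lam * m k.
  have -> : k.+1%:R * m k.+1 = Q k.+1 +
      \sum_(0 <= i < k.+2) b i * ((k.+1 - i)%:R * c (k.+1 - i)%N).
    rewrite /m /Q /conv_mass mulr_sumr -big_split/= !big_nat.
    by apply: eq_bigr => i /andP[_ ik]; rewrite natrB -1?ltnS//; ring.
  congr (_ + _); rewrite big_nat_recr//= subnn mul0r mulr0 addr0.
  rewrite /m /conv_mass mulr_sumr !big_nat; apply: eq_bigr => i /andP[_ ik].
  by rewrite subSn -1?ltnS// cS; ring.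
have Q0 : Q 0%N = 0 by rewrite /Q big_nat1 !mul0r.
split; first by have := mS 0%N; rewrite mul1r QS Q0 => ->; ring.
move=> k; rewrite mS QS (_ : Q k.+1 = k.+1%:R * m k.+1 - lam * m k); last first.
  by rewrite mS addrK.
by ring.
Qed.

Lemma poisson_pmfS (lam : R) k : 0 < lam ->
  k.+1%:R * poisson_pmf lam k.+1 = lam * poisson_pmf lam k.
Proof.
move=> l0; rewrite /poisson_pmf l0 factS natrM invfM exprS.
have k1 : k.+1%:R != 0 :> R by rewrite pnatr_eq0.
by move: (k.+1%:R) k1 => y y0; rewrite !mulrA; congr (_ * _ * _); field.
Qed.

Lemma poisson_law_mass (lam : R) k : 0 < lam ->
  poisson_prob lam 0 [set k] = (poisson_pmf lam k)%:E.
Proof. by move=> l0; rewrite /poisson_prob l0 esum_set1// lee_fin poisson_pmf_ge0. Qed.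

Lemma poisson_pmf_total (lam : R) : 0 < lam ->
  \esum_(k in [set: nat]) (poisson_pmf lam k)%:E = 1%E.
Proof.
move=> l0; have : poisson_prob lam 0 setT = 1%E by exact: probability_setT.
by rewrite /poisson_prob l0.
Qed.

Lemma binomial_pmfS (n : nat) (p : R) k : 0 < p < 1 ->
  k.+1%:R * binomial_pmf n p k.+1 =
  (n%:R * p / (1 - p) + - (p / (1 - p)) * k%:R) * binomial_pmf n p k.
Proof.
move=> /andP[p0 p1]; have q0 : 1 - p != 0 by rewrite subr_eq0 gt_eqF.
rewrite /binomial_pmf /unstable.onem.
have [kn|nk|->] := ltngtP k n; last 2 first.
- by rewrite !bin_small// ?mulr0n ?mulr0// ltnW.
- rewrite bin_small// mulr0n mulr0 [X in X * _](_ : _ = 0) ?mul0r//.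
  by ring.
rewrite -[X in _ * X]mulr_natr -[in RHS]mulr_natr mulrCA -natrM.
have := mul_bin_left n k => ->; rewrite natrM natrB ?(ltnW kn)//.
by rewrite -(subnSK kn) !exprS; field.
Qed.

End DiscreteProbability.

(** * Stein identity, variance and tails of the target *)

Section Tails.
Context {d : measure_display} {T : measurableType d} {R : realType}.
Variable P : probability T R.
Variable W : T -> nat.
Hypothesis mW : forall v, measurable (W @^-1` [set v]).
Local Notation E := (Ex P W).

Lemma Ex_tail_small (e : R) : 0 < e ->
  exists N, forall K, (N <= K)%N -> E (fun k => (K < k)%N%:R) <= e.
Proof.
move=> e0.
pose F n := [set t | (n < W t)%N].
have mF n : measurable (F n) by exact: (measurable_countable_preimage mW
  [set k | (n < k)%N]).
have F0 : \bigcap_n F n = set0.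
  by rewrite -subset0 => t /(_ (W t) I); rewrite /F/= ltnn.
have cF : (P \o F) n @[n --> \oo] --> 0%E.
  rewrite -(@measure0 _ _ _ P) -F0; apply: nonincreasing_cvg_mu => //.
  - by rewrite (le_lt_trans (probability_le1 P (mF 0%N)))// ltry.
  - by rewrite F0.
  - apply/nonincreasing_seqP => n; apply/subsetPset => t /=; exact: ltnW.
have EF n : E (fun k => (n < k)%N%:R) = fine (P (F n)) by rewrite (Ex_indic P mW).
have cE : E (fun k => (n < k)%N%:R) @[n --> \oo] --> 0.
  rewrite (funext EF); exact: (fine_cvg cF).
have [N _ HN] := cvgr0_norm_le _ cE _ e0.
exists N => K NK; apply: le_trans (HN K NK); exact: ler_norm.
Qed.

Lemma Ex_finite_support (F : nat -> R) n : (forall k, (n <= k)%N -> F k = 0) ->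
  E F = \sum_(0 <= k < n) F k * E (fun j => (j == k)%:R).
Proof.
move=> F0.
rewrite [in LHS](funext (fun j => finite_support_sum j F0)).
rewrite Ex_sum; last by move=> k; apply: integZ; exact: (integ_ind P mW).
by apply: eq_bigr => k _; rewrite ExZ//; exact: (integ_ind P mW).
Qed.

End Tails.

Section MassRecursion.
Context {R : realType}.
Variables (al be lam : R) (m : nat -> R).
Hypothesis m1E : m 1%N = (al + lam * be) * m 0%N.
Hypothesis mSS : forall k, k.+2%:R * m k.+2 =
  (al + lam * be + be * k.+1%:R) * m k.+1 - lam * be * m k.

(** The recursion makes the sum telescope; the boundary terms vanish once [g]
    does. *)
Lemma sum_stein_op (g : nat -> R) n :
  \sum_(0 <= k < n.+1) m k * stein_op al be lam g k =
  n.+1%:R * m n.+1 * g n.+1 - lam * be * m n * g n.+2.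
Proof.
elim: n => [|n IH].
  by rewrite big_nat1 /stein_op /fdiff mul1r m1E; ring.
rewrite big_nat_recr//= IH mSS /stein_op /fdiff; ring.
Qed.

Hypothesis m_ge0 : forall k, 0 <= m k.
Hypothesis m_le1 : forall n, \sum_(0 <= k < n) m k <= 1.
Variable mu : R.
Hypothesis alE : al = (1 - be) * mu.
Hypothesis be_lt0 : be < 0.
Hypothesis lam_gt0 : 0 < lam.
Hypothesis mu_ge0 : 0 <= mu.

(** With [c = mu - be / (1 - be)] the Stein operator maps [k - c] to
    [(mu - lam * be) - (1 - be) * (k - mu) ^ 2], and for [be < 0] the boundary
    terms are nonnegative as soon as the summation range contains [c].
    Working with partial sums bounds the variance without knowing that it is
    finite. *)
Lemma sum_square_le n :
  \sum_(0 <= k < n) m k * (k%:R - mu) ^+ 2 <= (mu - lam * be) / (1 - be).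
Proof.
have b1 : 0 < 1 - be by have := be_lt0; lra.
have lb : 0 <= - (lam * be) by rewrite -mulrN mulr_ge0 ?ltW// oppr_gt0.
pose c := mu - be / (1 - be).
have [N [nN cN]] : exists N, (n <= N)%N /\ c <= N%:R.
  exists (maxn n (Num.truncn c).+1); split; first exact: leq_maxl.
  apply: (le_trans (ltW (truncnS_gt c))); by rewrite ler_nat leq_maxr.
apply: (@le_trans _ _ (\sum_(0 <= k < N.+1) m k * (k%:R - mu) ^+ 2)).
  rewrite (big_cat_nat (leq0n n) (leqW nN))/= lerDl; apply: sumr_ge0 => k _.
  by rewrite mulr_ge0// sqr_ge0.
rewrite ler_pdivlMr// -subr_ge0.
have h := sum_stein_op (fun k => k%:R - c) N.
have gE k : stein_op al be lam (fun k => k%:R - c) k =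
    (mu - lam * be) - (1 - be) * (k%:R - mu) ^+ 2.
  rewrite /stein_op /fdiff alE /c -!natr1; field.
  by rewrite gt_eqF.
have {}h : \sum_(0 <= k < N.+1) m k * (mu - lam * be) -
    (\sum_(0 <= k < N.+1) m k * (k%:R - mu) ^+ 2) * (1 - be) =
    N.+1%:R * m N.+1 * (N.+1%:R - c) - lam * be * m N * (N.+2%:R - c).
  rewrite -h mulr_suml -sumrB; apply: eq_bigr => k _.
  by rewrite gE; ring.
have bd : 0 <= N.+1%:R * m N.+1 * (N.+1%:R - c) - lam * be * m N * (N.+2%:R - c).
  have c1 : 0 <= N.+1%:R - c by rewrite subr_ge0 (le_trans cN)// ler_nat.
  have c2 : 0 <= N.+2%:R - c by rewrite subr_ge0 (le_trans cN)// ler_nat; lia.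
  rewrite -!mulNr; apply: addr_ge0; apply: mulr_ge0 => //; apply: mulr_ge0 => //.
  by rewrite mulNr.
have s1 : \sum_(0 <= k < N.+1) m k * (mu - lam * be) <= mu - lam * be.
  rewrite -mulr_suml; apply: ler_piMl; last exact: m_le1.
  by apply: addr_ge0.
by move: h bd s1; lra.
Qed.

End MassRecursion.

(** * From the Stein equation to total variation *)

Section TotalVariation.
Context {d : measure_display} {T : measurableType d} {R : realType}.
Variable P : probability T R.
Variable W : T -> nat.
Hypothesis mW : forall v, measurable (W @^-1` [set v]).
Variable nu : probability nat R.
Let mid (v : nat) : measurable ((@idfun nat) @^-1` [set v]). Proof. by []. Qed.
Local Notation E1 := (Ex P W).
Local Notation E2 := (Ex nu (@idfun nat)).

Definition unit_fun (f : nat -> R) := forall k, 0 <= f k <= 1.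

Definition gap (f : nat -> R) : R := `|E1 f - E2 f|.

Lemma gap_le1 f : unit_fun f -> gap f <= 1.
Proof.
move=> f01.
have i1 : integ P W f.
  by apply: (@integ_bounded _ _ _ P _ W mW _ 1) => k; have /andP[? ?] := f01 k; rewrite ger0_norm.
have i2 : integ nu idfun f.
  by apply: (@integ_bounded _ _ _ nu _ idfun mid _ 1) => k; have /andP[? ?] := f01 k; rewrite ger0_norm.
have h1 : 0 <= E1 f <= 1.
  rewrite Ex_ge0 => [/=|k]; last by case/andP: (f01 k).
  rewrite -[leRHS](Ex_cst P W); apply: le_Ex => //; first exact: integ_cst.
  by move=> k; case/andP: (f01 k).
have h2 : 0 <= E2 f <= 1.
  rewrite Ex_ge0 => [/=|k]; last by case/andP: (f01 k).
  rewrite -[leRHS](Ex_cst nu (@idfun nat)); apply: le_Ex => //; first exact: integ_cst.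
  by move=> k; case/andP: (f01 k).
rewrite /gap ler_norml; lra.
Qed.

Variables (al be lam s : R) (K : nat) (B tau : R).
Hypothesis s_gt0 : 0 < s.
Hypothesis small : 2 * (`|lam * be| / s) < 1.

Hypothesis solve : forall f, unit_fun f -> exists g c,
  [/\ 0 <= c <= 1, g 0%N = g 1%N, forall k, (K < k)%N -> g k = 0,
    forall k, (k <= K)%N -> (al + be * k%:R) * g k.+1 - k%:R * g k = f k - c &
    forall k, `|g k.+1 - g k| <= s^-1].

Hypothesis E1_stein : forall g : nat -> R, (forall k, (K < k)%N -> g k = 0) ->
  (forall k, `|g k.+1 - g k| <= s^-1) -> `|E1 (stein_op al be lam g)| <= B.

Hypothesis E2_stein : forall g : nat -> R, (forall k, (K < k)%N -> g k = 0) ->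
  E2 (stein_op al be lam g) = 0.

Hypothesis tail1 : E1 (fun k => (K < k)%N%:R) <= tau.
Hypothesis tail2 : E2 (fun k => (K < k)%N%:R) <= tau.

(** Both expectations lie in the interval from [- c * tau] to
    [(1 - c) * tau]. *)
Lemma tail_difference (f : nat -> R) c : unit_fun f -> 0 <= c <= 1 ->
  `|E1 (fun k => (K < k)%N%:R * (f k - c)) - E2 (fun k => (K < k)%N%:R * (f k - c))|
    <= tau.
Proof.
move=> f01 /andP[c0 c1].
have gen d' (T' : measurableType d') (Q : probability T' R) (Z : T' -> nat)
    (mZ : forall v, measurable (Z @^-1` [set v])) :
    Ex Q Z (fun k => (K < k)%N%:R) <= tau ->
    - (c * tau) <= Ex Q Z (fun k => (K < k)%N%:R * (f k - c)) <= (1 - c) * tau.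
  move=> ht.
  have iI := integ_ind Q mZ (fun k => (K < k)%N).
  have iF : integ Q Z (fun k => (K < k)%N%:R * (f k - c)).
    apply: (@integ_bounded _ _ _ Q _ Z mZ _ 1) => k; have := f01 k.
    case: (K < k)%N; rewrite ?mul1r ?mul0r ?normr0// ler_norml; lra.
  apply/andP; split.
    apply: (@le_trans _ _ (Ex Q Z (fun k => - c * (K < k)%N%:R))).
      by rewrite ExZ// mulNr lerN2 ler_wpM2l.
    apply: le_Ex => //; first exact: integZ.
    by move=> k; rewrite mulrC ler_wpM2l// lerBrDl subrr; case/andP: (f01 k).
  apply: (@le_trans _ _ (Ex Q Z (fun k => (1 - c) * (K < k)%N%:R))); last first.
    by rewrite ExZ// ler_wpM2l// subr_ge0.
  apply: le_Ex => //; first exact: integZ.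
  by move=> k; rewrite [leRHS]mulrC ler_wpM2l// lerD2r; case/andP: (f01 k).
have /andP[h1 h2] := gen _ _ P W mW tail1.
have /andP[h3 h4] := gen _ _ nu idfun mid tail2.
rewrite ler_norml; apply/andP; split; lra.
Qed.

(** The perturbing term is a multiple of the increment of [g], which takes
    values in an interval of length [2 / s]. After rescaling this interval to
    [0, 1], the two means of the increment differ by at most [2 / s * kappa].
    Beyond [K], where [g] vanishes, the equation leaves the error [f k - c]. *)
Lemma gap_contraction (kappa : R) : (forall f, unit_fun f -> gap f <= kappa) ->
  forall f, unit_fun f -> gap f <= B + 2 * (`|lam * be| / s) * kappa + tau.
Proof.
move=> Hk f f01.
have [g [c [c01 g01 gK geq gd]]] := solve f01.
pose h k := fdiff g k.+1.
have hs k : `|h k| <= s^-1 by exact: gd.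
have eqf k : f k - c = stein_op al be lam g k + lam * be * h k
    + (K < k)%N%:R * (f k - c).
  rewrite /stein_op /h; have [kK|Kk] := leqP k K.
    by rewrite mul0r addr0 subrK geq.
  rewrite mul1r /fdiff (gK _ Kk) (gK _ (leqW Kk)) (gK _ (leqW (leqW Kk))); ring.
have f1 k : `|f k| <= 1 by have /andP[? ?] := f01 k; rewrite ger0_norm.
have gen d' (T' : measurableType d') (Q : probability T' R) (Z : T' -> nat)
    (mZ : forall v, measurable (Z @^-1` [set v])) :
    Ex Q Z f - c = Ex Q Z (stein_op al be lam g) + lam * be * Ex Q Z h
      + Ex Q Z (fun k => (K < k)%N%:R * (f k - c)).
  have i1 := integ_bounded Q mZ f1.
  have i2 := integ_bounded Q mZ hs.
  have i3 : integ Q Z (fun k => (K < k)%N%:R * (f k - c)).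
    apply: (@integ_bounded _ _ _ Q _ Z mZ _ 1) => k; have := f01 k; move: c01.
    case: (K < k)%N; rewrite ?mul1r ?mul0r ?normr0// ler_norml; lra.
  have i4 : integ Q Z (fun k => f k - c) by apply: integB => //; exact: integ_cst.
  have i5 : integ Q Z (stein_op al be lam g).
    rewrite (_ : stein_op _ _ _ _ = (fun k => (f k - c) - lam * be * h k -
        (K < k)%N%:R * (f k - c))).
      by apply: integB => //; apply: integB => //; exact: integZ.
    by apply/funext => k; have := eqf k; lra.
  have i6 : integ Q Z (fun k => lam * be * h k) by exact: integZ.
  transitivity (Ex Q Z (fun k => f k - c)).
    by rewrite (ExB i1 (integ_cst Q Z c)) Ex_cst.
  rewrite (funext eqf) (ExD _ i3); last exact: integD.
  by rewrite (ExD i5 i6) ExZ.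
have e1 := gen _ _ P W mW; have e2 := gen _ _ nu idfun mid.
rewrite (E2_stein gK) in e2.
have st := E1_stein gK gd.
have tl := tail_difference f01 c01.
have hh : `|E1 h - E2 h| <= 2 / s * kappa.
  pose ft k := 2^-1 * (s * h k + 1).
  have ft01 : unit_fun ft.
    move=> k; have : `|s * h k| <= 1.
      by rewrite normrM (gtr0_norm s_gt0) -ler_pdivlMl// mulr1.
    by rewrite /ft ler_norml; lra.
  have gen2 d' (T' : measurableType d') (Q : probability T' R) (Z : T' -> nat)
    (mZ : forall v, measurable (Z @^-1` [set v])) :
    Ex Q Z ft = 2^-1 * (s * Ex Q Z h + 1).
    have i2 := integ_bounded Q mZ hs.
    rewrite /ft ExZ; last by apply: integD; [exact: integZ|exact: integ_cst].
    by rewrite (ExD (integZ s i2) (integ_cst Q Z 1)) Ex_cst ExZ.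
  have := Hk _ ft01; rewrite /gap (gen2 _ _ P W mW) (gen2 _ _ nu idfun mid).
  rewrite (_ : _ - _ = s / 2 * (E1 h - E2 h)); last by field.
  have s2 : 0 < s / 2 by rewrite divr_gt0.
  rewrite normrM (gtr0_norm s2) => hk.
  by rewrite -[2 / s]invf_div ler_pdivlMl.
rewrite /gap (_ : E1 f - E2 f = E1 (stein_op al be lam g)
  + lam * be * (E1 h - E2 h) + (E1 (fun k => (K < k)%N%:R * (f k - c))
    - E2 (fun k => (K < k)%N%:R * (f k - c)))); last first.
  move: e1 e2; set u1 := E1 f; set u2 := E2 f; lra.
apply: le_trans (ler_normD _ _) _; apply: lerD => //.
apply: le_trans (ler_normD _ _) _; apply: lerD => //.
rewrite normrM; apply: le_trans (ler_wpM2l (normr_ge0 _) hh) _.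
by rewrite le_eqVlt; apply/orP; left; apply/eqP; ring.
Qed.

(** The supremum of the gaps is finite, being at most 1, so the inequality
    that it satisfies by [gap_contraction] can be solved for it. *)
Lemma gap_bound f : unit_fun f ->
  gap f <= (B + tau) / (1 - 2 * (`|lam * be| / s)).
Proof.
move=> f01.
pose S := [set x | exists2 f, unit_fun f & x = gap f].
have S0 : S !=set0 by exists (gap f), f.
have Sb : has_ubound S by exists 1 => _ [h h01 ->]; exact: gap_le1.
have Hk h : unit_fun h -> gap h <= sup S.
  by move=> h01; apply: ub_le_sup => //; exists h.
have kb : sup S <= B + 2 * (`|lam * be| / s) * sup S + tau.
  by apply: ge_sup => // _ [h h01 ->]; exact: gap_contraction.
apply: le_trans (Hk _ f01) _.
have h0 : 0 < 1 - 2 * (`|lam * be| / s) by rewrite subr_gt0.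
rewrite ler_pdivlMr// mulrBr mulr1; move: kb; lra.
Qed.

Lemma dTV_bound (law : set nat -> \bar R) : (forall U, law U = nu U) ->
  (dTV (pushforward P W) law <=
    ((B + tau) / (1 - 2 * (`|lam * be| / s)))%:E)%E.
Proof.
move=> lawE; apply: ge_ereal_sup => _ [U _ <-].
rewrite lawE /pushforward.
pose f k : R := (k \in U)%:R.
have f01 : unit_fun f by move=> k; rewrite /f; case: (k \in U); rewrite ?lexx ler01.
have e1 : P (W @^-1` U) = (E1 f)%:E.
  rewrite (Ex_indicE P mW); congr (P _); apply/seteqP; split => t /=.
    by move=> ?; rewrite mem_set.
  by rewrite inE.
have e2 : nu U = (E2 f)%:E.
  rewrite (Ex_indicE nu mid); congr (nu _); apply/seteqP; split => t /=.
    by move=> ?; rewrite mem_set.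
  by rewrite inE.
by rewrite e1 e2 -EFinB /= lee_fin; exact: gap_bound.
Qed.

End TotalVariation.

(** * Comparison of the bracket sums *)

Section RealBracket.
Context {d : measure_display} {T : measurableType d} {R : realType}.
Variable P : probability T R.
Context {V : countType}.
Variable Y : T -> V.
Local Notation E := (Ex P Y).

(** Follows the recursion of [bracketE], with which it agrees as soon as the
    moments involved are finite, see [bracketE_real]. *)
Fixpoint bracket (u : V -> R) (s : seq (V -> R)) : R :=
  match s with
  | [::] => E u
  | z :: s' => bracket (fun x => u x * z x) s' + E u * bracket z s'
  end.

End RealBracket.

Section Brackets.
Context {d : measure_display} {T : measurableType d} {R : realType}.
Variable P : probability T R.
Context {I : finType}.
Local Notation V := {ffun I -> nat}.
Variable X : I -> T -> nat.
Hypothesis mX : forall i, measurable_fun setT (X i).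
Local Notation Y := (outcome X).
Local Notation mY := (measurable_outcome mX).
Local Notation E := (Ex P Y).
Local Notation nr u := (fun x : V => (u x)%:R : R).

Lemma nmeanE (u : V -> nat) : integ P Y (nr u) ->
  nmean P (u \o Y) = (E (nr u))%:E.
Proof.
move=> iu; rewrite /nmean unlock fineK//.
exact: integrable_fin_num.
Qed.

Lemma nmean_ge0 (Z : T -> nat) : (0 <= nmean P Z)%E.
Proof. by rewrite /nmean unlock; apply: integral_ge0 => t _; rewrite lee_fin. Qed.

Lemma bracketE_ge0 (Z : T -> nat) s : (0 <= bracketE P Z s)%E.
Proof.
elim: s Z => [|z s IH] Z /=; first exact: nmean_ge0.
by rewrite adde_ge0// mule_ge0// nmean_ge0.
Qed.

Lemma bracketE_real D (u : V -> nat) (s : seq (V -> nat)) k :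
  integ P Y (fun x => (tots x)%:R ^+ D) ->
  bnd k (nr u) -> {in s, forall z : V -> nat, bnd 1 (nr z)} ->
  (k + size s <= D)%N ->
  bracketE P (u \o Y) [seq z \o Y | z <- s] =
    (bracket P Y (nr u) [seq nr z | z <- s])%:E.
Proof.
move=> WD; elim: s u k => [|z s IH] u k bu bs kD.
  by rewrite /= nmeanE//; apply: (bnd_integ_deg mY WD _ bu); rewrite addn0 in kD.
have bz : bnd 1 (nr z) by apply: bs; rewrite mem_head.
have bs' : {in s, forall z : V -> nat, bnd 1 (nr z)}.
  by move=> w ws; apply: bs; rewrite in_cons ws orbT.
have kD' : (k + (size s).+1 <= D)%N := kD.
have iu : integ P Y (nr u) by apply: (bnd_integ_deg mY WD _ bu); lia.
rewrite /=.
rewrite (_ : (fun t => (u \o Y) t * (z \o Y) t)%N = (fun x => u x * z x)%N \o Y)//.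
have e : nr (fun x => u x * z x)%N = (fun x => (u x)%:R * (z x)%:R).
  by apply/funext => x; rewrite natrM.
have b2 : bnd (k + 1) (nr (fun x => u x * z x)%N) by rewrite e; exact: bnd_mul.
have k1 : (k + 1 + size s <= D)%N by lia.
have k2 : (1 + size s <= D)%N.
  by case: k {bu b2 iu} kD kD' k1 => [|k] *; lia.
by rewrite (IH _ _ b2 bs' k1) (IH _ _ bz bs' k2) nmeanE// -EFinM -EFinD e.
Qed.

End Brackets.

Section BracketComparison.
Context {d : measure_display} {T : measurableType d} {R : realType}.
Variable P : probability T R.
Context {I : finType}.
Local Notation V := {ffun I -> nat}.
Variable Y : T -> V.
Hypothesis mY : forall v, measurable (Y @^-1` [set v]).
Hypothesis W4 : integ P Y (fun x => (tots x)%:R ^+ 4).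
Local Notation E := (Ex P Y).
Variables (i : I) (A B C : {set I}).
Hypothesis iA : i \in A.
Hypothesis AB : A \subset B.
Hypothesis BC : B \subset C.
Local Notation xi := (fun x : V => (x i)%:R : R).
Local Notation a := (fun x : V => (tot A x)%:R : R).
Local Notation b := (fun x : V => (tot B x)%:R : R).
Local Notation c := (fun x : V => (tot C x)%:R : R).
Local Notation ex := (@excess R I i A).

Let xi_le_a (x : V) : (x i <= tot A x)%N.
Proof. by rewrite -(tot1 i x) tot_leq// finset.sub1set. Qed.
Let a_le_b (x : V) : (tot A x <= tot B x)%N. Proof. exact: tot_leq. Qed.
Let b_le_c (x : V) : (tot B x <= tot C x)%N. Proof. exact: tot_leq. Qed.

Let bxi : bnd 1 xi. Proof. exact: bnd_xi. Qed.
Let ba : bnd 1 a. Proof. exact: bnd_tot. Qed.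
Let bb : bnd 1 b. Proof. exact: bnd_tot. Qed.
Let bc : bnd 1 c. Proof. exact: bnd_tot. Qed.
Let bex : bnd 2 ex. Proof. exact: bnd_excess. Qed.

Let E_mono k (F G : V -> R) : (k <= 4)%N -> bnd k G -> (forall x, 0 <= F x <= G x) ->
  0 <= E F <= E G.
Proof.
move=> k4 bG FG; have iG := bnd_integ mY W4 k4 bG.
rewrite Ex_ge0 => [/=|x]; last by case/andP: (FG x).
apply: le_Ex => //; last by move=> x; case/andP: (FG x).
apply: (integ_le mY iG) => x; have /andP[F0 FGx] := FG x.
by rewrite ger0_norm.
Qed.

Lemma excessE (x : V) : ex x = (x i)%:R * (tot A x)%:R - (x i)%:R.
Proof.
have := xi_le_a x; rewrite /excess natrM; case: (tot A x) => [|n] h.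
  by rewrite (_ : x i = 0%N) ?mul0r ?subr0//; lia.
by rewrite /= -natr1; ring.
Qed.

Lemma bracket_bracket3 u : bracket P Y u [:: b; c] = bracket3 P Y B C u.
Proof. by rewrite /bracket3 /=; ring. Qed.

Lemma bracket3_excess :
  bracket3 P Y B C ex = bracket3 P Y B C (fun x => xi x * a x) - bracket3 P Y B C xi.
Proof.
have b1 : bnd 2 (fun x => xi x * a x) by exact: (bnd_mul bxi ba).
have b2 : bnd 2 (fun x => xi x * b x) by exact: (bnd_mul bxi bb).
have b3 : bnd 3 (fun x => xi x * b x * c x) by exact: (bnd_mul b2 bc).
have b4 : bnd 3 (fun x => xi x * a x * b x) by exact: (bnd_mul b1 bb).
have b5 : bnd 4 (fun x => xi x * a x * b x * c x) by exact: (bnd_mul b4 bc).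
have e0 : E ex = E (fun x => xi x * a x) - E xi.
  rewrite -ExB; [|exact: (bnd_integ mY W4 _ b1)|exact: (bnd_integ mY W4 _ bxi)].
  by congr Ex; apply/funext => x; rewrite excessE.
have e1 : E (fun x => ex x * b x) = E (fun x => xi x * a x * b x) - E (fun x => xi x * b x).
  rewrite -ExB; [|exact: (bnd_integ mY W4 _ b4)|exact: (bnd_integ mY W4 _ b2)].
  by congr Ex; apply/funext => x; rewrite excessE; ring.
have e2 : E (fun x => ex x * b x * c x) =
    E (fun x => xi x * a x * b x * c x) - E (fun x => xi x * b x * c x).
  rewrite -ExB; [|exact: (bnd_integ mY W4 _ b5)|exact: (bnd_integ mY W4 _ b3)].
  by congr Ex; apply/funext => x; rewrite excessE; ring.
by rewrite /bracket3 e0 e1 e2; ring.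
Qed.

Local Notation S8 := (bracket P Y xi [:: a; b; c]).
Local Notation S4 := (bracket P Y xi [:: b; c]).
Local Notation Q3 := (E xi * bracket3 P Y B C a + bracket3 P Y B C ex).
Local Notation Q2 := (E xi * bracket2 P Y B a + bracket2 P Y B ex).

(** Since the excess is [X_i * X_A - X_i], the remainder splits into the terms
    that start from [X_i * X_A], or from [X_A] with a separate factor [E X_i],
    which make up the eight-term sum, minus those that start from [X_i]. *)
Lemma rem3_bracket : Q3 = S8 - S4.
Proof.
rewrite bracket3_excess !bracket_bracket3 addrA; congr (_ - _).
by rewrite [RHS]/= -!/(bracket _ _ _ [:: b; c]) /bracket3 /=; ring.
Qed.

(** For integers, [X_B <= X_C] gives [X_B <= X_B * X_C]. *)
Lemma bracket2_le_bracket3 (u : V -> R) k : (k + 2 <= 4)%N -> bnd k u ->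
  (forall x, 0 <= u x) ->
  0 <= bracket2 P Y B u <= bracket3 P Y B C u.
Proof.
move=> k2 bu u0.
have b_bc (x : V) : b x <= b x * c x.
  by rewrite -natrM ler_nat; have := b_le_c x; nia.
have k4 : (k + 1 + 1 <= 4)%N by lia.
have k3 : (k + 1 <= 4)%N by lia.
have Eu : 0 <= E u by exact: Ex_ge0.
have Ec : 0 <= E c by exact: Ex_ge0.
have /andP[h1 h2] : 0 <= E b <= E (fun x => b x * c x).
  by apply: (@E_mono 2) => [//||x]; [exact: (bnd_mul bb bc)|rewrite b_bc andbT].
have bub : bnd (k + 1) (fun x => u x * b x) by exact: bnd_mul.
have /andP[h3 h4] : 0 <= E (fun x => u x * b x) <= E (fun x => u x * b x * c x).
  apply: (E_mono k4) => [|x]; first exact: bnd_mul.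
  by rewrite mulr_ge0//= -mulrA ler_wpM2l.
rewrite /bracket2 /bracket3; apply/andP; split; first by rewrite addr_ge0// mulr_ge0.
have h5 := ler_wpM2l Eu h2.
have h6 : 0 <= E u * E b * E c by rewrite !mulr_ge0.
have h7 : 0 <= E (fun x => u x * b x) * E c by rewrite mulr_ge0.
lra.
Qed.

Let Exi : 0 <= E xi. Proof. exact: Ex_ge0. Qed.

Lemma rem2_le_rem3 : 0 <= Q2 <= Q3.
Proof.
have /andP[h1 h2] := bracket2_le_bracket3 (k := 1) isT ba (fun x => ler0n _ _).
have /andP[h3 h4] := bracket2_le_bracket3 (k := 2) isT bex (fun x => ler0n _ _).
by rewrite addr_ge0 ?mulr_ge0//= lerD// ler_wpM2l.
Qed.

Lemma rem2_le_bracket : Q2 <= S4.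
Proof.
rewrite bracket_bracket3 /bracket2 /bracket3.
have Eb : 0 <= E b by exact: Ex_ge0.
have Ec : 0 <= E c by exact: Ex_ge0.
have Ea : 0 <= E a by exact: Ex_ge0.
have /andP[_ h1] : 0 <= E a <= E b.
  by apply: (@E_mono 1) => // x; rewrite ler0n ler_nat a_le_b.
have /andP[_ h2] : 0 <= E b <= E c.
  by apply: (@E_mono 1) => // x; rewrite ler0n ler_nat b_le_c.
have /andP[_ h3] : 0 <= E (fun x => a x * b x) <= E (fun x => b x * c x).
  apply: (@E_mono 2) => [//||x]; first exact: (bnd_mul bb bc).
  by rewrite mulr_ge0//= ler_pM// ler_nat ?a_le_b ?b_le_c.
have ex_b (x : V) : (x i * (tot A x).-1 <= x i * tot B x)%N.
  by rewrite leq_mul// (leq_trans (leq_pred _))// a_le_b.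
have ex_c (x : V) : (x i * (tot A x).-1 * tot B x <= x i * tot B x * tot C x)%N.
  rewrite -!mulnA leq_mul// mulnC leq_mul//.
  by rewrite (leq_trans (leq_pred _))// (leq_trans (a_le_b x))// b_le_c.
have b2 : bnd 2 (fun x => xi x * b x) by exact: (bnd_mul bxi bb).
have /andP[h40 h4] : 0 <= E ex <= E (fun x => xi x * b x).
  apply: (@E_mono 2) => [//|//|x].
  by rewrite ler0n/= -natrM ler_nat.
have /andP[h50 h5] : 0 <= E (fun x => ex x * b x) <= E (fun x => xi x * b x * c x).
  apply: (@E_mono 3) => [//||x]; first exact: (bnd_mul b2 bc).
  by rewrite mulr_ge0//= -!natrM ler_nat.
have h6 : E a * E b <= E b * E c by apply: ler_pM.
have h7 := ler_wpM2l Exi h6; have h8 := ler_wpM2l Exi h3.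
have h9 : E ex * E b <= E (fun x => xi x * b x) * E c by apply: ler_pM.
rewrite mulrDr; move: h5 h7 h8 h9; lra.
Qed.

(** For integers, [X_i <= X_A <= X_B <= X_C] gives
    [X_i <= X_i * X_A * X_B * X_C]. The bound by the mean is what absorbs the
    tails in the binomial case. *)
Lemma bracket_ge_mean : E xi <= S8.
Proof.
have b2 : bnd 2 (fun x => xi x * a x) by exact: (bnd_mul bxi ba).
have b3 : bnd 3 (fun x => xi x * a x * b x) by exact: (bnd_mul b2 bb).
have /andP[_ h1] : 0 <= E xi <= E (fun x => xi x * a x * b x * c x).
  apply: (@E_mono 4) => [//||x]; first exact: (bnd_mul b3 bc).
  rewrite ler0n -!natrM ler_nat/=.
  have := xi_le_a x; have := a_le_b x; have := b_le_c x.
  case: (x i) => // n h3 h2 h1.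
  by rewrite -!mulnA leq_pmulr// !muln_gt0; lia.
rewrite /=.
have h2 : 0 <= E (fun x => xi x * a x * b x) * E c by rewrite mulr_ge0//; apply: Ex_ge0 => x; rewrite ?mulr_ge0.
have h3 : 0 <= E (fun x => xi x * a x) * (E (fun x => b x * c x) + E b * E c).
  by rewrite mulr_ge0 ?addr_ge0 ?mulr_ge0//; apply: Ex_ge0 => x; rewrite ?mulr_ge0.
have h4 : 0 <= E xi * (E (fun x => a x * b x * c x) + E (fun x => a x * b x) * E c +
    E a * (E (fun x => b x * c x) + E b * E c)).
  by rewrite !(mulr_ge0, addr_ge0)//; apply: Ex_ge0 => x; rewrite ?mulr_ge0.
by move: h1 h2 h3 h4; lra.
Qed.

End BracketComparison.

(** * The mean of the Stein operator and the two approximations *)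

Section Approximation.
Context {d : measure_display} {T : measurableType d} {R : realType}.
Variable P : probability T R.
Context {I : finType}.
Local Notation V := {ffun I -> nat}.
Variable X : I -> T -> nat.
Hypothesis mX : forall i, measurable_fun setT (X i).
Local Notation Y := (outcome X).
Local Notation mY := (measurable_outcome mX).
Local Notation W := (rvsum X).
Local Notation E := (Ex P Y).
Variables (A B C : I -> {set I}).
Hypothesis loc : locally_dependent P X A B C.
Local Notation m k := (E (fun x => (tots x)%:R ^+ k)).
Local Notation G2 := (m 2 - m 1 ^+ 2 - m 1).
Local Notation G3 := (m 3 - 3 * m 1 * m 2 + 2 * m 1 ^+ 3 - 3 * m 2 + 3 * m 1 ^+ 2 + 2 * m 1).
Local Notation dd i := (ess_smooth P X (C i)).
Local Notation Q3 i := (rem3 P Y A B C i).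
Local Notation Q2 i := (rem2 P Y A B i).
Local Notation xi i := (fun x : V => (x i)%:R : R).
Local Notation S8 i := (bracket P Y (xi i) [:: (fun x : V => (tot (A i) x)%:R : R);
  (fun x : V => (tot (B i) x)%:R : R); (fun x : V => (tot (C i) x)%:R : R)]).
Local Notation S4 i := (bracket P Y (xi i)
  [:: (fun x : V => (tot (B i) x)%:R : R); (fun x : V => (tot (C i) x)%:R : R)]).

Lemma rvsum_outcome : W = @tots I \o Y.
Proof. by apply/funext => t; exact: rvsumE. Qed.

Lemma measurable_total v : measurable (W @^-1` [set v]).
Proof.
rewrite rvsum_outcome.
exact: (measurable_countable_preimage mY [set x | tots x = v]).
Qed.

Lemma Ex_total (F : nat -> R) : Ex P W F = E (F \o @tots I).
Proof. by rewrite rvsum_outcome. Qed.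

Lemma integ_total (F : nat -> R) : integ P W F = integ P Y (F \o @tots I).
Proof. by rewrite rvsum_outcome. Qed.

Lemma outcome_coord i : X i = (fun x : V => x i) \o Y.
Proof. by apply/funext => t; rewrite /= ffunE. Qed.

Lemma outcome_tot S : subsum X S = @tot I S \o Y.
Proof. by apply/funext => t; exact: subsumE. Qed.

Lemma bracketE4 D i : (3 <= D)%N -> integ P Y (fun x => (tots x)%:R ^+ D) ->
  bracketE P (X i) [:: subsum X (B i); subsum X (C i)] = (S4 i)%:E.
Proof.
move=> D3 WD; rewrite outcome_coord !outcome_tot.
apply: (@bracketE_real _ _ _ P _ _ mX D _
  [:: (fun x => tot (B i) x); (fun x => tot (C i) x)] 1 WD) => //.
- exact: bnd_xi.
- by move=> z; rewrite !inE => /orP[] /eqP ->; exact: bnd_tot.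
Qed.

Lemma bracketE8 i : integ P Y (fun x => (tots x)%:R ^+ 4) ->
  bracketE P (X i) [:: subsum X (A i); subsum X (B i); subsum X (C i)] = (S8 i)%:E.
Proof.
move=> WD; rewrite outcome_coord !outcome_tot.
apply: (@bracketE_real _ _ _ P _ _ mX 4 _
  [:: (fun x => tot (A i) x); (fun x => tot (B i) x); (fun x => tot (C i) x)] 1 WD) => //.
- exact: bnd_xi.
- by move=> z; rewrite !inE => /or3P[] /eqP ->; exact: bnd_tot.
Qed.

Lemma Xi_real be i : integ P Y (fun x => (tots x)%:R ^+ 4) ->
  Xi P X A B C be i = (9 * ((1 - be) * S8 i + be * S4 i) * dd i)%:E.
Proof.
move=> W4; rewrite /Xi (bracketE8 i W4) (bracketE4 i (isT : 3 <= 4)%N W4).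
by rewrite (ess_smoothE P mX) -!EFinM.
Qed.

Lemma smooth_lower i : integ P Y (fun x => (tots x)%:R ^+ 2) ->
  1 / 3 / Num.max (total_var P Y) 1 <= dd i.
Proof.
move=> W2; apply: (smooth_given_lower mY (ess_smooth_ge0 P mX (C i)) _ W2).
exact: smooth_given_ess.
Qed.

Lemma target_stein (nu : probability nat R) (mass : nat -> R) (al be lam : R)
    (K : nat) (g : nat -> R) :
  (forall k, nu [set k] = (mass k)%:E) ->
  mass 1%N = (al + lam * be) * mass 0%N ->
  (forall k, k.+2%:R * mass k.+2 =
    (al + lam * be + be * k.+1%:R) * mass k.+1 - lam * be * mass k) ->
  (forall k, (K < k)%N -> g k = 0) ->
  Ex nu idfun (stein_op al be lam g) = 0.
Proof.
move=> nuE m1 mS gK.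
have mid v : measurable ((@idfun nat) @^-1` [set v]) by [].
rewrite (@Ex_finite_support _ _ _ nu idfun mid _ K.+1); last first.
  move=> k Kk; rewrite /stein_op /fdiff (gK k Kk) (gK k.+1 (leqW Kk)).
  by rewrite (gK k.+2 (leqW (leqW Kk))); ring.
have ind k : Ex nu idfun (fun j => (j == k)%:R) = mass k.
  apply: EFin_inj; rewrite (Ex_indicE nu mid) -nuE; congr (nu _).
  by apply/seteqP; split => j /= /eqP.
under eq_bigr do rewrite ind mulrC.
rewrite (sum_stein_op m1 mS) (gK K.+1 (leqnn _)) (gK K.+2 (leqW (leqnn _))).
by rewrite !mulr0 subrr.
Qed.

Hypothesis W4 : integ P Y (fun x => (tots x)%:R ^+ 4).

Lemma integ_moment k : (k <= 4)%N -> integ P Y (fun x => (tots x)%:R ^+ k).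
Proof.
move=> k4; apply: (bnd_integ mY W4 k4); exists 1 => x.
rewrite mul1r ger0_norm ?exprn_ge0//.
by rewrite lerXn2r ?nnegrE// ler_nat.
Qed.

Lemma finsupp_growth k (g : nat -> R) K : (forall j, (K < j)%N -> g j = 0) ->
  growth k g.
Proof.
move=> gK; exists (\sum_(0 <= j < K.+1) `|g j|) => j.
have S0 : 0 <= \sum_(0 <= j < K.+1) `|g j| by apply: sumr_ge0.
have [jK|Kj] := leqP j K; last by rewrite gK// normr0 mulr_ge0// exprn_ge0.
apply: (@le_trans _ _ (\sum_(0 <= j < K.+1) `|g j|)); last first.
  by rewrite ler_peMr// exprn_ege1// ler1n.
rewrite (bigD1_seq j) ?mem_index_iota ?iota_uniq ?ltnS//= lerDl.
by apply: sumr_ge0.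
Qed.

Section SteinBound.
Variables (be lam : R).
Hypothesis be1 : be <= 1.

(** The equation between the second and the third cumulant is the vanishing
    of the coefficient of [E (fdiff (fdiff g) (W + 1))] in the expansion. *)
Lemma stein_op_bound (K : nat) (s : R) (g : nat -> R) :
  (1 - be) * G3 / 2 = be * G2 -> 0 < s ->
  (forall j, (K < j)%N -> g j = 0) -> (forall k, `|g k.+1 - g k| <= s^-1) ->
  `|E (fun x => stein_op ((1 - be) * m 1) be lam g (tots x))| <=
  s^-1 * (`|be * (m 1 - lam) - (1 - be) * G2| +
    \sum_i dd i * ((1 - be) * Q3 i + `|be| * Q2 i)).
Proof.
move=> hc2 s0 gK gd.
have nest := locally_dependent_nested mX loc.
have indA i : nested_indep P Y [set i]%SET (A i) by have [] := nest i.
have indB i : nested_indep P Y (A i) (B i) by have [] := nest i.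
have indC i : nested_indep P Y (B i) (C i) by have [] := nest i.
have [c1 [c2 H]] := stein_op_expansion mY W4 indA indB indC lam be1.
have m1E : E (fun x => (tots x)%:R) = m 1 by [].
rewrite m1E in H.
have i1 : integ P Y (fun x => (tots x)%:R) by exact: (integ_moment (k := 1)).
have i2 := integ_moment (isT : 2 <= 4)%N.
have i3 := integ_moment (isT : 3 <= 4)%N.
have zero_small S : cal_small P Y S (fun=> 0 : R) 0.
  move=> w k _ _ _ _; rewrite mul0r (_ : cal S w (fun=> 0) = fun=> 0).
    by rewrite Ex_cst normr0.
  by apply/funext => x; rewrite /cal big1// => l _; rewrite mulr0.
have growth_cst k (c : R) : growth k (fun=> c).
  exists `|c| => j; by rewrite ler_peMr// exprn_ege1// ler1n.
have d1 : fdiff (fun k => k%:R : R) = (fun=> 1).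
  by apply/funext => k; rewrite /fdiff -natr1; ring.
have d0 (c : R) : fdiff (fun=> c) = (fun=> 0) by apply/funext => k; rewrite /fdiff subrr.
pose g2 (k : nat) : R := k%:R * (k%:R - 1) / 2.
have d2 : fdiff g2 = (fun k => k%:R).
  by apply/funext => k; rewrite /fdiff /g2 -natr1; field.
have gr1 : growth 1 (fun k => k%:R : R).
  by exists 1 => k; rewrite ger0_norm// mul1r expr1 ler_nat.
have gr2 k : growth k.+1 (fun k => k%:R : R).
  exists 1 => j; rewrite ger0_norm// mul1r -natrX ler_nat.
  by rewrite expnS; have : (0 < j.+1 ^ k)%N by [rewrite expn_gt0]; nia.
have sum0 : \sum_i (0 : R) * ((1 - be) * Q3 i + `|be| * Q2 i) = 0.
  by rewrite big1// => i _; rewrite mul0r.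
(* The coefficients are independent of [g] and the remainder involves third
   differences only, so linear and quadratic [g] determine them. *)
have c1E : c1 = be * (m 1 - lam) - (1 - be) * G2.
  have := H (fun k => k%:R) (fun=> 0); rewrite d1 !d0 => h.
  have := h (gr2 1%N) (growth_cst 1%N 1) (growth_cst 0%N 0) (growth_cst 0%N 0)
    (fun=> lexx 0) (fun i => zero_small (C i)) (fun i => zero_small (B i)).
  rewrite sum0 normr_le0 !Ex_cst mulr1 mulr0 subr0 subr_eq0 => /eqP <-.
  rewrite (_ : (fun x => _) = (fun x => ((1 - be) * m 1 + be - be * 0) * (tots x)%:R
     - (1 - be) * (tots x)%:R ^+ 2 + ((1 - be) * m 1 - lam * be))); last first.
    by apply/funext => x; rewrite /stein_op d1 -natr1; ring.
  rewrite ExD; [|by apply: integB; exact: integZ|exact: integ_cst].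
  rewrite ExB; [|exact: integZ|exact: integZ].
  by rewrite !ExZ// Ex_cst; ring.
have c2E : c2 = - ((1 - be) * G3 / 2) + be * G2.
  have := H g2 (fun=> 0); rewrite d2 d1 !d0 => h.
  have gg : growth 2 g2.
    exists 1 => j; rewrite mul1r ger0_norm.
      rewrite /g2 -natr1 -subr_ge0 [X in 0 <= X](_ : _ = j%:R ^+ 2 / 2 + 5 / 2 * j%:R + 1).
        by rewrite !addr_ge0 ?mulr_ge0 ?exprn_ge0.
      by field.
    rewrite /g2 divr_ge0//; case: j => [|j]; first by rewrite mul0r.
    by rewrite -[X in _ * (X - 1)]natr1 addrK mulr_ge0.
  have := h gg (gr2 0%N) (growth_cst 0%N 1) (growth_cst 0%N 0)
    (fun=> lexx 0) (fun i => zero_small (C i)) (fun i => zero_small (B i)).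
  rewrite sum0 normr_le0 !Ex_cst mulr1 subr_eq0 => /eqP <-.
  rewrite (_ : (fun x => (tots x).+1%:R) = (fun x => (tots x)%:R + 1)); last first.
    by apply/funext => x; rewrite natr1.
  rewrite (ExD i1 (integ_cst _ _ 1)) Ex_cst c1E.
  rewrite (_ : (fun x => _) = (fun x =>
     ((1 - be) * m 1 / 2 - lam * be) * (tots x)%:R +
     ((1 - be) * m 1 / 2 + be / 2 + 1 / 2) * (tots x)%:R ^+ 2
     - (1 - be) / 2 * (tots x)%:R ^+ 3 - lam * be)); last first.
    by apply/funext => x; rewrite /stein_op d2 /g2 -natr1; field.
  rewrite ExB; [|by apply: integB; [apply: integD; exact: integZ|exact: integZ]|exact: integ_cst].
  rewrite ExB; [|by apply: integD; exact: integZ|exact: integZ].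
  rewrite ExD; [|exact: integZ|exact: integZ].
  by rewrite Ex_cst !ExZ// m1E; field.
have c20 : c2 = 0 by rewrite c2E hc2 addNr.
have gK1 j : (K < j)%N -> fdiff g j = 0.
  by move=> Kj; rewrite /fdiff !gK// ?subrr// leqW.
have gK2 j : (K < j)%N -> fdiff (fdiff g) j = 0.
  by move=> Kj; rewrite /fdiff -!/(fdiff _ _) /fdiff !gK// ?subrr//; lia.
have gK3 j : (K < j)%N -> fdiff (fdiff (fdiff g)) j = 0.
  by move=> Kj; rewrite /fdiff !gK//; [ring|lia..].
have fb : finsupp_bounded (fdiff g) s^-1.
  by split => //; exists K.+1 => k Kk; exact: gK1.
have dd0 i : 0 <= dd i := ess_smooth_ge0 P mX (C i).
have sV : 0 <= s^-1 by rewrite invr_ge0 ltW.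
have loc_sub i : (A i \subset B i) /\ (B i \subset C i).
  by have [[]] := loc i.
have := H g (fun i => s^-1 * dd i) (finsupp_growth 2 gK) (finsupp_growth 1 gK1)
  (finsupp_growth 0 gK2) (finsupp_growth 0 gK3) (fun i => mulr_ge0 sV (dd0 i)).
have smC i : cal_small P Y (C i) (fdiff (fdiff (fdiff g))) (s^-1 * dd i).
  exact: (cal_small_smooth mY W4 (subxx _) (dd0 i) (smooth_given_ess P mX (C i)) fb).
have smB i : cal_small P Y (B i) (fdiff (fdiff (fdiff g))) (s^-1 * dd i).
  exact: (cal_small_smooth mY W4 (loc_sub i).2 (dd0 i) (smooth_given_ess P mX (C i)) fb).
move=> /(_ smC smB); rewrite c20 mul0r subr0.
set e1 := E _; set e2 := E (fun x => fdiff g _).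
have e2le : `|e2| <= s^-1.
  rewrite -[leRHS](Ex_cst P Y); apply: le_abs_Ex.
  - by apply: (@integ_bounded _ _ _ P _ Y mY _ s^-1) => x; exact: gd.
  - exact: integ_cst.
  - by move=> x; exact: gd.
move=> hmain.
have h1 : `|e1| <= `|c1 * e2| + `|e1 - c1 * e2|.
  by have := ler_normD (c1 * e2) (e1 - c1 * e2); rewrite addrC subrK.
apply: le_trans h1 _; rewrite mulrDr; apply: lerD.
  by rewrite normrM c1E mulrC ler_wpM2r.
apply: le_trans hmain _; rewrite mulr_sumr; apply: ler_sum => i _.
by rewrite mulrA.
Qed.

End SteinBound.

(** The cut-off [K], the constant [s] and the bound [tau] on the tails stay
    free, for the two families make different choices. *)
Lemma approximation (nu : probability nat R) (law : set nat -> \bar R)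
    (mass : nat -> R) (be lam s tau : R) (K : nat) :
  let al := (1 - be) * m 1 in
  (forall U, law U = nu U) -> (forall k, nu [set k] = (mass k)%:E) ->
  mass 1%N = (al + lam * be) * mass 0%N ->
  (forall k, k.+2%:R * mass k.+2 =
    (al + lam * be + be * k.+1%:R) * mass k.+1 - lam * be * mass k) ->
  be <= 1 -> (1 - be) * G3 / 2 = be * G2 ->
  0 < s -> s <= K%:R -> (0 < K)%N ->
  (forall k, (k < K)%N -> 0 < al + be * k%:R) ->
  (forall k, (0 < k < K)%N ->
    s * (bd_above (fun k => al + be * k%:R) K k.+1 / (al + be * k%:R) +
      bd_below (fun k => al + be * k%:R) k / k%:R) <=
    bd_below (fun k => al + be * k%:R) K.+1) ->
  2 * (`|lam * be| / s) < 1 ->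
  Ex P W (fun k => (K < k)%N%:R) <= tau ->
  Ex nu idfun (fun k => (K < k)%N%:R) <= tau ->
  (dTV (pushforward P W) law <=
   ((s^-1 * (`|be * (m 1 - lam) - (1 - be) * G2| +
      \sum_i dd i * ((1 - be) * Q3 i + `|be| * Q2 i)) + tau) /
      (1 - 2 * (`|lam * be| / s)))%:E)%E.
Proof.
move=> al lawE nuE m1 mS be1 hc2 s0 sK K0 al0 sb sm t1 t2.
apply: (@dTV_bound _ _ _ P W measurable_total nu al be lam s K) => //.
- move=> f f01.
  apply: (@stein_solution R (fun k => al + be * k%:R)) => //.
  by move=> k kK; rewrite -natr1; have := be1; lra.
- move=> g gK gd; rewrite Ex_total.
  exact: (stein_op_bound lam be1 hc2 s0 gK gd).
- by move=> g gK; exact: (target_stein nuE m1 mS gK).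
Qed.

Lemma sub_sets i : [/\ i \in A i, A i \subset B i & B i \subset C i].
Proof. by have [] := loc i. Qed.

Lemma rem3E i : Q3 i = S8 i - S4 i.
Proof. have [iA AB BC] := sub_sets i; exact: (rem3_bracket mY W4). Qed.

Lemma rem2_bounds i : [/\ 0 <= Q2 i, Q2 i <= Q3 i & Q2 i <= S4 i].
Proof.
have [iA AB BC] := sub_sets i.
have /andP[h1 h2] : 0 <= Q2 i <= Q3 i by exact: (rem2_le_rem3 mY W4).
by split => //; exact: (rem2_le_bracket mY W4).
Qed.

Lemma mean_le_S8 i : E (xi i) <= S8 i.
Proof. by have [iA AB BC] := sub_sets i; exact: (bracket_ge_mean mY W4). Qed.

Lemma mean_total : m 1 = \sum_i E (xi i).
Proof.
rewrite -Ex_sum; last by move=> i; apply: (bnd_integ mY W4 _ (bnd_xi i)).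
by congr Ex; apply/funext => x; rewrite expr1 tots_natE.
Qed.

Lemma mean_ge0 : 0 <= m 1.
Proof. by apply: Ex_ge0 => x; rewrite expr1. Qed.

(** All the birth rates are positive, so [K] may be taken so large that the
    tails are negligible. All three cumulants match exactly, whence the
    coefficient of the first difference is zero. *)
Lemma negbin_case (r pbar lam : R) :
  r = 4 * G2 ^+ 3 / G3 ^+ 2 -> pbar = 2 * G2 / (2 * G2 + G3) ->
  lam = m 1 - r * (1 - pbar) / pbar ->
  0 < r -> 0 < pbar < 1 -> 0 < lam ->
  lam * (1 - pbar) < (r * (1 - pbar) + lam * pbar) / 2 ->
  (dTV (pushforward P W) (law_M2 r pbar lam) <=
   (Theta2 r pbar lam * \sum_i dd i * (pbar * Q3 i + (1 - pbar) * Q2 i))%:E)%E.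
Proof.
move=> rE pE lE r0 p01 l0 hsmall; have /andP[p0 p1] := p01.
set q : R := 1 - pbar; have q0 : 0 < q by rewrite subr_gt0.
have q1 : q < 1 by rewrite /q; lra.
set G2' := G2 in rE pE *; set G3' := G3 in rE pE *.
have G3n : G3' != 0.
  by apply/eqP => h; move: r0; rewrite rE h expr0n/= invr0 mulr0 ltxx.
have G2n : G2' != 0.
  by apply/eqP => h; move: r0; rewrite rE h expr0n/= mulr0 mul0r ltxx.
have Dn : 2 * G2' + G3' != 0.
  by apply/eqP => h; move: p0; rewrite pE h invr0 mulr0 ltxx.
have pq : pbar * G3' / 2 = q * G2' by rewrite /q pE; field.
have rq : r * q / pbar * q = pbar * G2'.
  by rewrite /q rE pE; field; rewrite ?G3n ?G2n ?Dn.
set al := r * q + lam * pbar.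
have al0 : 0 < al by rewrite addr_gt0 ?mulr_gt0.
have m1E : m 1 = lam + r * q / pbar by rewrite lE subrK.
have alE : (1 - q) * m 1 = al by rewrite m1E /al /q; field; rewrite gt_eqF.
have pbE : 1 - q = pbar by rewrite /q subKr.
have bnd0 k : 0 <= negbin_pmf r pbar k by exact: negbin_pmf_ge0.
have poi0 k : 0 <= poisson_pmf lam k by exact: poisson_pmf_ge0.
have sumb : \esum_(k in [set: nat]) (negbin_pmf r pbar k)%:E = 1%E.
  by apply: esum_cvg => //; exact: negbin_pmf_cvg.
have mb i : negbin_prob r pbar [set i] = (negbin_pmf r pbar i)%:E.
  by rewrite /negbin_prob esum_set1// lee_fin.
have [nu lawE nuE] := law_conv_probability bnd0 poi0 mb
  (fun k => poisson_law_mass k l0) sumb (poisson_pmf_total l0).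
have [rec1 rec2] := conv_mass_recursion (negbin_pmfS r pbar)
  (fun k => poisson_pmfS k l0).
have alq : r * q + lam = al + lam * q by rewrite /al /q; ring.
rewrite -/q alq in rec1 rec2.
set th := lam * q / al.
have th1 : 2 * th < 1.
  have : lam * q < al / 2 by exact: hsmall.
  by rewrite /th mulrA ltr_pdivrMr// mul1r; lra.
have normE : `|lam * q| = lam * q by rewrite ger0_norm// mulr_ge0 ?ltW.
set S := \sum_i _.
have hTh : Theta2 r pbar lam = al^-1 / (1 - 2 * th).
  rewrite /Theta2 /theta2 -/q -/al -/th /th; field.
  rewrite !gt_eqF//.
  by move: th1; rewrite /th mulrA ltr_pdivrMr// mul1r; rewrite subr_gt0; lra.
have key e : 0 < e -> (dTV (pushforward P W) (law_M2 r pbar lam) <=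
    ((al^-1 * S + e) / (1 - 2 * th))%:E)%E.
  move=> e0.
  have [N1 H1] := Ex_tail_small P measurable_total e0.
  have mid v : measurable ((@idfun nat) @^-1` [set v]) by [].
  have [N2 H2] := Ex_tail_small nu mid e0.
  pose K := maxn (maxn N1 N2) (Num.truncn al).+1.
  have alK : al <= K%:R.
    by apply/ltW/(lt_le_trans (truncnS_gt al)); rewrite ler_nat leq_maxr.
  have K0 : (0 < K)%N by rewrite /K leq_max orbT.
  have N1K : (N1 <= K)%N by rewrite /K !leq_max leqnn.
  have N2K : (N2 <= K)%N by rewrite /K !leq_max leqnn orbT.
  have h := @approximation nu (law_M2 r pbar lam) (conv_mass (negbin_pmf r pbar)
    (poisson_pmf lam)) q lam al e K.
  have c10 : q * (m 1 - lam) - (1 - q) * G2 = 0.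
    rewrite pbE -/G2' -rq m1E; ring.
  have := h lawE nuE; rewrite alE c10 normr0 add0r pbE (gtr0_norm q0) normE -/th.
  apply => //.
  - exact: ltW.
  - by move=> k _; rewrite ltr_wpDr// mulr_ge0// ltW.
  - move=> k kK; apply: (@negbin_stein_factor R al q) => //.
    by rewrite !ltW.
  - exact: H1.
  - exact: H2.
rewrite hTh; apply/lee_addgt0Pr => e e0.
have th0 : 0 < 1 - 2 * th by rewrite subr_gt0.
apply: le_trans (key (e * (1 - 2 * th)) _) _; first by rewrite mulr_gt0.
rewrite -EFinD lee_fin le_eqVlt; apply/orP; left; apply/eqP.
by field; rewrite !gt_eqF.
Qed.

Lemma total_varE : total_var P Y = m 2 - m 1 ^+ 2.
Proof.
have i1 := integ_moment (isT : 1 <= 4)%N.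
have i2 := integ_moment (isT : 2 <= 4)%N.
have mE : total_mean P Y = m 1 by [].
rewrite /total_var mE (_ : (fun x => _) = (fun x : V => (tots x)%:R ^+ 2
  - 2 * m 1 * (tots x)%:R ^+ 1 + m 1 ^+ 2)); last by apply/funext => x; ring.
have i3 : integ P Y (fun x => 2 * m 1 * (tots x)%:R ^+ 1) by exact: integZ.
rewrite (ExD (integB i2 i3) (integ_cst P Y _)) Ex_cst (ExB i2 i3) ExZ//; ring.
Qed.

Lemma chebyshev_total (K : nat) : m 1 < K.+1%:R ->
  Ex P W (fun k => (K < k)%N%:R) * (K.+1%:R - m 1) ^+ 2 <= total_var P Y.
Proof.
move=> mK; set t := K.+1%:R - m 1.
have t0 : 0 < t by rewrite subr_gt0.
have i1 := integ_moment (isT : 1 <= 4)%N.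
have i2 := integ_moment (isT : 2 <= 4)%N.
rewrite Ex_total mulrC -ExZ; last exact: (integ_ind P mY (fun x => (K < tots x)%N)).
apply: le_Ex.
- by apply: integZ; exact: (integ_ind P mY (fun x => (K < tots x)%N)).
- have mE : total_mean P Y = m 1 by [].
  rewrite mE (_ : (fun x => _) = (fun x : V => (tots x)%:R ^+ 2
    - 2 * m 1 * (tots x)%:R ^+ 1 + m 1 ^+ 2)); last by apply/funext => x; ring.
  by apply: integD; [apply: integB => //; exact: integZ|exact: integ_cst].
move=> x /=; have mE : total_mean P Y = m 1 by [].
rewrite mE; case: ltnP => Kx; last by rewrite mulr0 sqr_ge0.
have h : t <= (tots x)%:R - m 1 by rewrite lerD2r ler_nat.
by rewrite mulr1 lerXn2r ?nnegrE ?(ltW t0)// (le_trans (ltW t0)).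
Qed.

(** Chebyshev's inequality, with the tail beyond a large [N] split off since
    only partial sums of the second moment are under control. *)
Lemma target_tail (nu : probability nat R) (mass : nat -> R) (be lam : R) (K : nat) :
  let al := (1 - be) * m 1 in
  (forall k, nu [set k] = (mass k)%:E) ->
  mass 1%N = (al + lam * be) * mass 0%N ->
  (forall k, k.+2%:R * mass k.+2 =
    (al + lam * be + be * k.+1%:R) * mass k.+1 - lam * be * mass k) ->
  be < 0 -> 0 < lam -> m 1 < K.+1%:R ->
  Ex nu idfun (fun k => (K < k)%N%:R) * (K.+1%:R - m 1) ^+ 2 <=
    (m 1 - lam * be) / (1 - be).
Proof.
move=> al nuE m1 mS be0 l0 mK; set t := K.+1%:R - m 1.
have t0 : 0 < t by rewrite subr_gt0.
have mid v : measurable ((@idfun nat) @^-1` [set v]) by [].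
have ind k : Ex nu idfun (fun j => (j == k)%:R) = mass k.
  apply: EFin_inj; rewrite (Ex_indicE nu mid) -nuE; congr (nu _).
  by apply/seteqP; split => j /= /eqP.
have mass0 k : 0 <= mass k by rewrite -ind; exact: Ex_ge0.
have EM (F : nat -> R) n : Ex nu idfun (fun k => F k * (k < n)%N%:R) =
    \sum_(0 <= k < n) mass k * F k.
  rewrite (@Ex_finite_support _ _ _ nu idfun mid _ n); last first.
    by move=> k nk; rewrite ltnNge nk mulr0.
  by rewrite !big_nat; apply: eq_bigr => k /andP[_ kn]; rewrite ind kn mulr1 mulrC.
have mass1 n : \sum_(0 <= k < n) mass k <= 1.
  under eq_bigr do rewrite -[mass _]mulr1.
  rewrite -(EM (fun=> 1)) -[leRHS](Ex_cst nu (@idfun nat)); apply: le_Ex.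
  - by apply: (integ_indic mid); exact: integ_cst.
  - exact: integ_cst.
  - by move=> k; rewrite mul1r lern1 leq_b1.
have iK (Q : pred nat) : integ nu idfun (fun k => (Q k)%:R : R) := integ_ind nu mid Q.
apply/ler_addgt0Pr => e e0.
have [N HN] := Ex_tail_small nu mid (divr_gt0 e0 (exprn_gt0 2 t0)).
have h1 : Ex nu idfun (fun k => (K < k)%N%:R) <=
    Ex nu idfun (fun k => ((K < k)%N && (k < N.+1)%N)%:R) +
    Ex nu idfun (fun k => (N < k)%N%:R).
  rewrite -ExD//; apply: le_Ex => //; first exact: integD.
  move=> k; rewrite -natrD ler_nat ltnS.
  by case: (K < k)%N; case: (leqP k N).
have h2 : Ex nu idfun (fun k => ((K < k)%N && (k < N.+1)%N)%:R) * t ^+ 2 <=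
    (m 1 - lam * be) / (1 - be).
  apply: le_trans (sum_square_le m1 mS mass0 mass1 (erefl _) be0 l0 mean_ge0 N.+1).
  rewrite -EM mulrC -ExZ//; apply: le_Ex.
  - exact: integZ.
  - have bnd_sq k : `|(k%:R - m 1) ^+ 2 * (k < N.+1)%N%:R| <= (N.+1%:R + m 1) ^+ 2 :> R.
      have m10 := mean_ge0.
      case: ltnP => kN; last by rewrite mulr0 normr0 sqr_ge0.
      rewrite mulr1 normrX lerXn2r ?nnegrE ?addr_ge0//.
      apply: le_trans (ler_normB _ _) _; rewrite !ger0_norm// lerD2r ler_nat.
      exact: ltnW.
    exact: (integ_bounded nu mid bnd_sq).
  move=> k; case: ltnP => Kk /=; last first.
    by rewrite mulr0 mulr_ge0// sqr_ge0.
  case: (k < N.+1)%N; rewrite ?mulr0// !mulr1.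
  have h : t <= k%:R - m 1 by rewrite lerD2r ler_nat.
  by rewrite lerXn2r ?nnegrE ?(ltW t0)// (le_trans (ltW t0)).
have h3 := HN N (leqnn N).
have t2 : 0 < t ^+ 2 by rewrite exprn_gt0.
have h4 : Ex nu idfun (fun k => (N < k)%N%:R) * t ^+ 2 <= e.
  by rewrite -ler_pdivlMr.
have h5 := ler_wpM2r (ltW t2) h1.
by move: h5; rewrite mulrDl; lra.
Qed.

(** The birth rates [(N' - k) * p / q], with [N' = n + lam / p], are positive
    for [k < K] only, where [K] is the ceiling of [N']. The tails beyond [K] are at most
    [7 * dd i] for every [i]; as the mean of the total is at most the sum of
    the eight-term sums, they are absorbed with the factor 7. Rounding [n]
    leaves the multiple [delta * p ^ 2 / q] of the first difference. *)
Lemma binomial_case (n : nat) (p lam delta : R) :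
  n%:Z = Num.floor (- (4 * G2 ^+ 3 / G3 ^+ 2)) ->
  p = - (G3 / (2 * G2)) -> lam = m 1 - n%:R * p ->
  delta = - (4 * G2 ^+ 3 / G3 ^+ 2) - n%:R ->
  (1 <= n)%N -> 0 < p < 1 -> 0 < lam ->
  lam * p / (1 - p) < p * (Num.floor (n%:R + lam / p))%:~R / 2 ->
  (dTV (pushforward P W) (law_M1 n p lam) <=
   (Theta1 n p lam * (\sum_i 9 * ((1 - - (p / (1 - p))) * S8 i
      + - (p / (1 - p)) * S4 i) * dd i + delta * p ^+ 2 / (1 - p)))%:E)%E.
Proof.
move=> nE pE lE dE n1 p01 l0 hsmall; have /andP[p0 p1] := p01.
set q : R := 1 - p; have q0 : 0 < q by rewrite subr_gt0.
have m10 := mean_ge0.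
set G2' := G2 in nE pE dE *; set G3' := G3 in nE pE dE *.
set F : R := (Num.floor (n%:R + lam / p))%:~R in hsmall *.
set b := p / q; have b0 : 0 < b by rewrite divr_gt0.
have G3n : G3' != 0.
  by apply/eqP => h; move: p0; rewrite pE h mul0r oppr0 ltxx.
have G2n : G2' != 0.
  by apply/eqP => h; move: p0; rewrite pE h mulr0 invr0 mulr0 oppr0 ltxx.
set xx := - (4 * G2' ^+ 3 / G3' ^+ 2) in nE dE *.
have nux : (n%:R + delta) * p ^+ 2 = - G2'.
  by rewrite dE addrC subrK /xx pE; field; rewrite G2n G3n.
have d0 : 0 <= delta.
  rewrite dE subr_ge0.
  by have := floor_le xx; rewrite -nE.
pose N' : R := n%:R + lam / p.
have N'1 : 1 <= N' by rewrite /N' ler_wpDr ?ler1n// divr_ge0// ltW.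
have N'0 : 0 < N' by exact: lt_le_trans N'1.
have mN : m 1 = N' * p by rewrite /N' lE; field; rewrite gt_eqF.
have FN : F <= N' by exact: floor_le.
have lqF : lam < q * F / 2.
  have : lam * p / q < p * F / 2 by exact: hsmall.
  rewrite ltr_pdivrMr// => h.
  by rewrite -(ltr_pM2r p0); apply: lt_le_trans h _; rewrite le_eqVlt; apply/orP; left; apply/eqP; ring.
have F0 : 0 < F.
  have : 0 < q * F by move: l0 lqF; lra.
  by rewrite pmulr_rgt0.
pose be := - b.
have be1 : 1 - be = q^-1 by rewrite /be /b /q; field; rewrite -/q gt_eqF.
have alE k : (1 - be) * m 1 + be * k%:R = (N' - k%:R) * (p / q).
  by rewrite be1 mN /be /b; field; rewrite gt_eqF.
have exK : exists K, N' <= K%:R.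
  by exists (Num.truncn N').+1; exact/ltW/truncnS_gt.
pose K := ex_minn exK.
have [NK Kmin] : N' <= K%:R /\ forall i, (i < K)%N -> i%:R < N'.
  rewrite /K; case: ex_minnP => k hk kmin; split => // i ik.
  by rewrite ltNge; apply/negP => /kmin; rewrite leqNgt ik.
have K0 : (0 < K)%N.
  by rewrite lt0n; apply/eqP => h; move: NK; rewrite h leNgt N'0.
have bnd0 k : 0 <= binomial_pmf n p k by apply: binomial_pmf_ge0; rewrite !ltW.
have poi0 k : 0 <= poisson_pmf lam k by exact: poisson_pmf_ge0.
have p01' : 0 <= p <= 1 by rewrite !ltW.
have sumb : \esum_(k in [set: nat]) (binomial_pmf n p k)%:E = 1%E.
  have : binomial_prob n p setT = 1%E by exact: probability_setT.
  by rewrite /binomial_prob p01'.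
have mb i : binomial_prob n p [set i] = (binomial_pmf n p i)%:E.
  by rewrite /binomial_prob p01' esum_set1// lee_fin.
have [nu lawE nuE] := law_conv_probability bnd0 poi0 mb
  (fun k => poisson_law_mass k l0) sumb (poisson_pmf_total l0).
have [rec1 rec2] := conv_mass_recursion (fun k => binomial_pmfS n k p01)
  (fun k => poisson_pmfS k l0).
have alq : n%:R * p / (1 - p) + lam = (1 - be) * m 1 + lam * be.
  rewrite be1 lE -/q; move: (gt_eqF q0) => qn; rewrite /be /b.
  rewrite (_ : m 1 = n%:R * p + lam); last by rewrite lE addrC subrK.
  by rewrite /q; field; rewrite -/q qn.
rewrite -/q -/b -/be in rec1 rec2; rewrite -/q in alq; rewrite alq in rec1 rec2.
set th := theta1 n p lam.
have thE : th = lam / (F * q) by [].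
have Fq : 0 < F * q by rewrite mulr_gt0.
have th1 : 2 * th < 1.
  by rewrite thE mulrA ltr_pdivrMr// mul1r; move: lqF; lra.
have hTh : Theta1 n p lam = (F * p)^-1 / (1 - 2 * th).
  rewrite /Theta1 -/th -/q {1}thE; field.
  by rewrite !gt_eqF// subr_gt0.
set s := N' * p; have s0 : 0 < s by rewrite mulr_gt0.
have Fs : F * p <= s by rewrite ler_wpM2r// ltW.
have Fp0 : 0 < F * p by rewrite mulr_gt0.
have normE : `|lam * be| = lam * b by rewrite /be mulrN normrN ger0_norm// mulr_ge0 ?ltW.
have th2 : `|lam * be| / s <= th.
  rewrite normE thE /s /b ler_pdivrMr// mulrAC ler_pdivlMr//.
  rewrite (_ : lam * (p / q) * (F * q) = lam * p * F); last by field; rewrite gt_eqF.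
  by rewrite [N' * p]mulrC mulrA ler_wpM2l// mulr_ge0// ltW.
set VM := (m 1 - lam * be) / (1 - be).
have VME : VM = p * (N' * q + lam).
  by rewrite /VM be1 invrK /be /b mN; field; rewrite gt_eqF.
have varE := total_varE.
set v := total_var P Y in varE *.
have vVM : v <= VM.
  have -> : v = m 1 + G2' by rewrite varE /G2'; ring.
  have -> : VM = m 1 - n%:R * p ^+ 2.
    rewrite VME mN (_ : N' * q = n%:R * q + lam / p * q); last by rewrite /N'; ring.
    by rewrite /N' /q; field; rewrite gt_eqF.
  rewrite lerD2l; move: nux; rewrite mulrDl => nux.
  have := mulr_ge0 d0 (sqr_ge0 p); lra.
have lNq : lam <= N' * q / 2.
  apply/ltW/(lt_le_trans lqF); rewrite ler_pM2r// mulrC.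
  by rewrite ler_wpM2r// ltW.
have Nq0 : 0 < N' * q by rewrite mulr_gt0.
have VMle : VM <= 3 / 2 * (N' * q).
  rewrite VME; apply: (@le_trans _ _ (N' * q + lam)); last by lra.
  by rewrite ler_piMl ?(ltW p1)// addr_ge0// ltW.
have tK : N' * q <= K.+1%:R - m 1.
  rewrite mN -natr1 /q; move: NK; lra.
have mK : m 1 < K.+1%:R by rewrite -subr_gt0; exact: lt_le_trans tK.
(* By Chebyshev a tail [x] satisfies [x * (N' * q) ^ 2 <= VM], and
   [v <= VM <= 3 / 2 * (N' * q)]; hence [x * v <= 9 / 4 <= 7 / 3]. *)
set w := Num.max v 1; set tau := 7 / 3 / w.
have w1 : 1 <= w by rewrite /w le_max lexx orbT.
have w0 : 0 < w by exact: lt_le_trans w1.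
have mid j : measurable ((@idfun nat) @^-1` [set j]) by [].
have tail_tau (x : R) : x <= 1 -> x * (K.+1%:R - m 1) ^+ 2 <= VM -> x <= tau.
  move=> x1 xV; rewrite /tau ler_pdivlMr//.
  have [v1|v1] := leP v 1; first by rewrite /w (max_idPr v1); lra.
  rewrite /w (max_idPl (ltW v1)).
  have t2 : (N' * q) ^+ 2 <= (K.+1%:R - m 1) ^+ 2.
    by rewrite lerXn2r ?nnegrE ?(ltW Nq0)// (le_trans (ltW Nq0)).
  have Nq2 : 0 < (N' * q) ^+ 2 by rewrite exprn_gt0.
  have [x0|x0] := leP x 0.
    by apply: (@le_trans _ _ 0); [rewrite mulr_le0_ge0//; lra|lra].
  have xV2 : x * (N' * q) ^+ 2 <= VM by apply: le_trans xV; rewrite ler_wpM2l// ltW.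
  have vv : VM * v <= (3 / 2 * (N' * q)) ^+ 2.
    rewrite expr2; apply: ler_pM => //; [by lra|by lra|].
    exact: le_trans VMle.
  have h : x * v * (N' * q) ^+ 2 <= 7 / 3 * (N' * q) ^+ 2.
    rewrite mulrAC; apply: (@le_trans _ _ (VM * v)).
      by rewrite ler_wpM2r//; lra.
    by apply: le_trans vv _; rewrite exprMn; lra.
  by rewrite -(ler_pM2r Nq2).
have tail_le1 d' (T' : measurableType d') (Q : probability T' R) (Z : T' -> nat)
    (mZ : forall v, measurable (Z @^-1` [set v])) :
    Ex Q Z (fun k => (K < k)%N%:R) <= 1.
  rewrite -[leRHS](Ex_cst Q Z); apply: le_Ex; [exact: (integ_ind Q mZ)|exact: integ_cst|].
  by move=> k; rewrite lern1 leq_b1.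
have t1 : Ex P W (fun k => (K < k)%N%:R) <= tau.
  apply: tail_tau; first exact: (tail_le1 _ _ P W measurable_total).
  by apply: le_trans vVM; exact: chebyshev_total.
have be0 : be < 0 by rewrite oppr_lt0.
have t2 : Ex nu idfun (fun k => (K < k)%N%:R) <= tau.
  apply: tail_tau; first exact: (tail_le1 _ _ nu idfun mid).
  exact: (target_tail nuE rec1 rec2).
have hc2 : (1 - be) * G3' / 2 = be * G2'.
  have -> : G3' = - (2 * G2' * p) by rewrite pE; field.
  by rewrite be1 /be /b; field; rewrite gt_eqF.
have sm : 2 * (`|lam * be| / s) < 1 by apply: le_lt_trans th1; rewrite ler_pM2l.
have sK : s <= K%:R.
  by apply: le_trans NK; rewrite /s ler_piMr ?ltW.
have := @approximation nu (law_M1 n p lam) (conv_mass (binomial_pmf n p)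
    (poisson_pmf lam)) be lam s tau K lawE nuE rec1 rec2 (ltac:(lra)) hc2 s0 sK K0.
move=> /(_ _ _ sm t1 t2)/wrap[].
- by move=> k kK; rewrite alE mulr_gt0 ?divr_gt0// subr_gt0 Kmin.
- move=> k kK; apply: (@binomial_stein_factor R N' p q) => //.
  by rewrite /q; ring.
move=> h; apply: le_trans h _; rewrite lee_fin.
have c1 : be * (m 1 - lam) - (1 - be) * G2' = delta * p ^+ 2 / q.
  have -> : G2' = - ((n%:R + delta) * p ^+ 2) by rewrite nux opprK.
  by rewrite be1 lE /be /b; field; rewrite gt_eqF.
rewrite -/G2' c1.
have dpq0 : 0 <= delta * p ^+ 2 / q by apply: divr_ge0 (ltW q0); rewrite mulr_ge0 ?sqr_ge0.
rewrite (ger0_norm dpq0).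
have dd0 i : 0 <= dd i := ess_smooth_ge0 P mX (C i).
have nbe : `|be| = b by rewrite normrN ger0_norm// ltW.
rewrite nbe be1.
have qVE : q^-1 = 1 + b by rewrite /b /q; field; rewrite -/q gt_eqF.
have S8Q i : [/\ 0 <= Q2 i, Q2 i <= Q3 i, Q3 i = S8 i - S4 i & 0 <= S4 i].
  have [h1 h2 h3] := rem2_bounds i; split => //; first exact: rem3E.
  exact: le_trans h3.
have tau_dd i : tau <= 7 * dd i.
  have := smooth_lower i (integ_moment (isT : 2 <= 4)%N).
  rewrite -/v -/w /tau => hl.
  by rewrite (_ : 7 / 3 / w = 7 * (1 / 3 / w)) ?ler_pM2l//; field; rewrite gt_eqF.
have tauS : tau <= (F * p)^-1 * \sum_i 7 * S8 i * dd i.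
  rewrite ler_pdivlMl//.
  apply: (@le_trans _ _ (m 1 * tau)).
    by rewrite mN ler_wpM2r// /tau divr_ge0// ltW.
  rewrite mean_total mulr_suml; apply: ler_sum => i _.
  rewrite (_ : 7 * S8 i * dd i = S8 i * (7 * dd i)); last by ring.
  apply: ler_pM => //.
  - exact: Ex_ge0.
  - by rewrite /tau divr_ge0// ltW.
  - exact: mean_le_S8.
have mainS : s^-1 * (delta * p ^+ 2 / q + \sum_i dd i * (q^-1 * Q3 i + b * Q2 i))
    <= (F * p)^-1 * (delta * p ^+ 2 / q +
      \sum_i dd i * (2 * (S8 i + b * (S8 i - S4 i)))).
  apply: ler_pM.
  - by rewrite invr_ge0 ltW.
  - apply: addr_ge0 => //; apply: sumr_ge0 => i _; rewrite mulr_ge0//.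
    have [h1 h2 _ _] := S8Q i.
    by rewrite addr_ge0// mulr_ge0 ?invr_ge0 ?(ltW b0) ?(ltW q0)// (le_trans h1).
  - by rewrite lef_pV2.
  - rewrite lerD2l; apply: ler_sum => i _; rewrite ler_wpM2l//.
    have [h1 h2 h3 h4] := S8Q i; rewrite -h3.
    have h5 := ler_wpM2l (ltW b0) h2.
    have h6 := mulr_ge0 (ltW b0) h1.
    by rewrite qVE mulrDl mul1r; move: h1 h2 h3 h4 h5 h6; lra.
set Bs := s^-1 * _ in mainS *.
have total : Bs + tau <= (F * p)^-1 * (\sum_i 9 * (q^-1 * S8 i + be * S4 i) * dd i
    + delta * p ^+ 2 / q).
  apply: le_trans (lerD mainS tauS) _; rewrite -mulrDr ler_pM2l ?invr_gt0//.
  rewrite -addrA addrC lerD2r -big_split/=; apply: ler_sum => i _.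
  have [h1 h2 h3 h4] := S8Q i.
  have h5 := mulr_ge0 (ltW b0) (mulr_ge0 (le_trans h1 h2) (dd0 i)).
  rewrite h3 in h5.
  have alg (u v' z : R) : 9 * ((1 + b) * u + - b * v') * z -
      (z * (2 * (u + b * (u - v'))) + 7 * u * z) = 7 * (b * ((u - v') * z)).
    by ring.
  by rewrite qVE /be -subr_ge0 alg mulr_ge0.
have D0 : 0 < 1 - 2 * th by rewrite subr_gt0.
have D1 : 1 - 2 * th <= 1 - 2 * (`|lam * be| / s).
  by rewrite lerD2l lerN2 ler_pM2l.
have Bs0 : 0 <= Bs + tau.
  apply: addr_ge0; last by rewrite /tau divr_ge0// ltW.
  apply: mulr_ge0; first by rewrite invr_ge0 ltW.
  apply: addr_ge0; first exact: dpq0.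
  apply: sumr_ge0 => i _; apply: mulr_ge0; first exact: dd0.
  have [h1 h2 _ _] := S8Q i.
  by rewrite addr_ge0// mulr_ge0 ?invr_ge0 ?(ltW b0) ?(ltW q0)// (le_trans h1).
rewrite hTh mulrAC; apply: (@le_trans _ _ ((Bs + tau) / (1 - 2 * th))).
  by rewrite ler_wpM2l// lef_pV2// posrE; exact: lt_le_trans D1.
by rewrite ler_wpM2r// invr_ge0 ltW.
Qed.

End Approximation.

(** * Infinite fourth moment *)

Section Positivity.
Context {R : realType}.

Lemma Theta2_gt0 (r pbar lam : R) : 0 < r -> 0 < pbar < 1 -> 0 < lam ->
  lam * (1 - pbar) < (r * (1 - pbar) + lam * pbar) / 2 -> 0 < Theta2 r pbar lam.
Proof.
move=> r0 /andP[p0 p1] l0 h.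
have q0 : 0 < 1 - pbar by rewrite subr_gt0.
have al0 : 0 < r * (1 - pbar) + lam * pbar by rewrite addr_gt0 ?mulr_gt0.
have th0 : 0 < theta2 r pbar lam by rewrite divr_gt0 ?mulr_gt0.
have th1 : 2 * theta2 r pbar lam < 1.
  by rewrite /theta2 mulrA ltr_pdivrMr// mul1r; lra.
by rewrite divr_gt0// !mulr_gt0// subr_gt0.
Qed.

Lemma Theta1_gt0 (n : nat) (p lam : R) : 0 < p < 1 -> 0 < lam ->
  lam * p / (1 - p) < p * (Num.floor (n%:R + lam / p))%:~R / 2 ->
  0 < Theta1 n p lam.
Proof.
move=> /andP[p0 p1] l0; rewrite /Theta1 /theta1; set F : R := _%:~R => h.
have q0 : 0 < 1 - p by rewrite subr_gt0.
have pF : 0 < p * F / 2 by apply: le_lt_trans h; rewrite divr_ge0 ?mulr_ge0 ?ltW.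
have F0 : 0 < F by move: pF; rewrite pmulr_lgt0// pmulr_rgt0.
have th0 : 0 < lam / (F * (1 - p)) by rewrite divr_gt0 ?mulr_gt0.
have th1 : 2 * (lam / (F * (1 - p))) < 1.
  rewrite mulrA ltr_pdivrMr ?mulr_gt0// mul1r -(ltr_pM2r p0).
  by move: h; rewrite ltr_pdivrMr//; lra.
have D0 : 0 < 1 - 2 * (lam / (F * (1 - p))) by rewrite subr_gt0.
by apply: divr_gt0; [exact: mulr_gt0|apply: mulr_gt0 => //; exact: mulr_gt0].
Qed.

End Positivity.

Section InfiniteFourthMoment.
Context {d : measure_display} {T : measurableType d} {R : realType}.
Variable P : probability T R.
Context {I : finType}.
Local Notation V := {ffun I -> nat}.
Variable X : I -> T -> nat.
Hypothesis mX : forall i, measurable_fun setT (X i).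
Local Notation Y := (outcome X).
Local Notation mY := (measurable_outcome mX).
Variables (A B C : I -> {set I}).
Hypothesis loc : locally_dependent P X A B C.
Local Notation nr u := (fun x : V => (u x)%:R : R).
Local Notation B8 i :=
  (bracketE P (X i) [:: subsum X (A i); subsum X (B i); subsum X (C i)]).

Lemma nmean_integ (u : V -> nat) : nmean P (u \o Y) != +oo%E -> integ P Y (nr u).
Proof.
rewrite /nmean unlock => u_fin; apply/integrableP; split.
  by apply/measurable_EFinP; exact: (measurable_fun_countable mY (nr u)).
rewrite (_ : (fun t => _) = (fun t => ((u \o Y) t)%:R%:E)); last first.
  by apply/funext => t /=; rewrite ger0_norm.
by rewrite ltey.
Qed.

(** The term in which all the optional expectation signs are deleted. *)
Lemma nmean_le_bracketE (Z : T -> nat) (s : seq (T -> nat)) :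
  (nmean P (fun t => Z t * \prod_(z <- s) z t)%N <= bracketE P Z s)%E.
Proof.
elim: s Z => [|z s IH] Z /=.
  by under eq_fun do rewrite big_nil muln1.
under eq_fun do rewrite big_cons mulnA.
by apply: le_trans (IH _) _; rewrite leeDl// mule_ge0 ?nmean_ge0 ?bracketE_ge0.
Qed.

Lemma tots_pow4_le (x : V) : (tots x ^ 4 <= #|I| ^ 4 * \sum_i x i ^ 4)%N.
Proof.
have [i0 xi0|none] := pickP (@predT I); last first.
  by rewrite /tots big1 ?exp0n// => i; have := none i.
have [i xi] : exists i, (tots x <= #|I| * x i)%N.
  have [|i imax] := @bigop.eq_bigmax _ x; first by apply/card_gt0P; exists i0.
  exists i; rewrite -sum_nat_const -imax /tots.
  by apply: leq_sum => j _; exact: leq_bigmax.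
apply: leq_trans (_ : (#|I| * x i) ^ 4 <= _)%N; first by rewrite leq_exp2r.
by rewrite expnMn leq_mul2l (bigD1 i)//= leq_addr orbT.
Qed.

(** Since [X_i <= X_A <= X_B <= X_C], the product of the four dominates
    [X_i ^ 4]. *)
Lemma fourth_moment_or_infinite_bracket :
  integ P Y (fun x => (tots x)%:R ^+ 4) \/ exists i, B8 i = +oo%E.
Proof.
case: (pselect (exists i, B8 i = +oo%E)) => [|fin]; [by right|left].
have i4 i : integ P Y (fun x => (x i)%:R ^+ 4).
  have [[iA AB BC] _] := loc i.
  pose u (x : V) := (x i * (tot (A i) x * (tot (B i) x * (tot (C i) x * 1))))%N.
  have iu : integ P Y (nr u).
    apply: nmean_integ; apply: contra_not_neq fin => u_oo; exists i.
    apply/eqP; rewrite -leye_eq -u_oo.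
    rewrite [X in (X <= _)%E](_ : _ = nmean P (fun t => X i t *
       \prod_(z <- [:: subsum X (A i); subsum X (B i); subsum X (C i)]) z t)%N).
      exact: nmean_le_bracketE.
    congr nmean; apply/funext => t.
    by rewrite !big_cons big_nil /u outcome_coord !outcome_tot.
  apply: (integ_le mY iu) => x; rewrite ger0_norm ?exprn_ge0// -natrX ler_nat.
  have le_tot (S : {set I}) : i \in S -> (x i <= tot S x)%N.
    by move=> iS; rewrite /tot (bigD1 i)//= leq_addr.
  have iB := fintype.subsetP AB _ iA; have iC := fintype.subsetP BC _ iB.
  by rewrite /u !expnS expn0 !leq_mul ?le_tot.
apply: (@integ_le _ _ _ P _ Y mY _ (fun x => (#|I| ^ 4)%:R * \sum_i (x i)%:R ^+ 4)).
  by apply: (integZ _ (integ_sum _ _ _)).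
move=> x; rewrite ger0_norm ?exprn_ge0//.
under eq_bigr do rewrite -natrX.
by rewrite -natr_sum -natrM -natrX ler_nat tots_pow4_le.
Qed.

Hypothesis W3 : integ P Y (fun x => (tots x)%:R ^+ 3).

Lemma integ_total2 : integ P Y (fun x => (tots x)%:R ^+ 2).
Proof.
apply: (integ_le mY W3) => x; rewrite ger0_norm ?exprn_ge0// -!natrX ler_nat.
by case: (tots x) => // k; rewrite leq_pexp2l.
Qed.

(** The four-term sums contain moments of order three only, so nothing can
    cancel an infinite eight-term sum, and the smoothness that multiplies it
    is positive by [smooth_lower]. *)
Lemma Xi_infinite be : be < 1 -> (exists i, B8 i = +oo%E) ->
  (\sum_i Xi P X A B C be i = +oo)%E.
Proof.
move=> be1 [i0 i0oo].
have be0 : 0 < 1 - be by rewrite subr_gt0.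
have dd0 i : (0 < (ess_smooth P X (C i))%:E)%E.
  rewrite lte_fin; apply: lt_le_trans (@smooth_lower _ _ _ P _ X mX C i integ_total2).
  by rewrite !divr_gt0// lt_max ltr01 orbT.
have XiE i : Xi P X A B C be i = (if B8 i == +oo%E then +oo%E else
    (fine (Xi P X A B C be i))%:E).
  rewrite /Xi (@bracketE4 _ _ _ P _ X mX B C 3 i (leqnn 3) W3) (ess_smoothE P mX).
  have := bracketE_ge0 P (X i) [:: subsum X (A i); subsum X (B i); subsum X (C i)].
  case: (B8 i) => [b _|_|//]; first by rewrite -!EFinM.
  by rewrite eqxx gt0_muley ?lte_fin// addye// gt0_muley// gt0_mulye.
apply/eqP; rewrite esum_eqy; last by move=> i _; rewrite XiE; case: ifP.
by apply/existsP; exists i0; rewrite XiE i0oo.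
Qed.

End InfiniteFourthMoment.
(** * Approximation of sums of locally dependent variables *)

Theorem theorem1p1 (R : realType) (d : measure_display) (T : measurableType d)
    (P : probability T R) (J : {fset nat}) (X : J -> {RV P >-> nat})
    (A B C : J -> {set J}) :
  let W : T -> nat := rvsum X in
  let Gamma2 := fact_cumulant P 2 W in
  let Gamma3 := fact_cumulant P 3 W in
  let EW : R := fine (nmean P W) in
  locally_dependent P X A B C ->
  ('E_P[fun t => ((W t)%:R ^+ 3)%R] < +oo)%E ->
  (forall r pbar lambda : R,
     r = 4 * Gamma2 ^+ 3 / Gamma3 ^+ 2 ->
     pbar = 2 * Gamma2 / (2 * Gamma2 + Gamma3) ->
     lambda = EW - r * (1 - pbar) / pbar ->
     0 < r -> 0 < pbar < 1 -> 0 < lambda ->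
     (nmean P W < 'V_P[fun t => (W t)%:R%R])%E ->
     lambda * (1 - pbar) < (r * (1 - pbar) + lambda * pbar) / 2 ->
     (dTV (pushforward P W) (law_M2 r pbar lambda) <=
      (Theta2 r pbar lambda)%:E * \sum_i Xi P X A B C (1 - pbar) i)%E)
  /\
  (forall (n : nat) (p lambda delta : R),
     n%:Z = Num.floor (- (4 * Gamma2 ^+ 3 / Gamma3 ^+ 2)) ->
     p = - (Gamma3 / (2 * Gamma2)) ->
     lambda = EW - n%:R * p ->
     delta = - (4 * Gamma2 ^+ 3 / Gamma3 ^+ 2) - n%:R ->
     (1 <= n)%N -> 0 < p < 1 -> 0 < lambda ->
     (nmean P W > 'V_P[fun t => (W t)%:R%R])%E ->
     lambda * p / (1 - p) < p * (Num.floor (n%:R + lambda / p))%:~R / 2 ->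
     (dTV (pushforward P W) (law_M1 n p lambda) <=
      (Theta1 n p lambda)%:E *
        (\sum_i Xi P X A B C (- (p / (1 - p))) i +
         (delta * p ^+ 2 / (1 - p))%:E))%E).

Proof.
move=> W Gamma2 Gamma3 EW loc W3E.
have mX i : measurable_fun setT (X i) by exact: measurable_funPT.
have mW := measurable_total mX.
set Y := outcome X.
have W3 : integ P Y (fun x => (tots x)%:R ^+ 3).
  rewrite -(integ_total P X (fun k => k%:R ^+ 3 : R)).
  apply/integrableP; split.
    apply/measurable_EFinP; exact: (measurable_fun_countable mW (fun k => k%:R ^+ 3 : R)).
  move: W3E; rewrite unlock; congr (_ < _)%E; apply: eq_integral => t _ /=.
  by rewrite ger0_norm// exprn_ge0.
have [W4|infinite] := fourth_moment_or_infinite_bracket mX loc; last first.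
  split.
    move=> r pbar lam _ _ _ r0 p01 l0 _ small; have /andP[p0 p1] := p01.
    rewrite (Xi_infinite mX W3 _ infinite); last by rewrite gtrBl.
    by rewrite gt0_muley ?leey// lte_fin Theta2_gt0.
  move=> n p lam delta _ _ _ _ _ p01 l0 _ small; have /andP[p0 p1] := p01.
  rewrite (Xi_infinite mX W3 _ infinite); last first.
    by rewrite (@lt_trans _ _ 0) ?oppr_lt0 ?divr_gt0 ?subr_gt0.
  by rewrite addye// gt0_muley ?leey// lte_fin Theta1_gt0.
have W4' : integ P W (fun k => k%:R ^+ 4) by rewrite integ_total.
have EWE : EW = Ex P Y (fun x => (tots x)%:R ^+ 1).
  rewrite /EW /W rvsum_outcome nmeanE//.
  exact: (integ_moment mX W4 (k := 1)).
have G2E := fact_cumulant2 mW W4'; have G3E := fact_cumulant3 mW W4'.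
rewrite -/Gamma2 !Ex_total in G2E; rewrite -/Gamma3 !Ex_total in G3E.
split.
  move=> r pbar lam; rewrite G2E G3E EWE => rE pE lE r0 p01 l0 _ small.
  apply: le_trans (negbin_case mX loc W4 rE pE lE r0 p01 l0 small) _.
  under [X in (_ <= _ * X)%E]eq_bigr do rewrite (Xi_real mX _ _ _ _ _ W4).
  rewrite sumEFin -EFinM lee_fin; apply: ler_wpM2l; first exact/ltW/Theta2_gt0.
  have /andP[p0 p1] := p01.
  apply: ler_sum => i _.
  have [h1 h2 h3] := rem2_bounds mX loc W4 i; have h4 := rem3E mX loc W4 i.
  have alg (u v z : R) : 9 * ((1 - (1 - pbar)) * u + (1 - pbar) * v) * z =
      z * (9 * (pbar * u + (1 - pbar) * v)) by ring.
  rewrite alg; apply: ler_wpM2l; first exact: (ess_smooth_ge0 P mX).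
  have q0 : 0 <= 1 - pbar by rewrite subr_ge0 ltW.
  have h5 := ler_wpM2l q0 h3.
  have h6 := mulr_ge0 (ltW p0) (le_trans h1 h2).
  have h7 := mulr_ge0 (ltW p0) (le_trans h1 h3).
  have h8 := mulr_ge0 q0 (le_trans h1 h3).
  by rewrite h4 in h6 *; lra.
move=> n p lam delta; rewrite G2E G3E EWE => nE pE lE dE n1 p01 l0 _ small.
apply: le_trans (binomial_case mX loc W4 nE pE lE dE n1 p01 l0 small) _.
under [X in (_ <= _ * (X + _))%E]eq_bigr do rewrite (Xi_real mX _ _ _ _ _ W4).
by rewrite sumEFin -EFinD -EFinM.
Qed.
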